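(* Let $0<E_-<E_+<\infty$ and let $E\mapsto\psi_E\in H^2(\mathbb{R}^n,\mathbb{C})$, $E\in(E_-,E_+)$, be a $C^1$ curve such that for each $E\in(E_-,E_+)$ the pair $(\psi_E,E)$ is a solution of $$-\Delta\psi+V\psi+\sigma|\psi|^{2p}\psi+E\psi=0\quad\text{on }\mathbb{R}^n.$$ Then $\|\psi_E\|_{L^2}$, $\|\psi_E\|_{H^1}$ and $\|\psi_E\|_{H^2}$ are uniformly bounded for $E\in(E_-,E_+)$.
   Context: Standing assumptions: $n\ge1$; $0<p<2/(n-2)$ if $n\ge3$ and $0<p<\infty$ if $n=1,2$; $\sigma\in\mathbb{R}$; $V:\mathbb{R}^n\to\mathbb{R}$ satisfies $V\in L^\infty(\mathbb{R}^n)$ and $\lim_{|x|\to\infty}V(x)=0$. The Hilbert spaces $H^2(\mathbb{R}^n,\mathbb{C})$, $L^2(\mathbb{R}^n,\mathbb{C})$ are regarded as real Banach spaces, so $C^1$ means continuously differentiable from the real interval to the real Banach space $H^2$. *)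

(* Defs.v *)
From HB Require Import structures.
From mathcomp Require Import all_boot all_order all_algebra.
From mathcomp Require Import all_classical all_reals all_analysis.
From mathcomp Require Import complex.

Set Implicit Arguments.
Unset Strict Implicit.
Unset Printing Implicit Defensive.

Import Order.TTheory GRing.Theory Num.Theory.
Import numFieldNormedType.Exports.

Local Open Scope classical_set_scope.
Local Open Scope ring_scope.

(* The sigma-algebra on 'rV[R]_n generated by the coordinates, i.e. the Borel
   one. The library only provides it on tuples, which carry no topology. *)
Definition rV_display : measure_display -> measure_display.
Proof. exact. Qed.

Section measurable_rV.
Context {R : realType} (n : nat).

Let coors : 'I_n -> 'rV[R]_n -> R := fun i x => x ord0 i.

Let rV_set0 : g_sigma_preimage coors set0.
Proof. exact: sigma_algebra0. Qed.

Let rV_setC A : g_sigma_preimage coors A -> g_sigma_preimage coors (~` A).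
Proof. exact: sigma_algebraC. Qed.

Let rV_bigcup (F : _^nat) : (forall i, g_sigma_preimage coors (F i)) ->
  g_sigma_preimage coors (\bigcup_i (F i)).
Proof. exact: sigma_algebra_bigcup. Qed.

HB.instance Definition _ :=
  @isMeasurable.Build (rV_display default_measure_display)
  'rV[R]_n (g_sigma_preimage coors) rV_set0 rV_setC rV_bigcup.

End measurable_rV.

Lemma measurable_rV_coord (R : realType) n (i : 'I_n) :
  measurable_fun [set: 'rV[R]_n] (fun x => x ord0 i).
Proof.
move=> _ Y mY; rewrite setTI; apply: sub_sigma_algebra => /=.
rewrite -bigcup_seq/=; exists i => /=; first by rewrite mem_index_enum.
by exists Y => //; rewrite setTI.
Qed.

Lemma measurable_fun_rVP d (T : measurableType d) (R : realType) n
    (f : T -> 'rV[R]_n) :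
  measurable_fun [set: T] f <->
  forall i, measurable_fun [set: T] (fun x => f x ord0 i).
Proof.
split=> [mf i|mf].
  exact: (measurableT_comp (measurable_rV_coord i) mf).
apply: (@measurability _ _ _ _ setT f
  (\big[setU/set0]_(i < n) preimage_set_system setT
     (fun x : 'rV[R]_n => x ord0 i) measurable)) => //.
move=> _ [B BB <-].
move: BB; rewrite -bigcup_seq => -[i _ [C mC <-]].
by rewrite !setTI; have := mf i measurableT C mC; rewrite setTI.
Qed.

Section cons_rV.
Context {R : realType} (n : nat).

Definition cons_rV (y : measurableTypeR R * 'rV[R]_n) : 'rV[R]_n.+1 :=
  \row_i (if unlift ord0 i is Some j then y.2 ord0 j else y.1 : R).

Definition uncons_rV (x : 'rV[R]_n.+1) : measurableTypeR R * 'rV[R]_n :=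
  (x ord0 ord0, \row_i x ord0 (lift ord0 i)).

Lemma cons_rV0 y : cons_rV y ord0 ord0 = y.1.
Proof. by rewrite mxE unlift_none. Qed.

Lemma cons_rVS y i : cons_rV y ord0 (lift ord0 i) = y.2 ord0 i.
Proof. by rewrite mxE liftK. Qed.

Lemma cons_rVK : cancel cons_rV uncons_rV.
Proof.
move=> [a v]; congr pair; first exact: cons_rV0.
by apply/rowP => i; rewrite mxE cons_rVS.
Qed.

Lemma measurable_cons_rV : measurable_fun setT cons_rV.
Proof.
apply/measurable_fun_rVP => i; case: (unliftP ord0 i) => [j ->|->].
  under eq_fun do rewrite cons_rVS.
  exact: (measurableT_comp (measurable_rV_coord j) measurable_snd).
under eq_fun do rewrite cons_rV0.
exact: measurable_fst.
Qed.

Lemma measurable_uncons_rV : measurable_fun setT uncons_rV.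
Proof.
apply/measurable_fun_pairP; split; first exact: measurable_rV_coord.
apply/measurable_fun_rVP => i; rewrite /uncons_rV/=.
under eq_fun do rewrite mxE.
exact: measurable_rV_coord.
Qed.

Variable m : {sigma_finite_measure set 'rV[R]_n -> \bar R}.

Definition cons_measure : set 'rV[R]_n.+1 -> \bar R :=
  pushforward (lebesgue_measure \x m)%E cons_rV.

Let cons_measure0 : cons_measure set0 = 0%E.
Proof. by rewrite /cons_measure /pushforward preimage_set0 measure0. Qed.

Let cons_measure_ge0 A : (0 <= cons_measure A)%E.
Proof. by rewrite /cons_measure /pushforward; exact: measure_ge0. Qed.

Let cons_measure_sigma_additive : semi_sigma_additive cons_measure.
Proof.
move=> F mF tF mUF; rewrite /cons_measure /pushforward preimage_bigcup.
apply: measure_semi_sigma_additive.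
- by move=> k; rewrite -[X in measurable X]setTI; exact: measurable_cons_rV.
- apply/trivIsetP => /= i j _ _ ij; rewrite -preimage_setI.
  by move/trivIsetP : tF => /(_ _ _ _ _ ij) ->//; rewrite preimage_set0.
- rewrite -preimage_bigcup -[X in measurable X]setTI.
  exact: measurable_cons_rV.
Qed.

HB.instance Definition _ := isMeasure.Build _ _ _ cons_measure
  cons_measure0 cons_measure_ge0 cons_measure_sigma_additive.

Let cons_measure_sigma_finite : sigma_finite setT cons_measure.
Proof.
have /sigma_finiteP[F [TF ndF Foo]] := sigma_finiteT (@lebesgue_measure R).
have /sigma_finiteP[G [TG ndG Goo]] := sigma_finiteT m.
exists (fun k => uncons_rV @^-1` (F k `*` G k)).
  rewrite -preimage_bigcup (_ : \bigcup_k (F k `*` G k) = setT) ?preimage_setT//.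
  rewrite -subTset => -[x y] _.
  have [k _ Fkx] : (\bigcup_k F k) x by rewrite -TF.
  have [l _ Gly] : (\bigcup_k G k) y by rewrite -TG.
  exists (maxn k l) => //; split => /=.
    by move: x Fkx; exact/subsetPset/ndF/leq_maxl.
  by move: y Gly; exact/subsetPset/ndG/leq_maxr.
move=> k; have [mF Fkoo] := Foo k; have [mG Gkoo] := Goo k; split.
  rewrite -[X in measurable X]setTI; apply: measurable_uncons_rV => //.
  exact: measurableX.
rewrite /cons_measure /pushforward -comp_preimage.
rewrite (_ : uncons_rV \o cons_rV = id); last first.
  by apply/funext => y; exact: cons_rVK.
by rewrite preimage_id product_measure1E// lte_mul_pinfty// ge0_fin_numE.
Qed.

HB.instance Definition _ := Measure_isSigmaFinite.Build _ _ _ cons_measure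
  cons_measure_sigma_finite.

End cons_rV.

Fixpoint lebesgue_rV (R : realType) (n : nat) :
    {sigma_finite_measure set 'rV[R]_n -> \bar R} :=
  if n is n'.+1 then cons_measure (lebesgue_rV R n')
  else dirac (0 : 'rV[R]_0).

Lemma lebesgue_rV_box (R : realType) (n : nat) (A : 'I_n -> set R) :
  (forall i, measurable (A i)) ->
  lebesgue_rV R n [set x | forall i, A i (x ord0 i)] =
  (\prod_(i < n) lebesgue_measure (A i))%E.
Proof.
elim: n A => [|n IH] A mA.
  rewrite big_ord0 /= diracE mem_set//= => -[]//.
rewrite big_ord_recl /=  -IH//.
rewrite /cons_measure /pushforward -product_measure1E//.
  congr (_ _); apply/seteqP; split => [[a v]/= Aav|[a v]/= [Aa Av] i].
    split=> [|i]; first by have := Aav ord0; rewrite cons_rV0.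
    by have := Aav (lift ord0 i); rewrite cons_rVS.
  by case: (unliftP ord0 i) => [j ->|->]; rewrite ?cons_rVS ?cons_rV0.
  exact: mA.
rewrite [X in measurable X](_ : _ = \bigcap_(i in [set: 'I_n])
    ((fun x : 'rV[R]_n => x ord0 i) @^-1` A (lift ord0 i))); last first.
  by apply/seteqP; split => x Ax i //=; exact: Ax.
apply: fin_bigcap_measurable => // i _.
by rewrite -[X in measurable X]setTI; exact: measurable_rV_coord.
Qed.

Section sobolev.
Context {R : realType} {n : nat}.
Local Notation mu := (lebesgue_rV R n).
Local Notation vec i := (delta_mx ord0 i : 'rV[R]_n).

(* [Rcomplex R] is the type of complex numbers seen as a normed real vector
   space: its norm is R-valued and its scaling is by real numbers. *)
Implicit Types (u v g : 'rV[R]_n -> Rcomplex R) (phi : 'rV[R]_n -> R).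

Definition euclidean_norm (x : 'rV[R]_n) : R :=
  Num.sqrt (\sum_(i < n) x ord0 i ^+ 2).

Definition vanishes_at_infinity phi : Prop :=
  forall e : R, 0 < e ->
    \forall r \near +oo, forall x, r <= euclidean_norm x -> `|phi x| < e.

(* Measurability in the library is Borel measurability; agreeing almost
   everywhere with a Borel function is Lebesgue measurability. *)
Definition in_Linfty phi : Prop :=
  exists2 W : 'rV[R]_n -> R, W \in Lfun mu +oo%E &
    {ae mu, forall x, phi x = W x}.

Definition iter_partial (s : seq 'I_n) phi : 'rV[R]_n -> R :=
  foldr (fun i f => 'D_(vec i) f) phi s.

Definition smooth phi : Prop :=
  forall s : seq 'I_n, continuous (iter_partial s phi) /\
    forall i x, derivable (iter_partial s phi) x (vec i).

Definition test_function phi : Prop :=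
  smooth phi /\ compact (closure [set x | phi x != 0]).

Definition cintegral u : Rcomplex R :=
  ((\int[mu]_x complex.Re (u x)) +i* (\int[mu]_x complex.Im (u x)))%C.

Definition in_L2 u : Prop :=
  (fun x => complex.Re (u x)) \in Lfun mu 2%:E /\
  (fun x => complex.Im (u x)) \in Lfun mu 2%:E.

Definition L2norm u : R := fine (Lnorm mu 2%:E (fun x => `|u x|%:E)).

Definition is_weak_partial (i : 'I_n) u g : Prop :=
  forall phi, test_function phi ->
    cintegral (fun x => 'D_(vec i) phi x *: u x) =
    - cintegral (fun x => phi x *: g x).

(* An L^2 representative of the i-th weak derivative (0 if there is none); it
   is unique up to a null set. *)
Definition weak_partial (i : 'I_n) u : 'rV[R]_n -> Rcomplex R :=
  xget 0 [set g | in_L2 g /\ is_weak_partial i u g].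

Definition in_H1 u : Prop :=
  in_L2 u /\ forall i, exists2 g, in_L2 g & is_weak_partial i u g.

Definition in_H2 u : Prop := in_H1 u /\ forall i, in_H1 (weak_partial i u).

Definition H1norm u : R :=
  Num.sqrt (L2norm u ^+ 2 + \sum_(i < n) L2norm (weak_partial i u) ^+ 2).

Definition H2norm u : R :=
  Num.sqrt (L2norm u ^+ 2 + \sum_(i < n) L2norm (weak_partial i u) ^+ 2 +
    \sum_(i < n) \sum_(j < n)
      L2norm (weak_partial j (weak_partial i u)) ^+ 2).

Definition laplacian u : 'rV[R]_n -> Rcomplex R :=
  \sum_(i < n) weak_partial i (weak_partial i u).

Definition is_solution (V : 'rV[R]_n -> R) (p sigma : R) u (E : R) : Prop :=
  {ae mu, forall x, - laplacian u x + V x *: u x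
    + (sigma * `|u x| `^ (2 * p)) *: u x + E *: u x = 0}.

(* Elements of H^2 are given by representatives, so differentiability and
   continuity for the H^2 norm are spelled out instead of going through a
   normedModType. *)
Definition C1_H2_curve (a b : R) (psi : R -> 'rV[R]_n -> Rcomplex R) : Prop :=
  exists dpsi : R -> 'rV[R]_n -> Rcomplex R,
    forall E, a < E < b ->
      [/\ in_H2 (psi E), in_H2 (dpsi E),
          H2norm (h^-1 *: (psi (E + h) - psi E) - dpsi E) @[h --> 0^'] --> 0
        & H2norm (dpsi F - dpsi E) @[F --> E] --> 0].

End sobolev.

(* Main.v *)
(** With [Q] the integral of [|psi_E|^(2p+2)], [N] that of [|psi_E|^2], and
    [X E F] the real part of the pairing of [|psi_E|^(2p) psi_E] with [psi_F],
    pairing the equations at [E] and [F] with each other's solution gives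
    [sigma (X E F - X F E) = (F - E) <psi_E, psi_F>].  Young's inequality gives
    [(2p + 2) X E F <= Q F + (2p + 1) Q E], whose defect is quadratic in
    [F - E]; therefore [Q' = - (p + 1) / (p sigma) N].  On the other
    hand the equation paired with [psi_E] reads
    [E N + |grad psi_E|^2 = - sigma Q - int V |psi_E|^2], and as [V] is small at
    infinity the last term is at most [(E_- / 2) N + Q + C].  Hence
    [N <= C (Q + 1)], [Q] is bounded by Gronwall's inequality, and with it [N]
    and the gradient.  If [sigma = 0], the first identity forces [N = 0].

    For the second derivatives, [sum |d_ij psi|^2 = |Delta psi|^2], so the
    equation reduces the matter to bounding the L^2 norm of [|psi|^(2p+1)] by
    [C N + eps sum |d_ij psi|^2].  Instead of a Sobolev embedding, split along
    dyadic levels of [|psi|]: on a cube of suitable side [r] the bound on [Q]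
    makes the average of [psi] small compared with the level, so [psi] is
    there comparable with [psi - 2 A psi + A A psi], [A] being the average
    over a cube of side [r], and this has norm at most
    [r^2 sum |d_ij psi|].  Subcriticality makes the sum over high levels
    small. *)
From HB Require Import structures.
Require Import Defs.
From mathcomp Require Import all_boot all_order all_algebra.
From mathcomp Require Import all_classical all_reals all_analysis.
From mathcomp Require Import measurable_realfun ess_sup_inf complex ring lra.

Import Order.TTheory GRing.Theory Num.Theory.
Import numFieldNormedType.Exports.

Local Open Scope classical_set_scope.
Local Open Scope ring_scope.

Set Implicit Arguments.
Unset Strict Implicit.
Unset Printing Implicit Defensive.

(** * Square-integrable functions *)

(** Without an embedding theorem, membership in H^2 does not show that the nonlinear term is square
    integrable, nor that it varies well with [E]. Both facts are read off the equation:
    [sigma |psi|^(2p) psi] agrees a.e. with [Delta psi - V psi - E psi], which is linear in [psi],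
    hence in L^2 and Lipschitz at each [E] along the curve. So the increment of the nonlinear term,
    paired with that of [psi], is of order (F - E)^2. Up to constants this pairing is the sum of the
    Young defects for (E, F) and (F, E). Both defects are nonnegative, so their difference, which is
    the error term in [Q F - Q E], is at most their sum. The dyadic argument closes by scaling. A
    bound on the integral of |psi|^q, q = 2p + 2, asks for cubes of side r of order lam^(-q/n) at
    level lam. The second difference then contributes r^2 and the factor |psi|^(2p) contributes
    lam^(2p), in total lam^(2p - 2q/n). This power is negative exactly when p n < 2p + 2, which for
    n >= 3 is p < 2/(n - 2). *)

Section square_integrable.
Context d (T : measurableType d) (R : realType).
Variable mu : {measure set T -> \bar R}.
Implicit Types f g h : T -> R.

Definition sqint f :=
  measurable_fun setT f /\ mu.-integrable setT (EFin \o (fun x => f x ^+ 2)).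

Definition ip f g : R := \int[mu]_x (f x * g x).

Lemma dom_integrable f g : measurable_fun setT f ->
  mu.-integrable setT (EFin \o g) -> (forall x, `|f x| <= g x) ->
  mu.-integrable setT (EFin \o f).
Proof.
move=> mf ig fg; apply: (le_integrable _ _ _ ig) => //.
  exact/measurable_EFinP.
move=> x _ /=; rewrite lee_fin; apply: le_trans (fg x) _; exact: ler_norm.
Qed.

Lemma integrable_addr f g : mu.-integrable setT (EFin \o f) ->
  mu.-integrable setT (EFin \o g) ->
  mu.-integrable setT (EFin \o (fun x => f x + g x)).
Proof.
move=> fi gi; have := integrableD measurableT fi gi.
by apply: eq_integrable.
Qed.

Lemma integrable_scaler k f : mu.-integrable setT (EFin \o f) ->
  mu.-integrable setT (EFin \o (fun x => k * f x)).
Proof.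
move=> fi; have := integrableZl measurableT k fi.
by apply: eq_integrable.
Qed.

Lemma sqint_mul f g : sqint f -> sqint g ->
  mu.-integrable setT (EFin \o (fun x => f x * g x)).
Proof.
move=> [mf fi] [mg gi]; apply: (dom_integrable _ (integrable_addr fi gi)).
  exact: measurable_funM.
move=> x; rewrite normrM; have := sqr_ge0 (`|f x| - `|g x|).
rewrite -[f x ^+ 2]real_normK ?num_real// -[g x ^+ 2]real_normK ?num_real//.
have := normr_ge0 (f x); have := normr_ge0 (g x).
nra.
Qed.

Lemma sqint_dom f g : measurable_fun setT f -> sqint g ->
  (forall x, `|f x| <= `|g x|) -> sqint f.
Proof.
move=> mf [mg gi] fg; split=> //; apply: (dom_integrable _ gi).
  exact: measurable_funX.
move=> x; rewrite ger0_norm ?sqr_ge0//.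
rewrite -[f x ^+ 2]real_normK ?num_real// -[g x ^+ 2]real_normK ?num_real//.
by rewrite lerXn2r// nnegrE.
Qed.

Lemma sqintD f g : sqint f -> sqint g -> sqint (fun x => f x + g x).
Proof.
move=> [mf fi] [mg gi]; split; first exact: measurable_funD.
apply: (dom_integrable _ (integrable_scaler 2 (integrable_addr fi gi))).
  by apply: measurable_funX; exact: measurable_funD.
by move=> x; rewrite ger0_norm ?sqr_ge0//; have := sqr_ge0 (f x - g x); nra.
Qed.

Lemma sqintZ k f : sqint f -> sqint (fun x => k * f x).
Proof.
move=> [mf fi]; split; first exact: measurable_funM.
apply: eq_integrable (integrable_scaler (k ^+ 2) fi) => // x _ /=.
by rewrite exprMn.
Qed.

Lemma sqintN f : sqint f -> sqint (fun x => - f x).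
Proof.
move=> /(sqintZ (-1)); congr sqint; apply/funext => x; by rewrite mulN1r.
Qed.

Lemma sqintB f g : sqint f -> sqint g -> sqint (fun x => f x - g x).
Proof. by move=> sf sg; apply: sqintD => //; exact: sqintN. Qed.

Lemma sqint_bndM k f g : measurable_fun setT g -> (forall x, `|g x| <= k) ->
  sqint f -> sqint (fun x => g x * f x).
Proof.
move=> mg gk sf; apply: (@sqint_dom _ (fun x => k * f x)).
- by apply: measurable_funM => //; case: sf.
- exact: sqintZ.
move=> x; rewrite !normrM ler_wpM2r//; exact: le_trans (gk x) (ler_norm _).
Qed.

Lemma ipC f g : ip f g = ip g f.
Proof. by apply: eq_Rintegral => x _; rewrite mulrC. Qed.

Lemma ipDl f g h : sqint f -> sqint g -> sqint h ->
  ip (fun x => f x + g x) h = ip f h + ip g h.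
Proof.
move=> sf sg sh; rewrite /ip -RintegralD//; try exact: sqint_mul.
by apply: eq_Rintegral => x _; rewrite mulrDl.
Qed.

Lemma ipZl k f h : sqint f -> sqint h -> ip (fun x => k * f x) h = k * ip f h.
Proof.
move=> sf sh; rewrite /ip -RintegralZl//; last exact: sqint_mul.
by apply: eq_Rintegral => x _; rewrite mulrA.
Qed.

Lemma ipNl f h : sqint f -> sqint h -> ip (fun x => - f x) h = - ip f h.
Proof.
move=> sf sh; rewrite -mulN1r -ipZl//; congr ip.
by apply/funext => x; rewrite mulN1r.
Qed.

Lemma ipBl f g h : sqint f -> sqint g -> sqint h ->
  ip (fun x => f x - g x) h = ip f h - ip g h.
Proof. by move=> sf sg sh; rewrite ipDl ?ipNl//; exact: sqintN. Qed.

Lemma ipDr f g h : sqint f -> sqint g -> sqint h ->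
  ip h (fun x => f x + g x) = ip h f + ip h g.
Proof. by move=> sf sg sh; rewrite ipC ipDl// ![ip _ h]ipC. Qed.

Lemma ipBr f g h : sqint f -> sqint g -> sqint h ->
  ip h (fun x => f x - g x) = ip h f - ip h g.
Proof. by move=> sf sg sh; rewrite ipC ipBl// ![ip _ h]ipC. Qed.

Lemma ipZr k f h : sqint f -> sqint h -> ip h (fun x => k * f x) = k * ip h f.
Proof. by move=> sf sh; rewrite ipC ipZl// ipC. Qed.

Lemma ip_ge0 f : 0 <= ip f f.
Proof. by apply: Rintegral_ge0 => x _; rewrite -expr2 sqr_ge0. Qed.

Lemma ip0l f : ip (fun=> 0) f = 0.
Proof.
rewrite /ip (_ : (fun x => _) = cst 0); first by rewrite Rintegral_cst// mul0r.
by apply/funext => x /=; rewrite mul0r.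
Qed.

Lemma sqint0 : sqint (fun=> 0).
Proof.
split; first exact: measurable_cst.
rewrite (_ : _ \o _ = cst 0%E); first exact: integrable0.
by apply/funext => x /=; rewrite expr0n.
Qed.

Lemma sqint_sum (I : Type) (s : seq I) (F : I -> T -> R) :
  (forall i, sqint (F i)) -> sqint (fun x => \sum_(i <- s) F i x).
Proof.
move=> sF; elim: s => [|i s IH].
  under eq_fun do rewrite big_nil; exact: sqint0.
under eq_fun do rewrite big_cons; exact: sqintD.
Qed.

Lemma ip_suml (I : Type) (s : seq I) (F : I -> T -> R) h :
  (forall i, sqint (F i)) -> sqint h ->
  ip (fun x => \sum_(i <- s) F i x) h = \sum_(i <- s) ip (F i) h.
Proof.
move=> sF sh; elim: s => [|i s IH].
  by under eq_fun do rewrite big_nil; rewrite big_nil ip0l.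
under eq_fun do rewrite big_cons; rewrite big_cons ipDl ?IH//.
exact: sqint_sum.
Qed.

Lemma eq_ip f f' g g' : sqint f -> sqint g -> sqint f' -> sqint g' ->
  {ae mu, forall x, f x = f' x} -> {ae mu, forall x, g x = g' x} ->
  ip f g = ip f' g'.
Proof.
move=> sf sg sf' sg' ff' gg'; congr fine; apply: ae_eq_integral => //.
- by case: (sqint_mul sf sg) => /integrableP[].
- by case: (sqint_mul sf' sg') => /integrableP[].
by apply: filterS2 ff' gg' => x + + _ => -> ->.
Qed.

(** The quadratic form [P] of the pair is nonnegative; its discriminant is read off by evaluating it
    at well-chosen points. *)
Lemma ip_CS f g : sqint f -> sqint g -> ip f g ^+ 2 <= ip f f * ip g g.
Proof.
move=> sf sg; set a := ip f f; set b := ip f g; set c := ip g g.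
have P s t : 0 <= s ^+ 2 * a + 2 * s * t * b + t ^+ 2 * c.
  have := ip_ge0 (fun x => s * f x + t * g x).
  have sF := sqintZ s sf; have sG := sqintZ t sg.
  rewrite ipDl ?ipDr//; try exact: sqintD.
  rewrite !ipZl// !ipZr// (ipC g f) -/a -/b -/c.
  by congr (0 <= _); ring.
have a0 : 0 <= a := ip_ge0 f.
have c0 : 0 <= c := ip_ge0 g.
have [c_gt0|] := ltP 0 c; last first.
  move=> c_le0; have {c_le0 c0}c0 : c = 0 by apply/eqP; rewrite eq_le c_le0.
  have [->|b0] := eqVneq b 0; first by rewrite expr0n mulr_ge0// c0.
  (* With [c = 0] the form is affine in its second argument, and if [b] were nonzero this value
     would make it [-1]. *)
  have := P 1 (- (a + 1) / (2 * b)); rewrite c0 mulr0 addr0.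
  rewrite (_ : _ + _ = -1); last by field.
  by rewrite lerNr oppr0 ler10.
(* For [c > 0], the point [(c, - b)] is proportional to the minimizer of the form. *)
have := P c (- b); rewrite (_ : _ + _ = c * (a * c - b ^+ 2)); last by ring.
by rewrite pmulr_rge0// subr_ge0.
Qed.

Lemma ip_CS_norm f g : sqint f -> sqint g ->
  `|ip f g| <= Num.sqrt (ip f f) * Num.sqrt (ip g g).
Proof.
move=> sf sg; rewrite -sqrtrM ?ip_ge0// -sqrtr_sqr ler_wsqrtr//.
exact: ip_CS.
Qed.

Definition nrm2 f := Num.sqrt (ip f f).

Lemma nrm2_ge0 f : 0 <= nrm2 f. Proof. exact: sqrtr_ge0. Qed.

Lemma nrm2_0 : nrm2 (fun=> 0) = 0.
Proof. by rewrite /nrm2 ip0l sqrtr0. Qed.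

Lemma nrm2_sqr f : nrm2 f ^+ 2 = ip f f.
Proof. by rewrite sqr_sqrtr// ip_ge0. Qed.

Lemma nrm2D f g : sqint f -> sqint g ->
  nrm2 (fun x => f x + g x) <= nrm2 f + nrm2 g.
Proof.
move=> sf sg.
rewrite -(@ler_pXn2r _ 2)// ?nnegrE ?addr_ge0 ?nrm2_ge0// sqrrD !nrm2_sqr.
have sfg := sqintD sf sg.
rewrite ipDl// !ipDr// (ipC g f).
have /(le_trans (ler_norm _)) := ip_CS_norm sf sg.
rewrite -/(nrm2 f) -/(nrm2 g).
lra.
Qed.

Lemma nrm2Z k f : sqint f -> nrm2 (fun x => k * f x) = `|k| * nrm2 f.
Proof.
move=> sf; rewrite /nrm2 ipZl ?ipZr//; last exact: sqintZ.
by rewrite mulrA -expr2 sqrtrM ?sqr_ge0// sqrtr_sqr.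
Qed.

Lemma nrm2N f : nrm2 (fun x => - f x) = nrm2 f.
Proof.
by congr Num.sqrt; apply: eq_Rintegral => x _; rewrite mulrNN.
Qed.

Lemma nrm2B f g : sqint f -> sqint g ->
  nrm2 (fun x => f x - g x) <= nrm2 f + nrm2 g.
Proof.
move=> sf sg; rewrite -(nrm2N g); apply: nrm2D => //; exact: sqintN.
Qed.

Lemma nrm2_sum (I : Type) (s : seq I) (F : I -> T -> R) :
  (forall i, sqint (F i)) ->
  nrm2 (fun x => \sum_(i <- s) F i x) <= \sum_(i <- s) nrm2 (F i).
Proof.
move=> sF; elim: s => [|i s IH].
  by under eq_fun do rewrite big_nil; rewrite big_nil /nrm2 ip0l sqrtr0.
under eq_fun do rewrite big_cons; rewrite big_cons.
apply: (le_trans (nrm2D _ _)) => //; first exact: sqint_sum.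
by rewrite lerD2l.
Qed.

Lemma ip_eq0 f : sqint f -> ip f f = 0 -> {ae mu, forall x, f x = 0}.
Proof.
move=> sf f0; have sff := sqint_mul sf sf.
have : (\int[mu]_x `|(EFin \o (fun x => (f x * f x)%R)) x| = 0)%E.
  under eq_integral => x _.
    rewrite /= ger0_norm; last by rewrite -expr2 sqr_ge0.
    over.
  by rewrite -[LHS]fineK ?integrable_fin_num//= -[X in X%:E]/(ip f f) f0.
have mff := measurable_int _ sff.
move=> /(ae_eq_integral_abs mu measurableT mff).
by apply: filterS => x /(_ I) /= [] /eqP; rewrite mulf_eq0 orbb => /eqP.
Qed.

Lemma le_ip f g : sqint f -> sqint g -> (forall x, `|f x| <= `|g x|) ->
  ip f f <= ip g g.
Proof.
move=> sf sg fg; apply: le_Rintegral => //; try exact: sqint_mul.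
move=> x _; rewrite -!expr2 -[f x ^+ 2]real_normK ?num_real//.
by rewrite -[g x ^+ 2]real_normK ?num_real// lerXn2r// nnegrE.
Qed.

(** Dominated convergence for the squared differences, with dominating function [4 * g ^ 2]. It
    turns pointwise approximations into L^2 approximations, both for the density of bumps and for
    truncations. *)
Lemma sqint_dominated (f_ : (T -> R)^nat) f g :
  (forall k, measurable_fun setT (f_ k)) -> measurable_fun setT f ->
  sqint g -> (forall k x, `|f_ k x| <= g x) ->
  (forall x, f_ k x @[k --> \oo] --> f x) ->
  [/\ forall k, sqint (f_ k), sqint f
    & ip (fun x => f x - f_ k x) (fun x => f x - f_ k x) @[k --> \oo] --> 0].
Proof.
move=> mf_ mf sg f_g f_f.
have sf_ k : sqint (f_ k).
  by apply: (sqint_dom _ sg) => // x; apply: le_trans (f_g k x) (ler_norm _).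
have fg x : `|f x| <= g x.
  rewrite -(cvg_lim _ (cvg_norm (f_f x)))//; apply: limr_le.
    by apply/cvg_ex; exists `|f x|; exact: cvg_norm (f_f x).
  by apply: nearW => k; exact: f_g.
have sf : sqint f.
  by apply: (sqint_dom _ sg) => // x; apply: le_trans (fg x) (ler_norm _).
split=> //.
have sd k : sqint (fun x => f x - f_ k x) by exact: sqintB.
have H : (\int[mu]_x ((f x - f_ k x) * (f x - f_ k x))%:E)%E @[k --> \oo] -->
   (\int[mu]_x (cst 0 x))%E.
  apply: (@dominated_cvg _ _ _ mu setT measurableT
    (fun k x => ((f x - f_ k x) * (f x - f_ k x))%:E) (cst 0%E)
    (EFin \o (fun x => 4 * (g x * g x)))).
  - move=> k; have := sqint_mul (sd k) (sd k).
    exact: measurable_int.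
  - move=> x _; have h : (f x - f_ k x) @[k --> \oo] --> 0.
      by rewrite -(subrr (f x)); apply: cvgB => //; exact: cvg_cst.
    rewrite (_ : cst 0%E x = (0 * 0 : R)%:E); last by rewrite /= mulr0.
    by apply: cvg_EFin; [exact: nearW|exact: cvgM].
  - by [].
  - by apply: integrable_scaler; exact: sqint_mul.
  - move=> k x _ /=; rewrite lee_fin normrM.
    have : `|f x - f_ k x| <= 2 * g x.
      apply: le_trans (ler_normB _ _) _; have := fg x; have := f_g k x; lra.
    have := normr_ge0 (f x - f_ k x); nra.
rewrite integral_cst// mul0e in H.
exact: (fine_cvg H).
Qed.

Lemma sqint_indic (A : set T) : measurable A -> (mu A < +oo)%E ->
  sqint (\1_A : T -> R).
Proof.
move=> mA Aoo; split; first exact: measurable_indic.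
rewrite (_ : _ \o _ = EFin \o \1_A); last first.
  by apply/funext => x /=; rewrite indicE; case: (_ \in _); rewrite ?expr0n ?expr1n.
apply/integrableP; split; first exact/measurable_EFinP/measurable_indic.
under eq_integral do rewrite /= ger0_norm//.
by rewrite integral_indic// setIT.
Qed.

End square_integrable.

(** * Boxes, translation invariance and Borel sets for Lebesgue measure on row vectors *)

Section lebesgue_rV_theory.
Context {R : realType} {n : nat}.
Local Notation mu := (lebesgue_rV R n).
Implicit Types (A : 'I_n -> set R) (x y : 'rV[R]_n).

Definition box A : set 'rV[R]_n := [set x | forall i, A i (x ord0 i)].

Definition boxes : set (set 'rV[R]_n) :=
  [set B | exists2 A, (forall i, measurable (A i)) & B = box A].

Lemma measurable_box A : (forall i, measurable (A i)) -> measurable (box A).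
Proof.
move=> mA; rewrite (_ : box A = \bigcap_(i in [set: 'I_n])
    ((fun x : 'rV[R]_n => x ord0 i) @^-1` A i)); last first.
  by apply/seteqP; split => x Ax i //=; exact: Ax.
apply: fin_bigcap_measurable => // i _.
by rewrite -[X in measurable X]setTI; exact: measurable_rV_coord.
Qed.

Lemma setI_closed_boxes : setI_closed boxes.
Proof.
move=> _ _ [A mA ->] [B mB ->]; exists (fun i => A i `&` B i).
  by move=> i; exact: measurableI.
apply/seteqP; split=> x /=; first by move=> [Ax Bx] i; split.
by move=> ABx; split=> i; have [] := ABx i.
Qed.

Lemma measurable_rVE : @measurable _ 'rV[R]_n = <<s boxes >>.
Proof.
apply/seteqP; split.
  apply: smallest_sub; first exact: smallest_sigma_algebra.
  move=> B /=; rewrite -bigcup_seq => -[i _ [C mC <-]].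
  apply: sub_sigma_algebra; exists (fun j => if j == i then C else setT).
    by move=> j; case: ifP.
  rewrite setTI; apply/seteqP; split=> x /=.
    by move=> Cx j; case: eqP => [->|].
  by move=> /(_ i); rewrite eqxx.
apply: smallest_sub; first exact: sigma_algebra_measurable.
by move=> _ [A mA ->]; exact: measurable_box.
Qed.

Definition cube (a b : R) : set 'rV[R]_n := box (fun=> `[a, b]%classic).

Lemma measurable_cube a b : measurable (cube a b).
Proof. by apply: measurable_box => i; exact: measurable_itv. Qed.

Lemma mu_cube a b : a <= b -> mu (cube a b) = ((b - a) ^+ n)%:E.
Proof.
move=> ab; rewrite lebesgue_rV_box//.
under eq_bigr do rewrite lebesgue_measure_itv/= lte_fin.
have -> : (if a < b then (b%:E - a%:E)%E else 0%E) = (b - a)%:E.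
  by case: ltP => // ba; rewrite (_ : a = b) ?subrr//; apply/le_anti/andP.
rewrite prodEFin; congr EFin.
by rewrite prodr_const card_ord.
Qed.

Lemma mu_cube_lty a b : (mu (cube a b) < +oo)%E.
Proof.
rewrite lebesgue_rV_box//; under eq_bigr do rewrite lebesgue_measure_itv/= lte_fin.
rewrite (eq_bigr (fun=> (if a < b then b - a else 0)%:E)) ?prodEFin ?ltry//.
by move=> i _; case: ifP.
Qed.

Lemma cube_cover : \bigcup_k cube (- k%:R) k%:R = setT.
Proof.
rewrite -subTset => x _.
exists (Num.trunc (\sum_(i < n) `|x ord0 i|)).+1 => // i.
rewrite /= in_itv/= -ler_norml.
apply: le_trans (ltW (truncnS_gt _)).
by rewrite (bigD1 i)//= lerDl sumr_ge0.
Qed.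

Definition shift_rV y x := y + x.

Lemma measurable_shift_rV y : measurable_fun setT (shift_rV y).
Proof.
apply/measurable_fun_rVP => i.
under eq_fun do rewrite mxE.
by apply: measurable_funD => //; exact: measurable_rV_coord.
Qed.

HB.instance Definition _ y := isMeasurableFun.Build _ _ _ _ (shift_rV y)
  (measurable_shift_rV y).

Lemma lebesgue_measure_shift (c : R) (B : set R) : measurable B ->
  lebesgue_measure ((fun t : measurableTypeR R => c + t : measurableTypeR R)
      @^-1` B) =
  lebesgue_measure B.
Proof.
move=> mB.
have mc : measurable_fun setT
    (fun t : measurableTypeR R => c + t : measurableTypeR R).
  exact: measurable_funD.
pose F : {mfun measurableTypeR R >-> measurableTypeR R} :=
  HB.pack (fun t : measurableTypeR R => c + t : measurableTypeR R)
   (isMeasurableFun.Build _ _ _ _ _ mc).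
apply/esym.
apply: (@lebesgue_measure_unique R (pushforward lebesgue_measure F)) => //.
move=> _ [[a b]] _ <-.
have E : (fun t : measurableTypeR R => c + t : measurableTypeR R) @^-1`
    `]a, b]%classic
    = `]a - c, b - c]%classic.
  by apply/seteqP; split=> x /=; rewrite !in_itv/= ltrBlDl lerBrDl.
transitivity (lebesgue_measure (`]a - c, b - c]%classic : set R)); last first.
  by rewrite -E.
rewrite !lebesgue_measure_itv/= !lte_fin ltrD2r.
by case: ifP => // _; congr EFin; ring.
Qed.

(** The two measures agree on boxes, where one-dimensional invariance applies factor by factor.
    Boxes are stable under intersection and generate the sigma-algebra, and cubes of finite measure
    exhaust the space, so uniqueness of measures applies. *)
Lemma lebesgue_rV_shift y (B : set 'rV[R]_n) : measurable B ->
  mu (shift_rV y @^-1` B) = mu B.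
Proof.
move=> mB.
apply: (measure_unique boxes (fun k => cube (- k%:R) k%:R) _ _ _ _
  (pushforward mu (shift_rV y)) mu) => //.
- exact: measurable_rVE.
- exact: setI_closed_boxes.
- by move=> k; exists (fun=> `[- k%:R, k%:R]%classic) => // i;
    exact: measurable_itv.
- exact: cube_cover.
- move=> _ [A mA ->].
  have E : shift_rV y @^-1` box A = box (fun i => (fun t : measurableTypeR R =>
      y ord0 i + t : measurableTypeR R) @^-1` A i).
   apply/seteqP; split=> x /= + i => /(_ i); by rewrite /shift_rV /= mxE.
  transitivity (mu (shift_rV y @^-1` box A)) => //; rewrite E.
  rewrite lebesgue_rV_box//.
    by rewrite [RHS]lebesgue_rV_box //; apply: eq_bigr => i _;
        exact: lebesgue_measure_shift.
  move=> i; rewrite -[X in measurable X]setTI.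
  have : measurable_fun setT (fun t : measurableTypeR R => y ord0 i + t).
    exact: measurable_funD.
  exact.
- move=> k.
  have E : shift_rV y @^-1` cube (- k%:R) k%:R =
      box (fun i => `[- k%:R - y ord0 i, k%:R - y ord0 i]%classic).
   apply/seteqP; split=> x /= + i => /(_ i);
       by rewrite /shift_rV /= !in_itv/= mxE lerBlDl lerBrDl.
  suff : (mu (shift_rV y @^-1` cube (- k%:R) k%:R) < +oo)%E by [].
  rewrite E lebesgue_rV_box//.
  under eq_bigr do rewrite lebesgue_measure_itv/= lte_fin ltrD2r.
  rewrite (eq_bigr (fun i => (if - k%:R < k%:R :> R then
      k%:R - y ord0 i - (- k%:R - y ord0 i) else 0)%:E)).
    by rewrite prodEFin ltry.
  by move=> i _; case: ifP.
Qed.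

Lemma ge0_integral_shift y (f : 'rV[R]_n -> \bar R) :
  measurable_fun setT f -> (forall x, 0 <= f x)%E ->
  (\int[mu]_x f (shift_rV y x) = \int[mu]_x f x)%E.
Proof.
move=> mf f0.
rewrite -[LHS](@ge0_integral_pushforward _ _ _ _ _ _ (measurable_shift_rV y) mu
    setT)//.
apply: eq_measure_integral => B mB _.
exact: lebesgue_rV_shift.
Qed.

Lemma integral_shift y (f : 'rV[R]_n -> \bar R) :
  measurable_fun setT f ->
  (\int[mu]_x f (shift_rV y x) = \int[mu]_x f x)%E.
Proof.
move=> mf; rewrite integralE [RHS]integralE.
rewrite -(@ge0_integral_shift y (f^\+)%E)//; last exact: measurable_funepos.
rewrite -(@ge0_integral_shift y (f^\-)%E)//; last exact: measurable_funeneg.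
by congr (_ - _)%E; apply: eq_integral => x _; rewrite ?funeposE ?funenegE.
Qed.

Lemma integrable_shift y (f : 'rV[R]_n -> \bar R) :
  mu.-integrable setT f -> mu.-integrable setT (f \o shift_rV y).
Proof.
move=> /integrableP[mf fi]; apply/integrableP; split.
  exact: measurableT_comp.
rewrite [X in (X < _)%E](_ : _ = \int[mu]_x `|f x|)%E//.
apply: (@ge0_integral_shift y (fun x => `|f x|%E)) => //.
exact: measurableT_comp.
Qed.

Lemma sqint_shift y (f : 'rV[R]_n -> R) : sqint mu f -> sqint mu (f \o shift_rV y).
Proof.
move=> [mf fi]; split; first exact: measurableT_comp.
exact: (integrable_shift y fi).
Qed.

Lemma shift_rVK y x : shift_rV y (shift_rV (- y) x) = x.
Proof. by rewrite /shift_rV addNKr. Qed.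

Lemma ip_shift y (f g : 'rV[R]_n -> R) :
  measurable_fun setT f -> measurable_fun setT g ->
  ip mu (f \o shift_rV y) g = ip mu f (g \o shift_rV (- y)).
Proof.
move=> mf mg; rewrite /ip /Rintegral; congr fine.
rewrite -(@integral_shift (- y) (fun x => ((f \o shift_rV y) x * g x)%:E)).
  by apply: eq_integral => x _ /=; rewrite shift_rVK.
apply/measurable_EFinP; apply: measurable_funM => //.
exact: measurableT_comp.
Qed.

Lemma ip_shift2 y (f g : 'rV[R]_n -> R) :
  measurable_fun setT f -> measurable_fun setT g ->
  ip mu (f \o shift_rV y) (g \o shift_rV y) = ip mu f g.
Proof.
move=> mf mg; rewrite ip_shift//; last exact: measurableT_comp.
by congr ip; apply/funext => x /=; rewrite shift_rVK.
Qed.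

Lemma nrm2_shift y (f : 'rV[R]_n -> R) : measurable_fun setT f ->
  nrm2 mu (f \o shift_rV y) = nrm2 mu f.
Proof. by move=> mf; rewrite /nrm2 ip_shift2. Qed.

Lemma ball_rVE x e : 0 < e ->
  ball x e = box (fun i => `]x ord0 i - e, x ord0 i + e[%classic).
Proof.
move=> e0; apply/seteqP; split=> y.
  by move=> [_ xy] i; have := xy ord0 i; rewrite ball_itv.
move=> xy; split=> // i j; rewrite ord1 ball_itv; exact: xy.
Qed.

(** Balls of the sup norm are boxes, hence measurable for the sigma-algebra of the coordinates. The
    balls contained in [U] with rational centre and radius [1 / (m + 1)], enumerated through
    [unpickle], cover [U]. *)
Lemma open_measurable_rV (U : set 'rV[R]_n) : open U -> measurable U.
Proof.
move=> oU.
pose c (qm : 'rV[rat]_n * nat) : 'rV[R]_n := \row_i ratr (qm.1 ord0 i).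
pose B qm := if `[< ball (c qm) qm.2.+1%:R^-1 `<=` U >]
  then ball (c qm) qm.2.+1%:R^-1 else set0.
rewrite (_ : U = \bigcup_k (if unpickle k is Some qm then B qm else set0)).
  apply: bigcup_measurable => k _; case: unpickle => [qm|//].
  rewrite /B; case: asboolP => // _; rewrite ball_rVE//.
  by apply: measurable_box => i; exact: measurable_itv.
apply/seteqP; split=> [x Ux|x [k _]]; last first.
  by case: unpickle => [qm|//]; rewrite /B; case: asboolP => // + xB; exact.
have /nbhs_ballP[e /= e0 eU] : nbhs x U by move: oU; rewrite openE; exact.
(* The radius is below [e / 2], so that a ball of this radius containing [x] lies inside
   [ball x e]. *)
pose m := Num.trunc (2 / e).
have me : m.+1%:R^-1 < e / 2.
  rewrite -[ltRHS]invrK ltf_pV2 ?posrE ?invr_gt0 ?divr_gt0//.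
  by rewrite invf_div; exact: truncnS_gt.
have qx i : {q : rat | ratr q \in `]x ord0 i - m.+1%:R^-1, x ord0 i + m.+1%:R^-1[}.
  by apply/cid; apply: rat_in_itvoo; rewrite ltrD2l gtrN.
pose q : 'rV[rat]_n := \row_i projT1 (qx i).
exists (pickle (q, m)) => //; rewrite pickleK /B.
have cx : ball (c (q, m)) m.+1%:R^-1 x.
  split=> // i j; rewrite ord1 ball_itv/= !mxE /=.
  have := projT2 (qx j); rewrite !in_itv/= => /andP[h1 h2].
  by apply/andP; split; [rewrite ltrBlDr; exact: h2|rewrite -ltrBlDr; exact: h1].
case: asboolP => // -[] z cz; apply: eU.
have := ball_triangle (ball_sym cx) cz.
by apply: le_ball; rewrite [leRHS]splitr; apply: lerD; exact: ltW.
Qed.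

Lemma continuous_measurable_rV (f : 'rV[R]_n -> R) :
  continuous f -> measurable_fun setT f.
Proof.
move=> /continuousP cf; apply: (measurability _ (RGenOpens.measurableE R)).
move=> _ [_ [a [b ->] <-]]; rewrite setTI; apply: open_measurable_rV.
exact/cf/interval_open.
Qed.

End lebesgue_rV_theory.

(** * Smooth bumps *)

Section flat.
Context {R : realType}.

Lemma is_derive_cvg (V : normedModType R) (f : V -> R) (x v : V) (d : R) :
  h^-1 *: ((f \o shift x) (h *: v) - f x) @[h --> 0^'] --> d ->
  is_derive x v f d.
Proof. by move=> fd; split; [apply: cvgP fd|apply: cvg_lim fd]. Qed.

Lemma is_derive_line (V : normedModType R) (f : V -> R) (x v : V) (d : R) :
  is_derive (0 : R) (1 : R) (fun h : R => f (h *: v + x)) d -> is_derive x v f d.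
Proof.
move=> [/cvg_ex[l fl] <-]; apply: is_derive_cvg.
rewrite /derive (cvg_lim _ fl)//.
apply: cvg_trans fl; apply: near_eq_cvg; apply: nearW => h /=.
by rewrite addr0 scale0r add0r [_%:A]mulr1.
Qed.

Lemma eq_is_derive (V : normedModType R) (f g : V -> R) (x v : V) (d d' : R) :
  is_derive x v f d -> f =1 g -> d = d' -> is_derive x v g d'.
Proof. by move=> fd /funext <- <-. Qed.

(* [flat 0] is the classical smooth function [exp (- 1 / x)] vanishing for
   [x <= 0]; the family is closed under derivation. *)
Definition flat (m : nat) (x : R) : R :=
  if 0 < x then x ^- m * expR (- x^-1) else 0.

Lemma flat_ge0 m (x : R) : 0 <= flat m x.
Proof.
by rewrite /flat; case: ifP => // x0; rewrite mulr_ge0 ?expR_ge0// invr_ge0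
    exprn_ge0// ltW.
Qed.

Lemma flat_le0 m (x : R) : x <= 0 -> flat m x = 0.
Proof. by rewrite /flat leNgt => /negbTE ->. Qed.

(** A single term of the exponential series at [x^-1] already dominates; this gives flatness at 0 to
    any order. *)
Lemma expR_Ninv_le k (x : R) : 0 < x -> expR (- x^-1) <= k`!%:R * x ^+ k.
Proof.
move=> x0; rewrite expRN -[leRHS]invrK lef_pV2 ?posrE ?expR_gt0//; last first.
  by rewrite invr_gt0 mulr_gt0 ?exprn_gt0// ltr0n fact_gt0.
case: k => [|k].
  by rewrite fact0 expr0 mulr1 invr1 -expR0 ler_expR invr_ge0 ltW.
have xV0 : 0 <= x^-1 by rewrite invr_ge0 ltW.
apply: le_trans (expR_ge1Dxn k xV0).
by rewrite invfM exprVn mulrC lerDr.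
Qed.

Lemma flat_le m k (x : R) : 0 <= x -> flat m x <= (k + m)`!%:R * x ^+ k.
Proof.
rewrite le_eqVlt => /predU1P[<-|x0].
  by rewrite flat_le0// mulr_ge0// exprn_ge0.
rewrite /flat x0 ler_pdivrMl ?exprn_gt0//.
apply: le_trans (expR_Ninv_le (k + m) x0) _.
by rewrite exprD [x ^+ k * _]mulrC mulrCA lexx.
Qed.

Lemma flat_bnd m (x : R) : `|flat m x| <= m`!%:R.
Proof.
rewrite ger0_norm ?flat_ge0//; have [x0|x0] := leP 0 x.
  by have := flat_le m 0 x0; rewrite expr0 mulr1.
by rewrite flat_le0 ?ler0n// ltW.
Qed.

Lemma is_derive_flat m (x : R) :
  is_derive x 1 (flat m) (flat m.+2 x - m%:R * flat m.+1 x).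
Proof.
have [x0|x0|->] := ltgtP x 0.
- rewrite !(flat_le0 _ (ltW x0)) mulr0 subr0.
  apply: (@near_eq_is_derive _ _ _ (cst 0)).
  near=> y; rewrite flat_le0//.
  by near: y; apply: (cvgr_le x (fun A => id)).
- have xn0 : x != 0 by rewrite gt_eqF.
  have D1 : is_derive x 1 (fun y : R => y^-1) (- x ^- 2).
    have := @is_deriveV _ (fun y => y) x 1 1 xn0 (@is_derive_id _ _ x 1).
    by move/eq_is_derive; apply => //; rewrite [LHS]mulr1.
  have D2 : is_derive x 1 (fun y : R => (y ^+ m)^-1) (- m%:R * x ^- m.+1).
    have h : is_derive x 1 (fun y : R => y ^+ m) (m%:R * x ^+ m.-1).
      have := @is_deriveX _ _ (fun y : R => y) m x 1 1 (@is_derive_id _ _ x 1).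
      by move/eq_is_derive; apply => [y|]; [rewrite exprfctE|rewrite [LHS]mulr1].
    have := @is_deriveV _ (fun y : R => y ^+ m) x _ 1 (expf_neq0 _ xn0) h.
    move/eq_is_derive; apply => //.
    case: m {h} => [|m] /=; first by rewrite !mul0r scaler0 oppr0 mul0r.
    rewrite -[_ *: _]/(_ * _) !exprS; field.
    by rewrite expf_neq0 ?xn0.
  have D3 : is_derive x 1 (fun y : R => expR (- y^-1)) (expR (- x^-1) * x ^- 2).
    have := @is_derive1_comp _ expR (- (fun y : R => y^-1)) x _ _
        (is_derive_expR _) (is_deriveN D1).
    by move/eq_is_derive; apply => //; rewrite opprK.
  suff D4 : is_derive x 1 (fun y : R => (y ^+ m)^-1 * expR (- y^-1))
      (flat m.+2 x - m%:R * flat m.+1 x).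
    apply: near_eq_is_derive D4; near=> y; rewrite /flat ifT//.
    by near: y; exact: (cvgr_gt x (fun A => id)).
  have := is_deriveM D2 D3; move/eq_is_derive; apply => //.
  rewrite /flat x0 /=.
  rewrite -![_ *: _]/(_ * _) !exprS expr0; field.
  by rewrite expf_neq0 ?xn0.
- rewrite !flat_le0// mulr0 subr0; apply: is_derive_cvg => /=.
  apply/cvgr0Pnorm_le => e e0.
  have C0 : (0 : R) < (2 + m)`!%:R by rewrite ltr0n fact_gt0.
  near=> h.
  rewrite addr0 (flat_le0 m (lexx 0)) subr0 [_%:A]mulr1 normrM normfV.
  have hn0 : h != 0 by near: h; exact: nbhs_dnbhs_neq.
  rewrite ler_pdivrMl ?normr_gt0// ger0_norm ?flat_ge0//.
  have [h0|h0] := leP h 0; first by rewrite flat_le0// mulr_ge0// ltW.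
  (* Flatness of order 2 leaves one factor [h] after division by [h], so the difference quotient at
     0 tends to 0. *)
  apply: le_trans (flat_le m 2 (ltW h0)) _.
  rewrite gtr0_norm// expr2 mulrCA ler_pM2l// mulrC -ler_pdivlMr//.
  apply: le_trans (ler_norm _) _.
  by near: h; apply: dnbhs0_le; rewrite divr_gt0.
Unshelve. all: by end_near. Qed.

Lemma continuous_flat m : continuous (flat m).
Proof.
move=> x; apply: differentiable_continuous; apply/derivable1_diffP.
by case: (is_derive_flat m x).
Qed.

End flat.

Section bump_algebra.
Context {R : realType} {n : nat}.
Local Notation mu := (lebesgue_rV R n).
Local Notation vec i := (delta_mx ord0 i : 'rV[R]_n).

(* An explicit algebra of bounded smooth functions, closed under partial
   derivatives and rich enough to contain bumps on every box. *)
Inductive flat_alg : ('rV[R]_n -> R) -> Prop :=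
| flat_alg_cst c : flat_alg (fun=> c)
| flat_alg_flat m (a b : R) i : flat_alg (fun x => flat m (a * x ord0 i + b))
| flat_algD f g : flat_alg f -> flat_alg g -> flat_alg (fun x => f x + g x)
| flat_algM f g : flat_alg f -> flat_alg g -> flat_alg (fun x => f x * g x).

Lemma flat_algZ k f : flat_alg f -> flat_alg (fun x => k * f x).
Proof. by apply: (flat_algM (flat_alg_cst k)). Qed.

Lemma flat_algB f g : flat_alg f -> flat_alg g -> flat_alg (fun x => f x - g x).
Proof.
move=> ff gg; apply: (flat_algD ff); under eq_fun do rewrite -mulN1r.
exact: flat_algZ.
Qed.

Lemma flat_alg_prod (I : Type) (s : seq I) (F : I -> 'rV[R]_n -> R) :
  (forall i, flat_alg (F i)) -> flat_alg (fun x => \prod_(i <- s) F i x).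
Proof.
move=> FF; elim: s => [|i s IH].
  under eq_fun do rewrite big_nil; exact: flat_alg_cst.
under eq_fun do rewrite big_cons; exact: flat_algM.
Qed.

Lemma flat_alg_shift y f : flat_alg f -> flat_alg (f \o shift_rV y).
Proof.
elim=> [c|m a b i|g h _ IHg _ IHh|g h _ IHg _ IHh].
- exact: flat_alg_cst.
- have := flat_alg_flat m a (a * y ord0 i + b) i; congr flat_alg.
  by apply/funext => x /=; rewrite /shift_rV mxE; congr flat; ring.
- exact: flat_algD IHg IHh.
- exact: flat_algM IHg IHh.
Qed.

Lemma flat_alg_bnd f : flat_alg f -> exists M, forall x, `|f x| <= M.
Proof.
elim=> [c|m a b i|g h _ [A Ag] _ [B Bh]|g h _ [A Ag] _ [B Bh]].
- by exists `|c|.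
- by exists m`!%:R => x; exact: flat_bnd.
- exists (A + B) => x; apply: le_trans (ler_normD _ _) _; exact: lerD.
- by exists (A * B) => x; rewrite normrM ler_pM.
Qed.

Lemma continuous_affine_coord (a b : R) (i : 'I_n) :
  continuous (fun x : 'rV[R]_n => a * x ord0 i + b).
Proof.
move=> x; have h := @coord_continuous R 1 n ord0 i x.
have := cvgD (cvgM (cvg_cst a) h) (cvg_cst b); exact.
Qed.

Lemma continuous_flat_alg f : flat_alg f -> continuous f.
Proof.
elim=> [c|m a b i|g h _ IHg _ IHh|g h _ IHg _ IHh] x.
- exact: cst_continuous.
- have c := @continuous_flat R m (a * x ord0 i + b).
  exact: continuous_comp (@continuous_affine_coord a b i x) c.
- exact: cvgD (IHg x) (IHh x).
- exact: cvgM (IHg x) (IHh x).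
Qed.

Lemma flat_alg_derive f i : flat_alg f ->
  exists2 g, flat_alg g & forall x, is_derive x (vec i) f (g x).
Proof.
elim=> [c|m a b j|g h _ [g' Gg' gg'] _ [h' Gh' hh']
       |g h Gg [g' Gg' gg'] Gh [h' Gh' hh']].
- exists (fun=> 0); first exact: flat_alg_cst.
  by move=> x; exact: is_derive_cst.
- pose d : R := (j == i)%:R.
  exists (fun x => (flat m.+2 (a * x ord0 j + b) -
      m%:R * flat m.+1 (a * x ord0 j + b)) * (a * d)).
    apply: flat_algM; last exact: flat_alg_cst.
    by apply: flat_algB; [|apply: flat_algZ]; exact: flat_alg_flat.
  move=> x; apply: is_derive_line.
  pose l (t : R) := a * d * t + (a * x ord0 j + b).
  have dl : is_derive (0 : R) (1 : R) l (a * d).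
    have := is_deriveD (is_deriveZ (a * d) (@is_derive_id R R 0 1))
      (@is_derive_cst R R R (a * x ord0 j + b) 0 1).
    by move/eq_is_derive; apply => //; rewrite addr0 [LHS]mulr1.
  have := @is_derive1_comp _ (flat m) l 0 _ _ (is_derive_flat m _) dl.
  move/eq_is_derive; apply => [t|].
    by rewrite /= /l !mxE eqxx /= /d eq_sym; congr flat; ring.
  by rewrite /l mulr0 add0r.
- exists (fun x => g' x + h' x); first exact: flat_algD.
  by move=> x; exact: is_deriveD.
- exists (fun x => g x * h' x + h x * g' x).
    by apply: flat_algD; exact: flat_algM.
  by move=> x; exact: is_deriveM.
Qed.

Lemma flat_alg_partial f i : flat_alg f -> flat_alg ('D_(vec i) f).
Proof.
move=> /(flat_alg_derive i)[g Gg fg]; rewrite (_ : 'D_(vec i) f = g)//.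
by apply/funext => x; rewrite derive_val.
Qed.

Lemma flat_alg_is_derive f i x : flat_alg f ->
  is_derive x (vec i) f ('D_(vec i) f x).
Proof.
by move=> /(flat_alg_derive i)[g _ /(_ x)[h _]]; split.
Qed.

Lemma flat_alg_smooth f : flat_alg f -> smooth f.
Proof.
move=> Gf s; have Gs : flat_alg (iter_partial s f).
  by elim: s => //= i s; exact: flat_alg_partial.
split; first exact: continuous_flat_alg.
by move=> i x; case: (flat_alg_is_derive i x Gs).
Qed.

(** A concrete subclass of the test functions, stable under translations and partial derivatives by
    construction and dense in L^2 by [bump_dense]. All properties of weak derivatives below are
    obtained by testing on these functions alone. *)
Definition bump_fun f := flat_alg f /\
  exists M : R, forall x, f x != 0 -> cube (- M) M x.

Lemma compact_cube (a b : R) : compact (@cube R n a b).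
Proof. by apply: rV_compact => i; exact: segment_compact. Qed.

Lemma closed_cube (a b : R) : closed (@cube R n a b).
Proof. by apply: compact_closed; [exact: norm_hausdorff|exact: compact_cube]. Qed.

Lemma bump_test f : bump_fun f -> test_function f.
Proof.
move=> [Gf [M fM]]; split; first exact: flat_alg_smooth.
apply: (@subclosed_compact _ _ (cube (- M) M)).
- exact: closed_closure.
- exact: compact_cube.
rewrite closureE; apply: smallest_sub; first exact: closed_cube.
by move=> x; exact: fM.
Qed.

Lemma bump_supp_le (M M' : R) x : M <= M' -> @cube R n (- M) M x ->
    @cube R n (- M') M' x.
Proof.
move=> MM' cx i; have := cx i; rewrite /= !in_itv/= -!ler_norml => h.
exact: le_trans h MM'.
Qed.

Lemma bump0 : bump_fun (fun=> 0).
Proof. by split; [exact: flat_alg_cst|exists 0 => x; rewrite eqxx]. Qed.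

Lemma bumpD f g : bump_fun f -> bump_fun g -> bump_fun (fun x => f x + g x).
Proof.
move=> [Gf [A fA]] [Gg [B gB]]; split; first exact: flat_algD.
exists (Num.max A B) => x.
have [->|/fA Af] := eqVneq (f x) 0.
  rewrite add0r => /gB; apply: bump_supp_le; by rewrite le_max lexx orbT.
by move=> _; apply: bump_supp_le Af; rewrite le_max lexx.
Qed.

Lemma bumpZ k f : bump_fun f -> bump_fun (fun x => k * f x).
Proof.
move=> [Gf [A fA]]; split; first exact: flat_algZ.
by exists A => x; rewrite mulf_eq0 negb_or => /andP[_ /fA].
Qed.

Lemma bumpB f g : bump_fun f -> bump_fun g -> bump_fun (fun x => f x - g x).
Proof.
move=> bf /(bumpZ (-1)) bg; under eq_fun do rewrite -[- g _]mulN1r.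
exact: bumpD.
Qed.

Lemma bump_shift y f : bump_fun f -> bump_fun (f \o shift_rV y).
Proof.
move=> [Gf [A fA]]; split; first exact: flat_alg_shift.
exists (A + \sum_i `|y ord0 i|) => x /= /fA + i => /(_ i).
rewrite /= !in_itv/= -!ler_norml mxE => h.
rewrite -[x ord0 i](addKr (y ord0 i)) addrC.
apply: le_trans (ler_normD _ _) _; rewrite normrN lerD//.
by rewrite (bigD1 i)//= lerDl sumr_ge0.
Qed.

Lemma bump_partial f i : bump_fun f -> bump_fun ('D_(vec i) f).
Proof.
move=> [Gf [A fA]]; split; first exact: flat_alg_partial.
exists A => x; apply: contraNP => xA.
have oA : nbhs x (~` cube (- A) A).
  by apply: open_nbhs_nbhs; split => //; exact/closed_openC/closed_cube.
rewrite (@near_eq_derive _ _ _ f (cst 0)) ?derive_cst//.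
apply: filterS oA => y yA.
by apply/eqP; apply: contra_notT yA; exact: fA.
Qed.

Lemma measurable_bump f : bump_fun f -> measurable_fun setT f.
Proof. by move=> [Gf _]; apply: continuous_measurable_rV;
    apply: continuous_flat_alg. Qed.

Lemma sqint_cube (M k : R) (f : 'rV[R]_n -> R) : measurable_fun setT f ->
  (forall x, `|f x| <= k) -> (forall x, f x != 0 -> cube (- M) M x) ->
  sqint mu f.
Proof.
move=> mf fk fM.
apply: (@sqint_dom _ _ _ _ _ (fun x => k * \1_(@cube R n (- M) M) x)) => //;
    last first.
  move=> x; rewrite normrM indicE; have [xM|xM] := boolP (x \in cube (- M) M).
    rewrite normr1 mulr1; exact: le_trans (fk x) (ler_norm _).
  rewrite normr0 mulr0; case: (eqVneq (f x) 0) => [->|/fM /mem_set];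
      first by rewrite normr0.
  by rewrite (negbTE xM).
by apply/sqintZ/sqint_indic; [exact: measurable_cube|exact: mu_cube_lty].
Qed.

Lemma sqint_bump f : bump_fun f -> sqint mu f.
Proof.
move=> bf; have mf := measurable_bump bf; case: bf => [/flat_alg_bnd[k fk] [M fM]].
exact: sqint_cube fk fM.
Qed.

End bump_algebra.

(** * Density of bumps in L^2 *)

Section bump_density.
Context {R : realType} {n : nat}.
Local Notation mu := (lebesgue_rV R n).
Implicit Types f g : 'rV[R]_n -> R.

(** The L^2 closure of the bumps. It is stable under linear combinations and dominated limits, which
    carries it from open boxes to measurable sets, simple functions and finally all of L^2. *)
Definition bump_adh f := sqint mu f /\
  forall e : R, 0 < e -> exists2 phi : 'rV[R]_n -> R, bump_fun phi &
      nrm2 mu (fun x => f x - phi x) < e.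

Lemma bump_adh_lim f : sqint mu f ->
  (forall e : R, 0 < e -> exists2 g : 'rV[R]_n -> R, bump_adh g &
      nrm2 mu (fun x => f x - g x) < e) ->
  bump_adh f.
Proof.
move=> sf fg; split=> // e e0; have e20 : 0 < e / 2 by rewrite divr_gt0.
have [g [sg gphi] fge] := fg _ e20; have [phi bphi gphie] := gphi _ e20.
exists phi => //; have sphi := sqint_bump bphi.
rewrite (_ : (fun x => f x - phi x) = (fun x => (f x - g x) + (g x - phi x)));
    last first.
  by apply/funext => x; ring.
apply: (le_lt_trans (nrm2D (sqintB sf sg) (sqintB sg sphi))).
by rewrite [ltRHS]splitr ltrD.
Qed.

Lemma bump_adhD f g : bump_adh f -> bump_adh g -> bump_adh (fun x => f x + g x).
Proof.
move=> [sf fphi] [sg gphi]; split; first exact: sqintD.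
move=> e e0; have e20 : 0 < e / 2 by rewrite divr_gt0.
have [phi bphi h1] := fphi _ e20; have [psi bpsi h2] := gphi _ e20.
exists (fun x => phi x + psi x); first exact: bumpD.
rewrite (_ : (fun x => _) = (fun x => (f x - phi x) + (g x - psi x))); last first.
  by apply/funext => x; ring.
apply: (le_lt_trans (nrm2D (sqintB sf (sqint_bump bphi))
    (sqintB sg (sqint_bump bpsi)))).
by rewrite [ltRHS]splitr ltrD.
Qed.

Lemma bump_adhZ k f : bump_adh f -> bump_adh (fun x => k * f x).
Proof.
move=> [sf fphi]; split; first exact: sqintZ.
move=> e e0; have k0 : 0 < `|k| + 1 by rewrite ltr_wpDl.
have [|phi bphi h] := fphi (e / (`|k| + 1)); first by rewrite divr_gt0.
exists (fun x => k * phi x); first exact: bumpZ.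
have := nrm2Z k (sqintB sf (sqint_bump bphi)).
under [X in nrm2 _ X = _ -> _]eq_fun do rewrite mulrBr.
move=> ->; rewrite -(@ltr_pM2l _ (`|k| + 1))// mulrCA mulfV ?gt_eqF// mulr1 in h.
apply: le_lt_trans h; rewrite ler_wpM2r ?nrm2_ge0// lerDl//.
Qed.

Lemma bump_adh0 : bump_adh (fun=> 0).
Proof.
split; first exact: sqint0.
move=> e e0; exists (fun=> 0); first exact: bump0.
by under eq_fun do rewrite subr0; rewrite /nrm2 ip0l sqrtr0.
Qed.

Lemma bump_adhB f g : bump_adh f -> bump_adh g -> bump_adh (fun x => f x - g x).
Proof.
move=> af /(bump_adhZ (-1)) ag; under eq_fun do rewrite -[- g _]mulN1r.
exact: bump_adhD.
Qed.

Lemma bump_adh_sum (I : Type) (s : seq I) (F : I -> 'rV[R]_n -> R) :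
  (forall i, bump_adh (F i)) -> bump_adh (fun x => \sum_(i <- s) F i x).
Proof.
move=> aF; elim: s => [|i s IH].
  under eq_fun do rewrite big_nil; exact: bump_adh0.
under eq_fun do rewrite big_cons; exact: bump_adhD.
Qed.

Lemma bump_adh_dominated (f_ : ('rV[R]_n -> R)^nat) f g :
  (forall k, bump_adh (f_ k)) -> measurable_fun setT f ->
  sqint mu g -> (forall k x, `|f_ k x| <= g x) ->
  (forall x, f_ k x @[k --> \oo] --> f x) -> bump_adh f.
Proof.
move=> af mf sg fg f_f.
have [] := @sqint_dominated _ _ _ mu f_ f g _ mf sg fg f_f.
  by move=> k; case: (af k) => -[].
move=> sf_ sf cvg; apply: bump_adh_lim => // e e0.
have e20 : 0 < e ^+ 2 by rewrite exprn_gt0.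
have /cvgr0Pnorm_lt/(_ _ e20) [N _ /(_ N (leqnn N))] := cvg.
rewrite /= ger0_norm ?ip_ge0// => h; exists (f_ N) => //.
by rewrite /nrm2 -(ltr_pXn2r (n := 2)) ?nnegrE ?sqrtr_ge0// ?ltW// sqr_sqrtr
    ?ip_ge0.
Qed.

Definition obox (a b : 'I_n -> R) : set 'rV[R]_n :=
    box (fun i => `]a i, b i[%classic).

Lemma measurable_obox a b : measurable (obox a b).
Proof. by apply: measurable_box => i; exact: measurable_itv. Qed.

Lemma mu_obox_lty a b : (mu (obox a b) < +oo)%E.
Proof.
rewrite lebesgue_rV_box//; under eq_bigr do rewrite lebesgue_measure_itv/= lte_fin.
rewrite (eq_bigr (fun i => (if a i < b i then b i - a i else 0)%:E)) ?prodEFin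
    ?ltry//.
by move=> i _; case: ifP.
Qed.

Lemma cvg_flat0 (t : R) : 0 < t -> flat 0 (k.+1%:R * t) @[k --> \oo] --> (1 : R).
Proof.
move=> t0; rewrite (_ : (fun k => _) = (fun k => expR (- (t^-1 * k.+1%:R^-1)))).
  have h : - (t^-1 * k.+1%:R^-1) @[k --> \oo] --> - (t^-1 * 0).
    by apply: cvgN; apply: cvgM; [exact: cvg_cst|exact: (@cvg_harmonic R)].
  rewrite mulr0 oppr0 in h.
  rewrite -[X in _ --> X]expR0.
  exact: (@continuous_cvg _ _ _ _ _ _ expR _ (@continuous_expR R 0) h).
by apply/funext => k; rewrite /flat mulr_gt0// expr0 invr1 mul1r invfM mulrC.
Qed.

Lemma flat0_le1 (t : R) : `|flat 0 t| <= 1.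
Proof. exact: flat_bnd. Qed.

(** Since [flat 0 (k * t)] increases to 1 for [t > 0] and vanishes for [t <= 0], the products over
    [i] of its values at [x_i - a_i] and [b_i - x_i] are bumps bounded by the indicator and
    converging to it. Open boxes are what makes the limit exact on the boundary. *)
Lemma bump_adh_obox a b : bump_adh (\1_(obox a b)).
Proof.
pose phi k (x : 'rV[R]_n) := \prod_(i < n)
  (flat 0 (k.+1%:R * x ord0 i + - (k.+1%:R * a i)) *
   flat 0 (- k.+1%:R * x ord0 i + k.+1%:R * b i)).
have phi_out k x : ~ obox a b x -> phi k x = 0.
  move=> /existsNP[i xi]; rewrite /phi (bigD1 i)//=.
  apply/eqP; rewrite mulf_eq0; apply/orP; left; rewrite mulf_eq0.
  have [xa|xa] := leP (x ord0 i) (a i).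
    by rewrite flat_le0 ?eqxx// -mulrBr pmulr_rle0// subr_le0.
  have xb : b i <= x ord0 i.
    by rewrite leNgt; apply/negP => xb; apply: xi; rewrite /= in_itv/= xa.
  by rewrite [X in _ || (X == _)]flat_le0 ?eqxx ?orbT// mulNr addrC -mulrBr
      pmulr_rle0// subr_le0.
have bphi k : bump_fun (phi k).
  split.
    by apply: flat_alg_prod => i; apply: flat_algM; exact: flat_alg_flat.
  exists (\sum_i (`|a i| + `|b i|)) => x.
  have [xo _|/phi_out ->] := pselect (obox a b x); last by rewrite eqxx.
  move=> i; have := xo i; rewrite /= !in_itv/= -ler_norml => /andP[ax xb].
  apply: (@le_trans _ _ (`|a i| + `|b i|)); last first.
    by rewrite (bigD1 i)//= lerDl sumr_ge0// => j _; rewrite addr_ge0.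
  rewrite ler_norml.
  have := ler_norm (b i); have := ler_norm (- a i); rewrite normrN.
  by have := normr_ge0 (a i); have := normr_ge0 (b i); lra.
have soo : sqint mu (\1_(obox a b)).
  by apply: sqint_indic; [exact: measurable_obox|exact: mu_obox_lty].
apply: (@bump_adh_dominated phi _ (\1_(obox a b))) => //.
- move=> k; split; first exact/sqint_bump.
  move=> e e0; exists (phi k) => //.
  by under eq_fun do rewrite subrr; rewrite /nrm2 ip0l sqrtr0.
- by case: soo.
- move=> k x; rewrite indicE; have [xo|xo] := boolP (x \in obox a b).
    rewrite /phi normr_prod; apply: prodr_ile1 => i _.
    by rewrite normr_ge0/= normrM mulr_ile1// flat0_le1.
  by rewrite phi_out ?normr0// => /mem_set; rewrite (negbTE xo).
- move=> x; rewrite indicE; have [xo|xo] := boolP (x \in obox a b); last first.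
    rewrite (_ : (fun k => _) = cst 0); first exact: cvg_cst.
    by apply/funext => k; rewrite phi_out// => /mem_set; rewrite (negbTE xo).
  have -> : true%:R = \prod_(i < n) (1 * 1) :> R.
    by rewrite big1// => i _; rewrite mulr1.
  apply: cvg_big => [|i _]; first by move=> z; exact: mul_continuous.
  have := set_mem xo i; rewrite /= in_itv/= => /andP[xa xb].
  apply: cvgM.
    under eq_fun do rewrite -mulrBr.
    by apply: cvg_flat0; rewrite subr_gt0.
  under eq_fun do rewrite mulNr addrC -mulrBr.
  by apply: cvg_flat0; rewrite subr_gt0.
Qed.

Definition oboxes : set (set 'rV[R]_n) := [set B | exists a b, B = obox a b].

Lemma oboxI a b a' b' : obox a b `&` obox a' b' =
  obox (fun i => Num.max (a i) (a' i)) (fun i => Num.min (b i) (b' i)).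
Proof.
apply/seteqP; split=> x /=.
  move=> [xo xo'] i; have := xo i; have := xo' i; rewrite /= !in_itv/=.
  by rewrite gt_max lt_min => /andP[-> ->] /andP[-> ->].
move=> xo; split=> i; have := xo i; rewrite /= !in_itv/= gt_max lt_min;
  by move=> /andP[/andP[h1 h2] /andP[h3 h4]]; apply/andP; split.
Qed.

Lemma obox_cover : \bigcup_k obox (fun=> - k%:R) (fun=> k%:R) = setT.
Proof.
rewrite -subTset => x _.
exists (Num.trunc (\sum_(i < n) `|x ord0 i|)).+1 => // i.
rewrite /= in_itv/= -ltr_norml.
apply: le_lt_trans (truncnS_gt _).
by rewrite (bigD1 i)//= lerDl sumr_ge0.
Qed.

Lemma measurable_rV_oboxes : @measurable _ 'rV[R]_n = <<s oboxes >>.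
Proof.
apply/seteqP; split; last first.
  apply: smallest_sub; first exact: sigma_algebra_measurable.
  by move=> _ [a [b ->]]; exact: measurable_obox.
apply: smallest_sub; first exact: smallest_sigma_algebra.
move=> B /=; rewrite -bigcup_seq => -[i _ BC].
have {BC} : <<s preimage_set_system setT (fun x : 'rV[R]_n => x ord0 i)
    (@RGenOpens.G R) >> B.
  by rewrite g_sigma_preimageE -(RGenOpens.measurableE R).
apply: smallest_sub; first exact: smallest_sigma_algebra.
move=> _ [_ [x [y ->]] <-]; rewrite setTI.
have -> : (fun x0 : 'rV[R]_n => x0 ord0 i) @^-1` `]x, y[%classic =
   \bigcup_k obox (fun j => if j == i then x else - k%:R)
                  (fun j => if j == i then y else k%:R).
  apply/seteqP; split=> [z /= zi|z [k _ /(_ i)]]; last by rewrite eqxx.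
  have : (\bigcup_k obox (fun=> - k%:R) (fun=> k%:R)) z by rewrite obox_cover.
  by move=> [k _ zk]; exists k => // j; case: eqP => [->|_]; [exact: zi|exact: zk].
apply: sigma_algebra_bigcup => k; apply: sub_sigma_algebra.
by do 2 eexists.
Qed.

(** The admissible [S] form a Dynkin class containing the open boxes. Cutting with a bounded box
    keeps measures finite, and the indicator of that box dominates the partial sums for countable
    disjoint unions. *)
Lemma bump_adh_indic (S : set 'rV[R]_n) k : measurable S ->
  bump_adh (\1_(S `&` obox (fun=> - k%:R) (fun=> k%:R))).
Proof.
move: S; pose o : set 'rV[R]_n := obox (fun=> - k%:R) (fun=> k%:R); rewrite -/o.
have mo : measurable o by exact: measurable_obox.
move=> S mS; have {mS} : <<s oboxes >> S by rewrite -measurable_rV_oboxes.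
move: S; apply: (@dynkin_induction _ _ oboxes (fun S =>
    bump_adh (\1_(S `&` o)))) => //.
- exact: measurable_rV_oboxes.
- by move=> _ _ [a [b ->]] [a' [b' ->]]; rewrite oboxI; do 2 eexists.
- by rewrite setTI; exact: bump_adh_obox.
- by move=> _ [a [b ->]]; rewrite /o oboxI; exact: bump_adh_obox.
- move=> S mS aS.
  have := bump_adhB (bump_adh_obox (fun=> - k%:R) (fun=> k%:R)) aS.
  congr bump_adh; apply/funext => x; rewrite !indicE !in_setI in_setC -/o.
  by case: (x \in o); case: (x \in S); rewrite /= ?subrr ?subr0.
- move=> F mF tF aF.
  pose F_ m (x : 'rV[R]_n) : R := \sum_(j < m) \1_(F j `&` o) x.
  (* By disjointness at most one [F j0] contains [x], so the partial sums at [x] jump once from 0 to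
     1, or stay 0. *)
  have FE x : (exists2 j0, o x & forall m, F_ m x = (j0 < m)%:R /\
        \1_((\bigcup_k F k) `&` o) x = 1 :> R) \/
      (forall m, F_ m x = 0 /\ \1_((\bigcup_k F k) `&` o) x = 0 :> R).
    have [[[j0 _ Fx] ox]|nFx] := pselect (((\bigcup_k F k) `&` o) x).
      left; exists j0 => // m; split; last first.
        by rewrite indicE mem_set//; split => //; exists j0.
      have E (j : nat) : \1_(F j `&` o) x = (j == j0)%:R :> R.
        rewrite indicE in_setI (mem_set ox) andbT.
        have [->|jj0] := eqVneq j j0; first by rewrite mem_set.
        rewrite memNset// => Fj; move: jj0; apply/negP/negPn/eqP.
        by apply: tF => //; exists x.
      rewrite /F_; elim: m => [|m IH]; first by rewrite big_ord0.
      rewrite big_ord_recr IH /= E ltnS [in RHS]leq_eqVlt [m == j0]eq_sym.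
      by case: (eqVneq j0 m) => [->|_]; rewrite ?ltnn ?add0r ?addr0.
    right=> m; split; last by rewrite indicE memNset.
    rewrite /F_ big1// => j _; rewrite indicE memNset// => -[Fj ox].
    by apply: nFx; split => //; exists j.
  apply: (@bump_adh_dominated F_ _ (\1_o)).
  + by move=> m; exact: bump_adh_sum.
  + apply: measurable_indic; apply: measurableI => //.
    exact: bigcup_measurable.
  + by apply: sqint_indic => //; exact: mu_obox_lty.
  + move=> m x; rewrite indicE; have [[j0 ox /(_ m)[-> _]]|/(_ m)[-> _]] := FE x.
      by rewrite mem_set//; case: (_ < _)%N; rewrite /= ?normr0 ?normr1.
    by rewrite normr0.
  + move=> x; have [[j0 ox Fm]|Fm] := FE x; last first.
      have [_ ->] := Fm 0%N.
      by under eq_fun do rewrite (Fm _).1; exact: cvg_cst.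
    have [_ ->] := Fm 0%N; apply: cvg_near_cst; exists j0.+1 => // m /= jm.
    by rewrite (Fm _).1 jm.
Qed.

Import HBNNSimple.

Lemma sqint_bump_adh f : sqint mu f -> bump_adh f.
Proof.
suff H g : sqint mu g -> (forall x, 0 <= g x) -> bump_adh g.
  move=> sf; have mf : measurable_fun setT f by case: sf.
  have sp : sqint mu (fun x => Num.max (f x) 0).
    apply: sqint_dom sf _; first exact: measurable_maxr.
    move=> x; have [h|h] := leP (f x) 0; first by rewrite normr0.
    by rewrite lexx.
  have sn : sqint mu (fun x => Num.max (- f x) 0).
    apply: sqint_dom sf _; first by apply: measurable_maxr => //;
        exact: measurableT_comp.
    move=> x; have [h|h] := leP (- f x) 0; first by rewrite normr0.
    by rewrite normrN lexx.
  have := bump_adhB (H _ sp _) (H _ sn _).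
  have -> : (fun x => Num.max (f x) 0 - Num.max (- f x) 0) = f.
    by apply/funext => x; case: (leP (f x) 0) => h1;
        case: (leP (- f x) 0) => h2; lra.
  by apply => x; rewrite le_max lexx orbT.
move=> sg g0; have mg : measurable_fun setT g by case: sg.
pose o (k : nat) : set 'rV[R]_n := obox (fun=> - k%:R) (fun=> k%:R).
have mEg : measurable_fun setT (EFin \o g) by exact/measurable_EFinP.
pose h := nnsfun_approx measurableT mEg.
have cvh x : h k x @[k --> \oo] --> g x.
  have : EFin \o h^~ x @ \oo --> (EFin \o g) x.
    by apply: cvg_nnsfun_approx => // y _; rewrite lee_fin.
  by move/fine_cvg.
have leh k x : h k x <= g x.
  rewrite -(cvg_lim _ (cvh x))//.
  apply: nondecreasing_cvgn_le; last by apply/cvg_ex; exists (g x); exact: cvh.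
  by move=> i j ij; have /lefP := nd_nnsfun_approx measurableT mEg ij; exact.
have h0 k x : 0 <= h k x by exact: fun_ge0.
(* The simple functions are also cut to growing boxes, because a level set of [h k] may have
   infinite measure. *)
apply: (@bump_adh_dominated (fun k x => h k x * \1_(o k) x) _ g) => //.
- move=> k; under eq_fun do rewrite fimfunEord mulr_suml.
  have aux (c : R) : bump_adh (fun x => c * \1_(h k @^-1` [set c]) x * \1_(o k) x).
    under eq_fun do rewrite -mulrA.
    apply: bump_adhZ.
    have := @bump_adh_indic (h k @^-1` [set c]) k.
    by rewrite indicI; apply; exact: measurable_funPTI.
  by apply: bump_adh_sum => i; exact: aux.
- move=> k x; rewrite normrM !ger0_norm// indicE.
  apply: le_trans (leh k x); rewrite ler_piMr//; by case: (_ \in _).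
- move=> x; have : (\bigcup_k o k) x by rewrite obox_cover.
  move=> [N _ xN].
  apply: cvg_trans (cvh x); apply: near_eq_cvg; exists N => // k /= Nk.
  rewrite indicE mem_set ?mulr1//= => i; have := xN i.
  have : N%:R <= k%:R :> R by rewrite ler_nat.
  rewrite /= !in_itv/= -!ltr_norml => h1 h2; exact: lt_le_trans h2 h1.
Qed.

Lemma bump_dense f : sqint mu f ->
  forall e : R, 0 < e -> exists2 phi : 'rV[R]_n -> R, bump_fun phi &
      nrm2 mu (fun x => f x - phi x) < e.
Proof. by move=> /sqint_bump_adh[]. Qed.

End bump_density.

(** * Weak derivatives via difference quotients *)

Section weak_derivative.
Context {R : realType} {n : nat}.
Local Notation mu := (lebesgue_rV R n).
Local Notation vec i := (delta_mx ord0 i : 'rV[R]_n).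
Local Notation ip := (ip mu).
Local Notation nrm2 := (nrm2 mu).
Implicit Types f g u v w : 'rV[R]_n -> R.

(** For a bump [phi] close to [w], the square norm of [w] equals the pairing of [w - phi] with [w],
    which Cauchy-Schwarz makes small. *)
Lemma sqint_bump_eq0 w : sqint mu w ->
  (forall phi, bump_fun phi -> ip phi w = 0) -> {ae mu, forall x, w x = 0}.
Proof.
move=> sw w0; apply: ip_eq0 => //; apply/eqP; rewrite eq_le ip_ge0 andbT.
apply/ler_addgt0Pl => e e0; rewrite addr0.
have [|phi bphi h] := bump_dense sw (e := e / (nrm2 w + 1)).
  by rewrite divr_gt0// ltr_wpDl ?nrm2_ge0.
have sphi := sqint_bump bphi.
have -> : ip w w = ip (fun x => w x - phi x) w by rewrite ipBl// (w0 _ bphi) subr0.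
apply: le_trans (ler_norm _) _.
apply: (le_trans (ip_CS_norm (sqintB sw sphi) sw)).
rewrite -[Num.sqrt _]/(nrm2 _) -[Num.sqrt (ip w w)]/(nrm2 _).
apply: (@le_trans _ _ (e / (nrm2 w + 1) * nrm2 w)).
  by rewrite ler_wpM2r ?nrm2_ge0// ltW.
rewrite mulrAC ler_pdivrMr ?ltr_wpDl ?nrm2_ge0//.
by apply: ler_wpM2l; [exact: ltW|rewrite lerDl].
Qed.

(** Duality: by density it is enough to test a norm bound on bumps. It transfers estimates from
    smooth functions to weakly differentiable ones. *)
Lemma nrm2_le_bump w K : sqint mu w -> 0 <= K ->
  (forall phi, bump_fun phi -> `|ip w phi| <= K * nrm2 phi) -> nrm2 w <= K.
Proof.
move=> sw K0 wK.
have [->//|w0] := eqVneq (nrm2 w) 0.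
have wgt0 : 0 < nrm2 w by rewrite lt_neqAle eq_sym w0 nrm2_ge0.
rewrite -(ler_pM2r wgt0) -expr2; apply/ler_addgt0Pr => e e0.
set d := K + nrm2 w; have d0 : 0 < d by rewrite ltr_wpDl.
have [|phi bphi h] := bump_dense sw (e := e / d); first by rewrite divr_gt0.
have sphi := sqint_bump bphi; have swp := sqintB sw sphi.
have -> : nrm2 w ^+ 2 = ip w phi + ip w (fun x => w x - phi x).
  by rewrite nrm2_sqr ipBr// addrC subrK.
have h1 : ip w phi <= K * (nrm2 w + e / d).
  apply: le_trans (ler_norm _) _; apply: (le_trans (wK _ bphi)).
  rewrite ler_wpM2l//.
  have -> : phi = (fun x => w x - (w x - phi x)) by apply/funext => x; ring.
  by apply: (le_trans (nrm2B sw swp)); rewrite lerD2l ltW.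
have h2 : ip w (fun x => w x - phi x) <= nrm2 w * (e / d).
  apply: le_trans (ler_norm _) _; apply: (le_trans (ip_CS_norm sw swp)).
  by rewrite ler_wpM2l ?nrm2_ge0// ltW.
apply: (le_trans (lerD h1 h2)).
rewrite mulrDr -addrA lerD2l -mulrDl -/d mulrCA mulfV ?gt_eqF// mulr1 //.
Qed.

Lemma is_derive_line_at f (x v : 'rV[R]_n) (t : R) d :
  is_derive (t *: v + x) v f d ->
  is_derive t (1 : R) (fun s : R => f (s *: v + x)) d.
Proof.
move=> [/cvg_ex[l fl] <-]; apply: is_derive_cvg.
rewrite /derive (cvg_lim _ fl)//.
apply: cvg_trans fl; apply: near_eq_cvg; apply: nearW => h /=.
by rewrite addrA -scalerDl [_%:A]mulr1.
Qed.

Lemma MVT_norm (F dF : R -> R) (K a b : R) :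
  (forall t : R, is_derive t (1 : R) F (dF t)) ->
  (forall t, `|t - a| <= `|b - a| -> `|dF t| <= K) ->
  `|F b - F a| <= K * `|b - a|.
Proof.
move=> FdF dFK.
have cF p q : {within `[p, q], continuous F}.
  apply: continuous_subspaceT => t; apply: differentiable_continuous.
  by apply/derivable1_diffP; case: (FdF t).
have [ab|ba] := leP a b.
  have [c] := MVT_segment ab (fun t _ => FdF t) (cF a b).
  rewrite in_itv/= => /andP[ac cb] ->; rewrite normrM ler_wpM2r//.
  by apply: dFK; rewrite !ger0_norm ?subr_ge0// lerD2r.
have [c] := MVT_segment (ltW ba) (fun t _ => FdF t) (cF b a).
rewrite in_itv/= => /andP[bc ca] E.
rewrite distrC E normrM [X in _ <= K * X]distrC ler_wpM2r//.
apply: dFK; rewrite distrC [leRHS]distrC !ger0_norm ?subr_ge0//; last exact: ltW.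
by rewrite lerD2l lerN2.
Qed.

(** The mean value bound is used twice along the line [t *: vec i + x], for the remainder and then
    for the first derivative; a sup bound on the second derivative gives the uniform [K]. *)
Lemma bump_taylor phi i : bump_fun phi -> exists2 K : R, 0 <= K & forall (s : R) x,
  `|phi (s *: vec i + x) - phi x - s * 'D_(vec i) phi x| <= K * s ^+ 2.
Proof.
move=> [Gphi _]; have Gphi' := flat_alg_partial i Gphi.
have [K phiK] := flat_alg_bnd (flat_alg_partial i Gphi').
have K0 : 0 <= K by exact: (le_trans _ (phiK 0)).
exists K => // s x.
pose F (t : R) := phi (t *: vec i + x).
pose F1 (t : R) := 'D_(vec i) phi (t *: vec i + x).
pose F2 (t : R) := 'D_(vec i) ('D_(vec i) phi) (t *: vec i + x).
have dF (t : R) : is_derive t (1 : R) F (F1 t).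
  exact: (is_derive_line_at (flat_alg_is_derive i _ Gphi)).
have dF1 (t : R) : is_derive t (1 : R) F1 (F2 t).
  exact: (is_derive_line_at (flat_alg_is_derive i _ Gphi')).
have F10 : F1 0 = 'D_(vec i) phi x by rewrite /F1 scale0r add0r.
have dG (t : R) : is_derive t (1 : R) (fun t => F t - t * F1 0) (F1 t - F1 0).
  have := is_deriveB (dF t) (is_deriveM (@is_derive_id _ _ t 1)
      (@is_derive_cst R R R (F1 0) t 1)).
  move/eq_is_derive; apply => //.
  by rewrite scaler0 add0r [_ *: _]mulr1.
have := @MVT_norm _ _ (K * `|s|) 0 s dG.
rewrite /F scale0r add0r mul0r subr0 F10 !subr0 => H.
rewrite addrAC -mulrA -expr2 -normrX in H.
rewrite (ger0_norm (sqr_ge0 s)) in H.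
apply: H => t; rewrite subr0 => ts.
rewrite -F10; have := @MVT_norm F1 F2 K 0 t dF1 (fun r _ => phiK _).
rewrite subr0 => h; apply: (le_trans h); exact: ler_wpM2l.
Qed.

Lemma ip_bump_shift_derive f phi i : sqint mu f -> bump_fun phi ->
  exists2 C : R, 0 <= C & forall h : R, `|h| <= 1 ->
  `|ip f (phi \o shift_rV (h *: vec i)) - ip f phi - h * ip f ('D_(vec i) phi)|
     <= C * h ^+ 2.
Proof.
move=> sf bphi; have [K K0 phiK] := bump_taylor i bphi.
have [M phiM] := bphi.2; have [M' phiM'] := (bump_partial i bphi).2.
(* The margin 1 covers the support of the translated bump for [|h| <= 1], so the Taylor remainder
   lives on one fixed cube and its L^2 norm is of order [h ^ 2]. *)
pose L := Num.max M M' + 1.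
pose I : 'rV[R]_n -> R := \1_(cube (- L) L).
have sI : sqint mu I.
  by apply: sqint_indic; [exact: measurable_cube|exact: mu_cube_lty].
exists (nrm2 f * (K * nrm2 I)); first by rewrite !mulr_ge0 ?nrm2_ge0.
move=> h h1.
have s1 := sqint_shift (h *: vec i) (sqint_bump bphi).
have s2 := sqint_bump bphi; have s3 := sqint_bump (bump_partial i bphi).
rewrite -ipBr// -ipZr// -ipBr//; [|exact: sqintB|exact: sqintZ].
set w := fun x => _.
have sw : sqint mu w by apply: sqintB; [exact: sqintB|exact: sqintZ].
apply: (le_trans (ip_CS_norm sf sw)).
rewrite -!mulrA ler_wpM2l ?sqrtr_ge0//.
have sKI := sqintZ (K * h ^+ 2) sI.
apply: (@le_trans _ _ (nrm2 (fun x => K * h ^+ 2 * I x))).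
  apply: ler_wsqrtr; apply: le_ip => // x.
  rewrite normrM; have [xL|xL] := boolP (x \in cube (- L) L).
    rewrite /I indicE xL normr1 mulr1; apply: le_trans (ler_norm _).
    exact: phiK.
  rewrite /I indicE (negbTE xL) normr0 mulr0 normr_le0.
  have ML : M <= L by rewrite /L (@le_trans _ _ (Num.max M M'))// ?lerDl//
      le_max lexx.
  have ML1 : M + 1 <= L by rewrite /L lerD2r le_max lexx.
  have ML' : M' <= L.
    by rewrite /L (@le_trans _ _ (Num.max M M'))// ?lerDl// le_max lexx orbT.
  rewrite /w /=.
  have -> : phi x = 0.
    by apply/eqP; apply: contraNT xL => /phiM /(bump_supp_le ML) /mem_set.
  have -> : 'D_(vec i) phi x = 0.
    by apply/eqP; apply: contraNT xL => /phiM' /(bump_supp_le ML') /mem_set.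
  rewrite mulr0 !subr0; apply: contraNT xL => /phiM xM; apply/mem_set => j.
  have := xM j; rewrite /= !in_itv/= -!ler_norml => xjM.
  apply: le_trans ML1.
  have -> : x ord0 j = shift_rV (h *: vec i) x ord0 j - (h *: vec i) ord0 j.
    by rewrite /shift_rV !mxE; ring.
  apply: le_trans (ler_normB _ _) _; apply: lerD => //.
  rewrite !mxE eqxx /=; case: eqP => _; first by rewrite mulr1.
  by rewrite mulr0 normr0.
rewrite nrm2Z// ger0_norm; last by apply: mulr_ge0 => //; exact: sqr_ge0.
by rewrite -mulrA [h ^+ 2 * _]mulrC.
Qed.

End weak_derivative.

Section weak_diff.
Context {R : realType} {n : nat}.
Local Notation mu := (lebesgue_rV R n).
Local Notation vec i := (delta_mx ord0 i : 'rV[R]_n).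
Local Notation ip := (ip mu).
Local Notation nrm2 := (nrm2 mu).
Implicit Types f g : 'rV[R]_n -> R.

(** The real form of a weak derivative, tested on bumps only. Density makes [g] unique up to a null
    set ([weak_diff_unique]) and is enough for the integration by parts in [weak_diff_ibp]. *)
Definition weak_diff (i : 'I_n) f g := [/\ sqint mu f, sqint mu g &
  forall phi, bump_fun phi -> ip ('D_(vec i) phi) f = - ip phi g].

Lemma derive_shift_rV f (v y : 'rV[R]_n) :
  'D_v (f \o shift_rV y) = 'D_v f \o shift_rV y.
Proof.
apply/funext => x; rewrite /derive /=.
set F := fun h => _; set G := (X in _ = lim (X @ _)).
suff -> : F = G by [].
by apply/funext => h; rewrite /F /G /= /shift_rV addrCA.
Qed.

Lemma weak_diffD i f g f' g' : weak_diff i f g -> weak_diff i f' g' ->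
  weak_diff i (fun x => f x + f' x) (fun x => g x + g' x).
Proof.
move=> [sf sg fg] [sf' sg' fg']; split; try exact: sqintD.
move=> phi bphi; have sp := sqint_bump bphi.
have sdp := sqint_bump (bump_partial i bphi).
by rewrite !ipDr// fg// fg'// opprD.
Qed.

Lemma weak_diffZ i k f g : weak_diff i f g ->
  weak_diff i (fun x => k * f x) (fun x => k * g x).
Proof.
move=> [sf sg fg]; split; try exact: sqintZ.
move=> phi bphi; have sp := sqint_bump bphi.
have sdp := sqint_bump (bump_partial i bphi).
by rewrite !ipZr// fg// mulrN.
Qed.

Lemma weak_diffB i f g f' g' : weak_diff i f g -> weak_diff i f' g' ->
  weak_diff i (fun x => f x - f' x) (fun x => g x - g' x).
Proof.
move=> fg /(weak_diffZ (-1)) fg'; have := weak_diffD fg fg'.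
by under eq_fun do rewrite mulN1r;
  under [X in weak_diff _ _ X -> _]eq_fun do rewrite mulN1r.
Qed.

Lemma weak_diff_shift i y f g : weak_diff i f g ->
  weak_diff i (f \o shift_rV y) (g \o shift_rV y).
Proof.
move=> [sf sg fg]; split; try exact: sqint_shift.
move=> phi bphi; have bs := bump_shift (- y) bphi.
have mf : measurable_fun setT f by case: sf.
have mg : measurable_fun setT g by case: sg.
have mp := measurable_bump bphi; have mdp := measurable_bump (bump_partial i bphi).
by rewrite ipC ip_shift// -derive_shift_rV ipC fg// ipC -ip_shift// ipC.
Qed.

Lemma weak_diff_unique i f g f' g' : weak_diff i f g -> weak_diff i f' g' ->
  {ae mu, forall x, f x = f' x} -> {ae mu, forall x, g x = g' x}.
Proof.
move=> [sf sg fg] [sf' sg' fg'] ff'.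
have : {ae mu, forall x, g x - g' x = 0}.
  apply: sqint_bump_eq0; first exact: sqintB.
  move=> phi bphi; have sp := sqint_bump bphi.
  have sdp := sqint_bump (bump_partial i bphi).
  rewrite ipBr//; apply/eqP; rewrite subr_eq0 -eqr_opp -fg// -fg'//; apply/eqP.
  by apply: eq_ip => //; exact: nearW.
by apply: filterS => x /eqP; rewrite subr_eq0 => /eqP.
Qed.

Lemma is_derive_quadratic (F : R -> R) (t d C eta : R) : 0 <= C -> 0 < eta ->
  (forall h, `|h| < eta -> `|F (h + t) - F t - h * d| <= C * h ^+ 2) ->
  is_derive t (1 : R) F d.
Proof.
move=> C0 eta0 FC; apply: is_derive_cvg; apply/cvgrPdist_le => e e0.
near=> h.
have hn0 : h != 0 by near: h; exact: nbhs_dnbhs_neq.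
have h1 : `|h| < eta by near: h; exact: dnbhs0_lt.
rewrite /= [_%:A]mulr1 -(ler_pM2l (_ : 0 < `|h|)) ?normr_gt0// -normrM mulrBr.
rewrite mulVKf// -normrN opprB.
apply: (le_trans (FC h h1)).
rewrite -real_normK ?num_real// expr2 mulrCA ler_wpM2l//.
have : `|h| <= e / (C + 1) by near: h; apply: dnbhs0_le;
    rewrite divr_gt0// ltr_wpDl.
rewrite ler_pdivlMr ?ltr_wpDl// => h2; apply: le_trans h2.
by rewrite mulrC ler_wpM2l// lerDl.
Unshelve. all: by end_near. Qed.

(** Translating the bump instead of [f] puts the differentiation on a smooth function; the
    definition of the weak derivative then moves it to [g]. *)
Lemma ip_shift_is_derive i f g phi (t : R) : weak_diff i f g -> bump_fun phi ->
  is_derive t (1 : R) (fun t : R => ip f (phi \o shift_rV (- (t *: vec i))))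
    (ip g (phi \o shift_rV (- (t *: vec i)))).
Proof.
move=> [sf sg fg] bphi; set psi := phi \o _.
have bpsi : bump_fun psi by exact: bump_shift.
have [C C0 HC] := ip_bump_shift_derive i sf bpsi.
apply: (is_derive_quadratic C0 ltr01) => h /ltW h1.
have := HC (- h); rewrite normrN => /(_ h1); rewrite sqrrN.
congr (`|_| <= _); congr (_ - _ - _).
  congr ip; apply/funext => x; rewrite /psi /= /shift_rV; congr phi.
  by rewrite scalerDl scaleNr opprD addrCA addrA.
by rewrite ipC fg// mulrNN ipC.
Qed.

(** Tested against a bump, the difference is the increment of the function differentiated in
    [ip_shift_is_derive], whose slope is at most [nrm2 g * nrm2 phi]; duality concludes. *)
Lemma nrm2_weak_diff i f g (h : R) : weak_diff i f g ->
  nrm2 (fun x => f (shift_rV (h *: vec i) x) - f x) <= `|h| * nrm2 g.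
Proof.
move=> fg; have [sf sg _] := fg.
have sfh := sqint_shift (h *: vec i) sf.
have mf : measurable_fun setT f by case: sf.
have mg : measurable_fun setT g by case: sg.
apply: nrm2_le_bump; first exact: sqintB.
  by rewrite mulr_ge0// nrm2_ge0.
move=> phi bphi; have sp := sqint_bump bphi; have mp := measurable_bump bphi.
rewrite ipBl//.
have D t := ip_shift_is_derive t fg bphi.
have := @MVT_norm _ _ _ (nrm2 g * nrm2 phi) 0 h D.
have -> : phi \o shift_rV (- (0 *: vec i)) = phi.
  by apply/funext => x; rewrite /= /shift_rV scale0r oppr0 add0r.
rewrite subr0 -ip_shift// => H.
rewrite -mulrA mulrC; apply: H => t _.
have := ip_CS_norm sg (sqint_shift (- (t *: vec i)) sp).
by rewrite -[Num.sqrt _]/(nrm2 _) -[X in _ * X]/(nrm2 _) nrm2_shift.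
Qed.

Definition diff_quot (i : 'I_n) (h : R) f : 'rV[R]_n -> R :=
  fun x => h^-1 * (f (shift_rV (h *: vec i) x) - f x).

Lemma sqint_diff_quot i h f : sqint mu f -> sqint mu (diff_quot i h f).
Proof. by move=> sf; apply/sqintZ/sqintB => //; exact: sqint_shift. Qed.

Lemma weak_diff_diff_quot i j h f g : weak_diff i f g ->
  weak_diff i (diff_quot j h f) (diff_quot j h g).
Proof.
by move=> fg; apply: weak_diffZ; apply: weak_diffB => //; exact: weak_diff_shift.
Qed.

Lemma ip_diff_quot i h f g : sqint mu f -> sqint mu g ->
  ip (diff_quot i h f) g = - ip f (diff_quot i (- h) g).
Proof.
move=> sf sg; have sfh := sqint_shift (h *: vec i) sf.
have sgh := sqint_shift (- h *: vec i) sg.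
rewrite ipZl ?ipZr//; try exact: sqintB.
rewrite ipBl// ipBr// invrN mulNr opprK; congr (_ * (_ - _)).
by rewrite scaleNr ip_shift//; [case: sf|case: sg].
Qed.

Lemma nrm2_diff_quot i f g (h : R) : h != 0 -> weak_diff i f g ->
  nrm2 (diff_quot i h f) <= nrm2 g.
Proof.
move=> h0 fg; have [sf sg _] := fg.
rewrite nrm2Z; last by apply: sqintB => //; exact: sqint_shift.
by rewrite normfV ler_pdivrMl ?normr_gt0// nrm2_weak_diff.
Qed.

(** Weak convergence of difference quotients. They are bounded by [nrm2 g], so convergence against
    bumps, seen by moving the quotient onto the bump, extends to every [v] by density. *)
Lemma weak_diff_cvg i f g v : weak_diff i f g -> sqint mu v ->
  forall e : R, 0 < e -> exists2 d : R, 0 < d & forall h, h != 0 -> `|h| < d ->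
    `|ip (diff_quot i h f) v - ip g v| < e.
Proof.
move=> fg sv e e0; have [sf sg _] := fg.
have G0 : 0 < nrm2 g + 1 by rewrite ltr_wpDl ?nrm2_ge0.
have [|phi bphi vphi] := bump_dense sv (e := e / 3 / (nrm2 g + 1)).
  by rewrite !divr_gt0.
have sp := sqint_bump bphi.
have [C C0 HC] := ip_bump_shift_derive i sf bphi.
exists (Num.min 1 (e / 3 / (C + 1))).
  by rewrite lt_min ltr01/= !divr_gt0// ltr_wpDl.
move=> h h0; rewrite lt_min => /andP[h1 hd].
have sD := sqint_diff_quot i h sf.
have svp := sqintB sv sp.
have key u : sqint mu u -> nrm2 u <= nrm2 g ->
    `|ip u (fun x => v x - phi x)| < e / 3.
  move=> su ug; apply: (le_lt_trans (ip_CS_norm su svp)).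
  have H := vphi; rewrite ltr_pdivlMr// mulrC in H; apply: le_lt_trans H.
  by rewrite ler_wpM2r ?sqrtr_ge0// (le_trans ug)// lerDl.
have k1 := key _ sD (nrm2_diff_quot h0 fg).
have k2 := key _ sg (lexx _).
rewrite !ipBr// in k1 k2.
have k3 : `|ip (diff_quot i h f) phi - ip g phi| < e / 3.
  rewrite ip_diff_quot// ipZr//; last by apply: sqintB => //; exact: sqint_shift.
  rewrite ipBr//; last exact: sqint_shift.
  have := HC (- h); rewrite normrN => /(_ (ltW h1)).
  case: fg => _ _ /(_ _ bphi); rewrite ipC => ->.
  rewrite sqrrN mulrNN (ipC _ phi g) => H.
  rewrite invrN mulNr opprK.
  rewrite -(ltr_pM2l (_ : 0 < `|h|)) ?normr_gt0// -normrM mulrBr mulVKf//.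
  apply: (le_lt_trans H).
  rewrite -real_normK ?num_real// expr2 mulrCA ltr_pM2l ?normr_gt0//.
  rewrite ltr_pdivlMr ?ltr_wpDl// in hd; apply: le_lt_trans hd.
  by rewrite mulrC ler_wpM2l// lerDl.
move: k1 k2 k3.
set a1 := ip _ v; set a2 := ip _ phi; set a3 := ip g v; set a4 := ip g phi.
rewrite !ltr_norml => /andP[? ?] /andP[? ?] /andP[? ?].
by apply/andP; split; lra.
Qed.

(** Neither function is smooth, so the limit is taken in the exact discrete identity [ip_diff_quot],
    whose two sides converge by [weak_diff_cvg]. *)
Lemma weak_diff_ibp i f g f' g' : weak_diff i f g -> weak_diff i f' g' ->
  ip g f' = - ip f g'.
Proof.
move=> fg fg'; have [sf sg _] := fg; have [sf' sg' _] := fg'.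
apply/eqP; rewrite -subr_eq0 opprK; apply/eqP; apply: normr0_eq0; apply/eqP.
rewrite eq_le normr_ge0 andbT; apply/ler_addgt0Pl => e e0; rewrite addr0.
have e20 : 0 < e / 2 by rewrite divr_gt0.
have [d1 d10 H1] := weak_diff_cvg fg sf' e20.
have [d2 d20 H2] := weak_diff_cvg fg' sf e20.
pose h := Num.min d1 d2 / 2.
have h0 : 0 < h by rewrite divr_gt0// lt_min d10.
have hd : h < Num.min d1 d2 by rewrite ltr_pdivrMr// ltr_pMr ?lt_min ?d10// ltr1n.
move: hd; rewrite lt_min => /andP[hd1 hd2].
have := H1 h; rewrite gt_eqF// gtr0_norm// => /(_ isT hd1).
have := H2 (- h); rewrite oppr_eq0 gt_eqF// normrN gtr0_norm// => /(_ isT hd2).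
rewrite (ipC _ (diff_quot _ _ _) f) ip_diff_quot// (ipC _ g' f).
set a := ip f (diff_quot _ _ _).
rewrite !ltr_norml => /andP[? ?] /andP[? ?].
by rewrite ler_norml; apply/andP; split; lra.
Qed.

End weak_diff.

(** * Second weak derivatives: symmetry of the Hessian and its L^2 norm *)

Section sobolev2.
Context {R : realType} {n : nat}.
Local Notation mu := (lebesgue_rV R n).
Local Notation vec i := (delta_mx ord0 i : 'rV[R]_n).
Local Notation ip := (ip mu).
Local Notation nrm2 := (nrm2 mu).
Implicit Types f g : 'rV[R]_n -> R.
Implicit Types (G : 'I_n -> 'rV[R]_n -> R) (K : 'I_n -> 'I_n -> 'rV[R]_n -> R).

Definition sobolev2 f G K := (forall i, weak_diff i f (G i)) /\
  (forall i j, weak_diff j (G i) (K i j)).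

Definition trace_hess K : 'rV[R]_n -> R := fun x => \sum_i K i i x.

Lemma sqint_trace_hess f G K : sobolev2 f G K -> sqint mu (trace_hess K).
Proof. by move=> [_ GK]; apply: sqint_sum => i; case: (GK i i). Qed.

Lemma ip_trace_hess f G K f' G' : sobolev2 f G K ->
  (forall i, weak_diff i f' (G' i)) -> sqint mu f' ->
  ip (trace_hess K) f' = - \sum_i ip (G i) (G' i).
Proof.
move=> [_ GK] fG' sf'; rewrite ip_suml//; last by move=> i; case: (GK i i).
rewrite -sumrN; apply: eq_bigr => i _.
exact: (weak_diff_ibp (GK i i) (fG' i)).
Qed.

Lemma trace_hess_sym f G K f' G' K' : sobolev2 f G K -> sobolev2 f' G' K' ->
  sqint mu f -> sqint mu f' ->
  ip (trace_hess K) f' = ip f (trace_hess K').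
Proof.
move=> S S' sf sf'; rewrite (ip_trace_hess S S'.1)// [RHS]ipC.
rewrite (ip_trace_hess S' S.1)//; congr (- _).
by apply: eq_bigr => i _; rewrite ipC.
Qed.

Definition lim0 (a : R -> R) (l : R) := forall e : R, 0 < e ->
  exists2 d : R, 0 < d & forall h, h != 0 -> `|h| < d -> `|a h - l| < e.

Lemma lim0_unique (a b : R -> R) (l m : R) : lim0 a l -> lim0 b m ->
  (forall h, h != 0 -> a h = b h) -> l = m.
Proof.
move=> al bm ab; apply/eqP; rewrite -subr_eq0; apply/eqP; apply: normr0_eq0.
apply/eqP; rewrite eq_le normr_ge0 andbT; apply/ler_addgt0Pl => e e0; rewrite addr0.
have e20 : 0 < e / 2 by rewrite divr_gt0.
have [d1 d10 H1] := al _ e20; have [d2 d20 H2] := bm _ e20.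
pose h := Num.min d1 d2 / 2.
have h0 : 0 < h by rewrite divr_gt0// lt_min d10.
have hd : h < Num.min d1 d2 by rewrite ltr_pdivrMr// ltr_pMr ?lt_min ?d10// ltr1n.
move: hd; rewrite lt_min => /andP[hd1 hd2]; have hn0 : h != 0 by rewrite gt_eqF.
have := H1 h hn0; rewrite gtr0_norm// => /(_ hd1).
have := H2 h hn0; rewrite gtr0_norm// => /(_ hd2); rewrite (ab _ hn0).
by rewrite !ltr_norml ler_norml => /andP[? ?] /andP[? ?]; apply/andP; split; lra.
Qed.

Lemma lim0_refl (a : R -> R) (l : R) : lim0 a l -> lim0 (fun h => a (- h)) l.
Proof.
move=> al e e0; have [d d0 H] := al _ e0; exists d => // h h0 hd.
by apply: H; rewrite ?oppr_eq0 ?normrN.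
Qed.

(** Only one derivative is made discrete: a difference quotient in direction [i] commutes exactly
    with the derivative of the bump in direction [j], and [h] then tends to 0. *)
Lemma hess_sym f G K i j phi : sobolev2 f G K -> bump_fun phi ->
  ip (K i j) phi = ip (K j i) phi.
Proof.
move=> [fG GK] bphi; have sp := sqint_bump bphi.
have bdp := bump_partial j bphi; have sdp := sqint_bump bdp.
have sf : sqint mu f by case: (fG i).
have sG k : sqint mu (G k) by case: (fG k).
have h1 : lim0 (fun h => ip (diff_quot i h f) ('D_(vec j) phi))
    (ip (G i) ('D_(vec j) phi)).
  exact: weak_diff_cvg.
have h2 : lim0 (fun h => ip (diff_quot i h (G j)) phi) (ip (K j i) phi).
  exact: weak_diff_cvg.
have E : ip (G i) ('D_(vec j) phi) = - ip (K i j) phi.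
  by have [_ _ /(_ _ bphi)] := GK i j; rewrite ipC => ->; rewrite ipC.
apply: oppr_inj; rewrite -E.
have h2N : lim0 (fun h => - ip (diff_quot i h (G j)) phi) (- ip (K j i) phi).
  move=> e e0; have [d d0 H] := h2 _ e0; exists d => // h h0 hd.
  by rewrite -opprD normrN; exact: H.
apply: (lim0_unique h1 h2N) => h h0.
pose psi : 'rV[R]_n -> R := diff_quot i (- h) phi.
have bpsi : bump_fun psi by apply/bumpZ/bumpB => //; exact: bump_shift.
have -> : ip (diff_quot i h f) ('D_(vec j) phi) = - ip f ('D_(vec j) psi).
  rewrite ip_diff_quot//; congr (- ip _ _).
  have dp x : derivable phi x (vec j) by case: (flat_alg_is_derive j x bphi.1).
  have dps x : derivable (phi \o shift_rV (- h *: vec i)) x (vec j).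
    by case: (flat_alg_is_derive j x (bump_shift (- h *: vec i) bphi).1).
  apply/funext => x; rewrite /psi /diff_quot.
  pose shp : 'rV[R]_n -> R := phi \o shift_rV (- h *: vec i).
  have E1 : 'D_(vec j) ((- h)^-1 *: (shp - phi)) x =
      (- h)^-1 * ('D_(vec j) shp x - 'D_(vec j) phi x).
    rewrite deriveZ; last exact: derivableB.
    by rewrite deriveB.
  have E2 : 'D_(vec j) shp x = 'D_(vec j) phi (shift_rV (- h *: vec i) x).
    exact: (congr1 (fun F : 'rV[R]_n -> R => F x)
        (derive_shift_rV phi (vec j) (- h *: vec i))).
  by rewrite -E2 -E1; congr ('D_(vec j) _ x).
have [_ _ fGj] := fG j.
by rewrite ipC fGj// opprK ipC ip_diff_quot// opprK.
Qed.

Lemma hess_ae_sym f G K i j : sobolev2 f G K ->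
  {ae mu, forall x, K i j x = K j i x}.
Proof.
move=> S; have sK a b : sqint mu (K a b) by case: (S.2 a b).
have : {ae mu, forall x, K i j x - K j i x = 0}.
  apply: sqint_bump_eq0; first exact: sqintB.
  move=> phi bphi; have sp := sqint_bump bphi.
  by rewrite ipBr// ![ip phi _]ipC (hess_sym i j S bphi) subrr.
by apply: filterS => x /eqP; rewrite subr_eq0 => /eqP.
Qed.

Lemma ip_hess_diag f G K i j : sobolev2 f G K ->
  ip (K i i) (K j j) = ip (K i j) (K i j).
Proof.
move=> S; have [fG GK] := S; have sK a b : sqint mu (K a b) by case: (S.2 a b).
have sG a : sqint mu (G a) by case: (fG a).
transitivity (ip (K i j) (K j i)); last first.
  by apply: eq_ip => //; [exact: nearW|exact: hess_ae_sym S].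
have h1 : lim0 (fun h => ip (diff_quot j h (G j)) (K i i)) (ip (K j j) (K i i)).
  exact: weak_diff_cvg.
have h2 : lim0 (fun h => ip (diff_quot j h (G i)) (K j i)) (ip (K i j) (K j i)).
  exact: weak_diff_cvg.
rewrite ipC; apply: (lim0_unique h1 (lim0_refl h2)) => h h0.
have D := weak_diff_diff_quot j h (GK j i).
rewrite ipC (weak_diff_ibp (GK i i) D) ipC ip_diff_quot// opprK.
by rewrite ipC.
Qed.

Lemma hess_trace f G K : sobolev2 f G K ->
  \sum_i \sum_j ip (K i j) (K i j) = ip (trace_hess K) (trace_hess K).
Proof.
move=> S; have sK a b : sqint mu (K a b) by case: (S.2 a b).
rewrite ip_suml//; last exact: sqint_trace_hess S.
apply: eq_bigr => i _; rewrite [RHS]ipC ip_suml//.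
by apply: eq_bigr => j _; rewrite [RHS]ipC (ip_hess_diag i j S).
Qed.

End sobolev2.

(** * The superlinear term against second derivatives *)

Section averaging.
Context {R : realType} {n : nat}.
Local Notation mu := (lebesgue_rV R n).
Local Notation vec i := (delta_mx ord0 i : 'rV[R]_n).
Local Notation ip := (ip mu).
Local Notation nrm2 := (nrm2 mu).
Implicit Types f g : 'rV[R]_n -> R.
Implicit Types (G : 'I_n -> 'rV[R]_n -> R) (K : 'I_n -> 'I_n -> 'rV[R]_n -> R).

Definition icube (r : R) : 'rV[R]_n -> R := \1_(cube 0 r).

(** The mean of [f] over the cube [x + [0, r]^n]. Written as an inner product, it gives direct
    access to Cauchy-Schwarz and to translation of integrals. *)
Definition avg (r : R) f : 'rV[R]_n -> R :=
  fun x => (r ^+ n)^-1 * ip (f \o shift_rV x) (icube r).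

Lemma sqint_icube r : sqint mu (icube r).
Proof. by apply: sqint_indic; [exact: measurable_cube|exact: mu_cube_lty]. Qed.

Lemma measurable_icube r : measurable_fun setT (icube r).
Proof. by case: (sqint_icube r). Qed.

Lemma icube_sqr r x : icube r x * icube r x = icube r x.
Proof. by rewrite /icube indicE; case: (_ \in _); rewrite ?mulr1 ?mulr0. Qed.

Lemma ip_icube r : 0 <= r -> ip (icube r) (icube r) = r ^+ n.
Proof.
move=> r0; rewrite /ip /Rintegral; under eq_integral do rewrite icube_sqr.
rewrite integral_indic//; last exact: measurable_cube.
by rewrite setIT -[LHS]/(fine (lebesgue_rV R n (cube 0 r))) mu_cube// subr0.
Qed.

Lemma measurable_shift_prod : measurable_fun setT
  (fun z : 'rV[R]_n * 'rV[R]_n => shift_rV z.1 z.2).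
Proof.
apply/measurable_fun_rVP => i; under eq_fun do rewrite /shift_rV mxE.
apply: measurable_funD.
  exact: (measurableT_comp (measurable_rV_coord i) measurable_fst).
exact: (measurableT_comp (measurable_rV_coord i) measurable_snd).
Qed.

Lemma measurable_avg r f : sqint mu f -> measurable_fun setT (avg r f).
Proof.
(* Splitting into positive and negative parts, since measurability of the partial integral comes
   from Tonelli for nonnegative functions. *)
suff H g : sqint mu g -> (forall x, 0 <= g x) -> measurable_fun setT
    (fun x => ip (g \o shift_rV x) (icube r)).
  move=> sf; have mf : measurable_fun setT f by case: sf.
  have sp : sqint mu (fun x => Num.max (f x) 0).
    apply: sqint_dom sf _; first exact: measurable_maxr.
    move=> x; have [h|h] := leP (f x) 0; first by rewrite normr0.
    by rewrite lexx.
  have sn : sqint mu (fun x => Num.max (- f x) 0).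
    apply: sqint_dom sf _; first by apply: measurable_maxr => //;
        exact: measurableT_comp.
    move=> x; have [h|h] := leP (- f x) 0; first by rewrite normr0.
    by rewrite normrN lexx.
  have p0 g x : 0 <= Num.max (g x) 0 :> R by rewrite le_max lexx orbT.
  have := measurable_funB (H _ sp (p0 _)) (H _ sn (p0 (fun x => - f x))).
  move=> /(measurable_funM (measurable_cst ((r ^+ n)^-1))).
  congr measurable_fun; apply/funext => x; rewrite /avg; congr (_ * _).
  rewrite -[LHS]/(_ - _) -ipBl.
  - congr ip; apply/funext => y /=.
    by case: (leP (f _) 0) => h1; case: (leP (- f _) 0) => h2; lra.
  - exact: (sqint_shift x sp).
  - exact: (sqint_shift x sn).
  - exact: sqint_icube.
move=> sg g0; have mg : measurable_fun setT g by case: sg.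
apply: (measurableT_comp (fine_measurable measurableT)).
pose F (z : 'rV[R]_n * 'rV[R]_n) := (g (shift_rV z.1 z.2) * icube r z.2)%:E.
apply: (@measurable_fun_fubini_tonelli_F _ _ _ _ _ mu F).
  apply/measurable_EFinP; apply: measurable_funM.
    exact: (measurableT_comp mg measurable_shift_prod).
  exact: (measurableT_comp (measurable_icube r) measurable_snd).
by move=> z; rewrite lee_fin mulr_ge0// /icube indicE.
Qed.

Lemma avgB r f g : sqint mu f -> sqint mu g ->
  avg r (fun x => f x - g x) = fun x => avg r f x - avg r g x.
Proof.
move=> sf sg; apply/funext => x; rewrite /avg -mulrBr -ipBl//.
- exact: sqint_shift.
- exact: sqint_shift.
- exact: sqint_icube.
Qed.

Lemma avg_shift r f y : avg r (f \o shift_rV y) = avg r f \o shift_rV y.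
Proof.
apply/funext => x; rewrite /avg /=; congr (_ * ip _ _).
by apply/funext => z /=; rewrite /shift_rV addrA.
Qed.

(** Averaging preserves the constant [a], while the integrable part [h] contributes at most its
    whole integral divided by the volume of the cube. *)
Lemma avg_bound r f (h : 'rV[R]_n -> R) (a H : R) x : 0 < r -> sqint mu f ->
  0 <= a -> (forall x, `|f x| <= a + h x) -> (forall x, 0 <= h x) ->
  mu.-integrable setT (EFin \o h) -> \int[mu]_x h x <= H ->
  `|avg r f x| <= a + H / r ^+ n.
Proof.
move=> r0 sf a0 fh h0 ih hH; have rn0 : 0 < r ^+ n by rewrite exprn_gt0.
rewrite /avg normrM normfV (gtr0_norm rn0).
rewrite ler_pdivrMl// mulrDr [_ * (H / _)]mulrC mulfVK ?gt_eqF//.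
have sc := sqint_icube r; have sfx := sqint_shift x sf.
have isf := sqint_mul sfx sc.
apply: (le_trans (le_normr_Rintegral _ isf)) => //.
have mh : measurable_fun setT h by apply/measurable_EFinP; case/integrableP : ih.
have ihx := integrable_shift x ih.
have icc := sqint_mul sc sc.
apply: (@le_trans _ _ (\int[mu]_y (a * (icube r y * icube r y) +
    h (shift_rV x y)))).
  apply: le_Rintegral => //.
  - exact: integrable_norm.
  - by apply: integrable_addr => //; exact: integrable_scaler.
  move=> y _ /=; rewrite icube_sqr /icube indicE; case: (_ \in _).
    by rewrite !mulr1; exact: fh.
  by rewrite !mulr0 normr0 add0r.
rewrite RintegralD//; last exact: integrable_scaler.
rewrite RintegralZl// -/(ip _ _) (ip_icube (ltW r0)) [a * _]mulrC. rewrite lerD2l.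
apply: le_trans hH; rewrite /Rintegral.
by rewrite (@integral_shift _ _ x (EFin \o h))//; exact/measurable_EFinP.
Qed.

(** The value [f x - avg r f x] is the mean over [y] in the cube of [f x - f (x + y)].
    Cauchy-Schwarz in [y] bounds its square by the mean of the squares, and Tonelli lets the
    integral in [x] be taken first, where [B] applies. *)
Lemma avg_contract r f (B : R) : 0 < r -> sqint mu f -> 0 <= B ->
  (forall y, cube 0 r y -> nrm2 (fun x => f x - f (shift_rV y x)) <= B) ->
  sqint mu (fun x => f x - avg r f x) /\ nrm2 (fun x => f x - avg r f x) <= B.
Proof.
move=> r0 sf B0 fB; have rn0 : 0 < r ^+ n by rewrite exprn_gt0.
have mf : measurable_fun setT f by case: sf.
set w := fun x => f x - avg r f x.
have mw : measurable_fun setT w by apply: measurable_funB => //;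
    exact: measurable_avg.
pose F (z : 'rV[R]_n * 'rV[R]_n) : \bar R :=
  (((f z.1 - f (shift_rV z.1 z.2)) * icube r z.2) ^+ 2)%:E.
have mF : measurable_fun setT F.
  apply/measurable_EFinP; apply: measurable_funX; apply: measurable_funM.
    apply: measurable_funB.
      exact: (measurableT_comp mf measurable_fst).
    exact: (measurableT_comp mf measurable_shift_prod).
  exact: (measurableT_comp (measurable_icube r) measurable_snd).
have F0 z : (0 <= F z)%E by rewrite lee_fin sqr_ge0.
have sc := sqint_icube r.
have wF x : ((w x ^+ 2)%:E <= ((r ^+ n)^-1)%:E * \int[mu]_y F (x, y))%E.
  pose u := fun y => (f x - f (shift_rV x y)) * icube r y.
  have su : sqint mu u.
    have -> : u = fun y => f x * icube r y - icube r y * f (shift_rV x y).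
      by apply/funext => y; rewrite /u; ring.
    apply: sqintB; first exact: sqintZ.
    apply: (@sqint_bndM _ _ _ _ 1);
        [exact: measurable_icube| |exact: (sqint_shift x sf)].
    by move=> y; rewrite /icube indicE; case: (_ \in _); rewrite ?normr0 ?normr1.
  have uc : ip u (icube r) = r ^+ n * w x.
    have -> : ip u (icube r) = ip (fun y => f x * icube r y - f (shift_rV x y))
        (icube r).
      apply: eq_Rintegral => y _; rewrite /u !mulrBl -!mulrA icube_sqr; ring.
    rewrite ipBl//; [|exact: sqintZ|exact: (sqint_shift x sf)].
    rewrite ipZl// (ip_icube (ltW r0)) /w mulrBr /avg mulVKf ?gt_eqF//.
    by rewrite [f x * _]mulrC.
  have -> : (\int[mu]_y F (x, y) = (ip u u)%:E)%E.
    rewrite /ip /Rintegral fineK; last exact: integrable_fin_num (sqint_mul su su).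
    by apply: eq_integral => y _; rewrite /F /= expr2.
  have := ip_CS su sc; rewrite uc (ip_icube (ltW r0)) => H.
  rewrite -EFinM lee_fin -(ler_pM2l rn0) mulVKf ?gt_eqF//.
  rewrite -(ler_pM2r rn0); apply: le_trans H.
  by rewrite exprMn expr2 mulrAC.
have intF : (\int[mu]_x \int[mu]_y F (x, y) <= (r ^+ n * B ^+ 2)%:E)%E.
  rewrite (@fubini_tonelli _ _ _ _ _ mu mu F mF F0)//.
  have GB y : (\int[mu]_x F (x, y) <= (B ^+ 2 * (icube r y))%:E)%E.
    have sfy := sqint_shift y sf; have sd := sqintB sf sfy.
    have -> : (\int[mu]_x F (x, y) =
        \int[mu]_x ((icube r y) * ((f x - f (shift_rV y x)) *
        (f x - f (shift_rV y x))))%:E)%E.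
      apply: eq_integral => x _; rewrite /F /= exprMn [icube r y ^+ 2]expr2
          icube_sqr.
      by rewrite mulrC expr2 (_ : shift_rV x y = shift_rV y x)//; exact: addrC.
    rewrite /icube indicE; have [yc|yc] := boolP (y \in _); last first.
      under eq_integral do rewrite mul0r.
      by rewrite integral0 mulr0.
    under eq_integral do rewrite mul1r.
    rewrite -(fineK (integrable_fin_num _ (sqint_mul sd sd)))// lee_fin mulr1.
    rewrite -[leLHS]/(ip _ _) -nrm2_sqr lerXn2r ?nnegrE ?nrm2_ge0//.
    by apply: fB; exact: set_mem.
  have sBc := sqintZ (B ^+ 2) sc.
  apply: (@le_trans _ _ (\int[mu]_y (B ^+ 2 * (icube r y * icube r y))%:E)%E).
    apply: ge0_le_integral => //.
    - by move=> y _; exact: integral_ge0.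
    - exact: measurable_fun_fubini_tonelli_G.
    - apply/measurable_EFinP; apply: measurable_funM => //.
      by apply: measurable_funM; exact: measurable_icube.
    - by move=> y _; rewrite icube_sqr; exact: GB.
  rewrite -(fineK (integrable_fin_num _
      (integrable_scaler (B ^+ 2) (sqint_mul sc sc))))//.
  rewrite lee_fin -[leLHS]/(Rintegral _ _ _) RintegralZl//; last exact: sqint_mul.
  by rewrite -/(ip _ _) (ip_icube (ltW r0)) mulrC.
have intw : (\int[mu]_x (w x ^+ 2)%:E <= (B ^+ 2)%:E)%E.
  apply: (@le_trans _ _ (\int[mu]_x (((r ^+ n)^-1)%:E * \int[mu]_y F (x, y)))%E).
    apply: ge0_le_integral => //.
    - by move=> x _; rewrite lee_fin sqr_ge0.
    - by apply/measurable_EFinP; exact: measurable_funX.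
    - apply: emeasurable_funM => //.
      exact: (@measurable_fun_fubini_tonelli_F _ _ _ _ _ mu F mF F0).
  rewrite ge0_integralZl//.
  - rewrite -(@lee_pmul2l _ (r ^+ n)%:E) ?lte_fin//.
    rewrite muleA -EFinM mulfV ?gt_eqF// mul1e -EFinM.
    exact: intF.
  - exact: (@measurable_fun_fubini_tonelli_F _ _ _ _ _ mu F mF F0).
  - by move=> x _; apply: integral_ge0.
  - by rewrite lee_fin invr_ge0 ltW.
have sw : sqint mu w.
  split=> //; apply/integrableP; split.
    by apply/measurable_EFinP; exact: measurable_funX.
  under eq_integral do rewrite /= ger0_norm ?sqr_ge0//.
  by apply: le_lt_trans intw _; rewrite ltry.
split=> //.
rewrite -(ler_pXn2r (n := 2)) ?nnegrE ?nrm2_ge0// nrm2_sqr -lee_fin.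
rewrite /ip /Rintegral fineK; last exact: integrable_fin_num (sqint_mul sw sw).
by apply: le_trans intw; under eq_integral do rewrite -expr2.
Qed.

End averaging.

(** * Second averages compared with second derivatives *)

Section second_difference.
Context {R : realType} {n : nat}.
Local Notation mu := (lebesgue_rV R n).
Local Notation vec i := (delta_mx ord0 i : 'rV[R]_n).
Local Notation ip := (ip mu).
Local Notation nrm2 := (nrm2 mu).
Implicit Types f g : 'rV[R]_n -> R.
Implicit Types (G : 'I_n -> 'rV[R]_n -> R) (K : 'I_n -> 'I_n -> 'rV[R]_n -> R).

(** The translation by [y] is a succession of translations along the axes; the differences telescope
    and each is bounded by one weak derivative. *)
Lemma nrm2_shift_sub f G (y : 'rV[R]_n) : sqint mu f ->
    (forall i, weak_diff i f (G i)) ->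
  nrm2 (fun x => f x - f (shift_rV y x)) <= \sum_i `|y ord0 i| * nrm2 (G i).
Proof.
move=> sf fG; have mf : measurable_fun setT f by case: sf.
have {1}-> : y = \sum_i y ord0 i *: vec i by exact: row_sum_delta.
elim: (index_enum _) => [|i s IH].
  rewrite !big_nil (_ : (fun x => _) = fun=> 0) ?nrm2_0//.
  by apply/funext => x; rewrite /shift_rV add0r subrr.
rewrite !big_cons; set z := \sum_(j <- s) _ in IH *.
have sz := sqint_shift z sf; have syi := sqint_shift (y ord0 i *: vec i) sf.
have -> : (fun x => f x - f (shift_rV (y ord0 i *: vec i + z) x)) =
  (fun x => (f x - f (shift_rV z x)) +
    ((fun x => f x - f (shift_rV (y ord0 i *: vec i) x)) \o shift_rV z) x).
  apply/funext => x /=.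
  rewrite (_ : shift_rV _ x = shift_rV (y ord0 i *: vec i) (shift_rV z x));
      first by ring.
  by rewrite /shift_rV addrA.
have sd := sqintB sf syi.
apply: (le_trans (nrm2D (sqintB sf sz) (sqint_shift z sd))).
rewrite addrC; apply: lerD => //.
rewrite nrm2_shift; last by case: sd.
rewrite -nrm2N; under [X in nrm2 X]eq_fun do rewrite opprB.
exact: nrm2_weak_diff.
Qed.

(** With A the average, [f - w] is (1 - A) applied twice to [f]. Averages commute with translations,
    so [avg_contract] applies twice and each factor 1 - A costs one power of [r] and one
    derivative. *)
Lemma second_avg f G K (r : R) : sqint mu f -> sobolev2 f G K -> 0 < r ->
  let w := fun x => 2 * avg r f x - avg r (avg r f) x in
  sqint mu (avg r f) /\
  sqint mu (fun x => f x - w x) /\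
  nrm2 (fun x => f x - w x) <= r ^+ 2 * \sum_i \sum_j nrm2 (K i j).
Proof.
move=> sf [fG GK] r0 w.
have step g (H : 'I_n -> 'rV[R]_n -> R) : sqint mu g ->
    (forall i, weak_diff i g (H i)) ->
    forall y, cube 0 r y -> nrm2 (fun x => g x - g (shift_rV y x)) <=
        r * \sum_i nrm2 (H i).
  move=> sg gH y yr; apply: (le_trans (nrm2_shift_sub y sg gH)).
  rewrite mulr_sumr; apply: ler_sum => i _; rewrite ler_wpM2r ?nrm2_ge0//.
  by have := yr i; rewrite /= in_itv/= => /andP[y0 yr']; rewrite ger0_norm.
have sum0 (H : 'I_n -> 'rV[R]_n -> R) : 0 <= r * \sum_i nrm2 (H i).
  by apply: mulr_ge0; [exact: ltW|apply: sumr_ge0 => i _; exact: nrm2_ge0].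
have [s1 _] := avg_contract r0 sf (sum0 G) (step f G sf fG).
have sa : sqint mu (avg r f).
  have := sqintB sf s1; congr sqint; apply/funext => x; ring.
split=> //.
have -> : (fun x => f x - w x) =
    (fun x => (fun x => f x - avg r f x) x - avg r (fun x => f x - avg r f x) x).
  by apply/funext => x; rewrite /w avgB//; ring.
pose k := \sum_i \sum_j nrm2 (K i j).
have k0 : 0 <= k by apply: sumr_ge0 => i _; apply: sumr_ge0 => j _; exact: nrm2_ge0.
have B0 : 0 <= r ^+ 2 * k by rewrite mulr_ge0 ?sqr_ge0.
have [| s2 h2] := avg_contract r0 s1 B0; last by split.
move=> y yr; have sfy := sqint_shift y sf.
pose g x := f x - f (shift_rV y x).
have sg : sqint mu g by exact: sqintB.
have -> : (fun x => f x - avg r f x - (f (shift_rV y x) - avg r f (shift_rV y x))) =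
    (fun x => g x - avg r g x).
  apply/funext => x; rewrite /g avgB//.
  rewrite -[avg r (fun x => f (shift_rV y x)) x]/(avg r (f \o shift_rV y) x)
      avg_shift /=.
  by ring.
have gH i : weak_diff i g (fun x => G i x - G i (shift_rV y x)).
  by apply: weak_diffB => //; exact: weak_diff_shift.
have [//|_] := @avg_contract _ _ r g (r ^+ 2 * k) r0 sg B0; last exact.
move=> z zr; apply: (le_trans (step _ _ sg gH z zr)).
rewrite expr2 -mulrA; apply: ler_wpM2l; first exact: ltW.
rewrite mulr_sumr; apply: ler_sum => i _.
by apply: step => //; case: (fG i).
Qed.

(** Pointwise Chebyshev: above [a], the factor (t / a)^(q - 1) is at least 1. Applied to [|f|], it
    gives the splitting that [avg_bound] takes as input. *)
Lemma powR_abs_le (a t q : R) : 0 < a -> 1 < q -> 0 <= t ->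
  t <= a + t `^ q * a `^ (1 - q).
Proof.
move=> a0 q1 t0; have [ta|at_] := leP t a.
  by apply: (le_trans ta); rewrite lerDl mulr_ge0// powR_ge0.
have tp : 0 < t by exact: lt_trans at_.
apply: ler_wpDl; first exact: ltW.
have q0 : 0 < q by apply: lt_trans q1.
rewrite -(mulr_powRB1 t0 q0) -mulrA ler_pMr//.
rewrite (_ : 1 - q = - (q - 1)); last by rewrite opprB.
rewrite powRN ler_pdivlMr ?powR_gt0// mul1r.
by apply: ge0_ler_powR; rewrite ?nnegrE ?subr_ge0 ?ltW.
Qed.

(** The condition on [r] makes the cube so large that the bound on the integral of [|f|^q] keeps all
    averages well below [lam]. Where [|f|] exceeds [lam], subtracting [w] then removes at most half
    of it. *)
Lemma level_gap f G K (q Q lam r : R) : sqint mu f -> sobolev2 f G K ->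
  1 < q -> 0 < lam -> 0 < r ->
  mu.-integrable setT (EFin \o (fun x => `|f x| `^ q)) ->
  \int[mu]_x (`|f x| `^ q) <= Q -> Q * (lam / 12) `^ (- q) <= r ^+ n ->
  exists w : 'rV[R]_n -> R, [/\ sqint mu (fun x => f x - w x),
    nrm2 (fun x => f x - w x) <= r ^+ 2 * \sum_i \sum_j nrm2 (K i j) &
    forall x, lam < `|f x| -> `|f x| <= 2 * `|f x - w x|].
Proof.
move=> sf S q1 lam0 r0 fq fQ Qr.
have [sa [sw wK]] := second_avg sf S r0.
exists (fun x => 2 * avg r f x - avg r (avg r f) x); split=> // x fx.
(* Both averages will be at most [2 * a], so [w] is at most [2 * (2 * a) + 2 * a = 6 * a], which is
   half of [lam]. *)
pose a := lam / 12; have a0 : 0 < a by rewrite divr_gt0.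
have rn0 : 0 < r ^+ n by rewrite exprn_gt0.
have av z : `|avg r f z| <= 2 * a.
  have := @avg_bound _ _ r f (fun x => `|f x| `^ q * a `^ (1 - q)) a
      (Q * a `^ (1 - q)) z r0 sf (ltW a0).
  move=> H; have {H} : `|avg r f z| <= a + Q * a `^ (1 - q) / r ^+ n.
    apply: H.
    - by move=> y; exact: powR_abs_le.
    - by move=> y; rewrite mulr_ge0// powR_ge0.
    - by under eq_fun do rewrite mulrC; exact: integrable_scaler.
    - by rewrite RintegralZr// ler_wpM2r// powR_ge0.
  move=> /le_trans; apply; rewrite [leRHS]mulrC mulr_natr mulr2n lerD2l.
  have -> : a `^ (1 - q) = a * a `^ (- q).
    rewrite powRD; last by rewrite (gt_eqF a0) implybT.
    by rewrite (powRr1 (ltW a0)).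
  rewrite ler_pdivrMr// mulrCA.
  by apply: ler_wpM2l => //; exact: ltW.
have av2 : `|avg r (avg r f) x| <= 2 * a.
  have := @avg_bound _ _ r (avg r f) (fun=> 0) (2 * a) 0 x r0 sa.
  rewrite mul0r addr0; apply => //.
  - by rewrite mulr_ge0// ltW.
  - have [_ +] := @sqint0 _ _ _ mu.
    by apply: eq_integrable => // y _; rewrite /= expr0n.
  - by rewrite Rintegral_cst// mul0r.
set w := 2 * _ - _.
have : `|w| <= 6 * a.
  apply: le_trans (ler_normB _ _) _; rewrite normrM (@ger0_norm _ 2)//.
  by have := av x; lra.
have : `|f x| <= `|f x - w| + `|w|.
  by rewrite -{1}(subrK w (f x)) ler_normD.
rewrite /a; move: fx; lra.
Qed.

End second_difference.

Section power_bound.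
Context {R : realType} {n : nat}.
Local Notation mu := (lebesgue_rV R n).
Local Notation ip := (ip mu).
Local Notation nrm2 := (nrm2 mu).
Implicit Types f g : 'rV[R]_n -> R.
Implicit Types (G : 'I_n -> 'rV[R]_n -> R) (K : 'I_n -> 'I_n -> 'rV[R]_n -> R).

Lemma sum_geometric_le (y : R) m : 0 <= y -> y < 1 ->
  \sum_(k < m) y ^+ k <= (1 - y)^-1.
Proof.
move=> y0 y1; have y10 : 0 < 1 - y by rewrite subr_gt0.
rewrite -[leRHS]mul1r ler_pdivlMr//.
have -> : (\sum_(k < m) y ^+ k) * (1 - y) = 1 - y ^+ m.
  elim: m => [|m IH]; first by rewrite big_ord0 mul0r expr0 subrr.
  by rewrite big_ord_recr /= mulrDl IH exprS; ring.
by rewrite gerBl exprn_ge0.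
Qed.

Lemma sum_nrm2_hess_le f G K : sobolev2 f G K ->
  (\sum_i \sum_j nrm2 (K i j)) ^+ 2 <=
  (n%:R ^+ 4) * \sum_i \sum_j ip (K i j) (K i j).
Proof.
move=> [_ GK]; set S := \sum_i \sum_j ip _ _.
have S0 : 0 <= S by apply: sumr_ge0 => i _; apply: sumr_ge0 => j _; exact: ip_ge0.
have KS i j : nrm2 (K i j) <= Num.sqrt S.
  apply: ler_wsqrtr; rewrite /S (bigD1 i)//= (bigD1 j)//= -addrA lerDl addr_ge0//.
    by apply: sumr_ge0 => k _; exact: ip_ge0.
  by apply: sumr_ge0 => k _; apply: sumr_ge0 => l _; exact: ip_ge0.
have H : \sum_i \sum_j nrm2 (K i j) <= n%:R ^+ 2 * Num.sqrt S.
  apply: (@le_trans _ _ (\sum_(i < n) \sum_(j < n) Num.sqrt S)).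
    by apply: ler_sum => i _; apply: ler_sum => j _; exact: KS.
  by rewrite !sumr_const !card_ord -mulrnA -[leLHS]mulr_natl natrM expr2.
rewrite -[X in _ <= _ * X](sqr_sqrtr S0) (_ : 4 = 2 * 2)%N// exprM -exprMn.
rewrite lerXn2r// nnegrE; last by rewrite mulr_ge0 ?exprn_ge0 ?sqrtr_ge0.
by apply: sumr_ge0 => i _; apply: sumr_ge0 => j _; exact: nrm2_ge0.
Qed.

(* Dyadic level sets: where [lam < |f| <= 2 lam], [f] is comparable with its
   second difference at the scale [P * lam `^ (- (q / n))], whose L^2 norm is
   quadratically small in that scale; [p * n < q] makes the sum over the levels
   converge. *)
Lemma power_bound (p Q e : R) : (0 < n)%N -> 0 < p -> p * n%:R < 2 * p + 2 ->
  0 < Q -> 0 < e ->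
  exists2 C : R, 0 <= C & forall f G K, sqint mu f -> sobolev2 f G K ->
    mu.-integrable setT (EFin \o (fun x => `|f x| `^ (2 * p + 2))) ->
    \int[mu]_x (`|f x| `^ (2 * p + 2)) <= Q ->
    sqint mu (fun x => `|f x| `^ (2 * p + 1)) ->
    ip (fun x => `|f x| `^ (2 * p + 1)) (fun x => `|f x| `^ (2 * p + 1)) <=
    C * ip f f + e * \sum_i \sum_j ip (K i j) (K i j).
Proof.
move=> n0 p0 pn Q0 e0; set q := 2 * p + 2 in pn *.
have nR0 : 0 < n%:R :> R by rewrite ltr0n.
have q1 : 1 < q by rewrite /q; lra.
(* The decay exponent per level: [|f|^(2p)] contributes [lam^(2p)] and the squared scale contributes
   [lam^(- 2q / n)]. *)
pose gam := 2 * (q / n%:R) - 2 * p.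
have gam0 : 0 < gam.
  by rewrite /gam subr_gt0 ltr_pM2l// ltr_pdivlMr.
(* This choice turns the condition on the scale in [level_gap] into an equality. *)
pose P := (Q * 12 `^ q) `^ n%:R^-1.
have P0 : 0 < P by rewrite powR_gt0// mulr_gt0// powR_gt0.
pose rho lam := P * lam `^ (- (q / n%:R)).
have rho0 lam : 0 < lam -> 0 < rho lam by move=> l0; rewrite mulr_gt0// powR_gt0.
have rhoE lam : 0 < lam -> Q * (lam / 12) `^ (- q) <= rho lam ^+ n.
  move=> l0; rewrite /rho exprMn -!powR_mulrn ?powR_ge0//.
  rewrite -!powRrM mulVf ?gt_eqF// powRr1; last by rewrite mulr_ge0 ?powR_ge0// ltW.
  rewrite -mulNr mulfVK ?gt_eqF// powRM ?invr_ge0 ?(ltW l0)//.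
  have -> : 12^-1 `^ (- q) = 12 `^ q by rewrite -[12^-1]powR_inv1// -powRrM
      mulrNN mul1r.
  by rewrite le_eqVlt; apply/orP; left; apply/eqP; ring.
pose E := 2 * (2 `^ (2 * p)) * P ^+ 2.
have E0 : 0 < E by rewrite /E; apply: mulr_gt0;
    [apply: mulr_gt0 => //; exact: powR_gt0|exact: exprn_gt0].
have EE lam : 0 < lam -> 2 * (2 * lam) `^ (2 * p) * rho lam ^+ 2 =
    E * lam `^ (- gam).
  move=> l0; rewrite powRM ?ltW// /rho exprMn.
  rewrite -[(lam `^ _) ^+ 2]powR_mulrn ?powR_ge0// -powRrM.
  have -> : - gam = 2 * p + - (q / n%:R) * 2 by rewrite /gam; ring.
  rewrite powRD; last by rewrite (gt_eqF l0) implybT.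
  by rewrite /E; ring.
pose x : R := 2 `^ (- gam).
have x0 : 0 < x by rewrite powR_gt0.
have x1 : x < 1.
  have := @ler1_powR; rewrite /x powRN invf_lt1 ?powR_gt0//.
  have := gt0_ltr_powR gam0; move=> /(_ 1 2); rewrite !nnegrE powR1.
  by move=> H _; apply: H => //; rewrite ?ltr1n.
(* Solved from the requirement that the geometric sum over all levels, with the factor [n ^ 4] of
   [sum_nrm2_hess_le], be exactly [e]. The lowest level [Lam] is then fixed by
   [Lam^(- gam) = 1 / T]. *)
pose T := Num.sqrt (n%:R ^+ 4 * E ^+ 2 * (1 - x ^+ 2)^-1 / e).
have x2 : 0 < 1 - x ^+ 2 by rewrite subr_gt0 expr_lt1// ltW.
have T20 : 0 < n%:R ^+ 4 * E ^+ 2 * (1 - x ^+ 2)^-1 / e.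
  by rewrite !mulr_gt0 ?exprn_gt0 ?invr_gt0//.
have T0 : 0 < T by rewrite sqrtr_gt0.
pose Lam := T `^ gam^-1.
have Lam0 : 0 < Lam by rewrite powR_gt0.
have LamE : Lam `^ (- gam) = T^-1.
  by rewrite powRN /Lam -powRrM mulVf ?gt_eqF// powRr1 ?ltW.
pose lam k := 2 ^+ k * Lam.
have lam0 k : 0 < lam k by rewrite mulr_gt0// exprn_gt0.
have lamE k : lam k `^ (- gam) = x ^+ k / T.
  rewrite /lam powRM ?exprn_ge0 ?ltW// LamE; congr (_ * _).
  by rewrite -[2 ^+ k]powR_mulrn// powRAC -/x powR_mulrn// ltW.
exists ((Lam `^ (2 * p)) ^+ 2); first exact: sqr_ge0.
move=> f G K sf S fq fQ sF; set F := fun x => _ in sF *.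
have /choice[w Hw] : forall k, exists w : 'rV[R]_n -> R,
    [/\ sqint mu (fun x => f x - w x),
    nrm2 (fun x => f x - w x) <= rho (lam k) ^+ 2 * \sum_i \sum_j nrm2 (K i j) &
    forall x, lam k < `|f x| -> `|f x| <= 2 * `|f x - w x|].
  by move=> k; apply: (level_gap sf S q1 (lam0 k) (rho0 _ (lam0 k)) fq fQ);
      exact: rhoE.
set kap := \sum_i \sum_j nrm2 (K i j) in Hw.
have kap0 : 0 <= kap by apply: sumr_ge0 => i _; apply: sumr_ge0 => j _;
    exact: nrm2_ge0.
pose c k := 2 * (2 * lam k) `^ (2 * p).
have FE y : F y = `|f y| `^ (2 * p) * `|f y|.
  have p1 : 2 * p + 1 == 0 = false by apply/negbTE; rewrite gt_eqF//; lra.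
  by rewrite /F powRD ?p1// powRr1.
have sq0 (a : R) : 0 <= a * a by rewrite -expr2 sqr_ge0.
have D0 m y : 0 <= (Lam `^ (2 * p)) ^+ 2 * (f y * f y) +
    \sum_(k < m) (c k) ^+ 2 * ((f y - w k y) * (f y - w k y)).
  apply: addr_ge0; first by apply: mulr_ge0; [exact: sqr_ge0|exact: sq0].
  by apply: sumr_ge0 => k _; apply: mulr_ge0; [exact: sqr_ge0|exact: sq0].
(* Up to [Lam] the factor [|f|^(2p)] is bounded and the mass term suffices; a point with [|f|]
   between [lam m] and [lam m.+1] is charged entirely to the term of level [m]. *)
have pt m y : `|f y| <= lam m -> F y ^+ 2 <=
    (Lam `^ (2 * p)) ^+ 2 * (f y * f y) +
        \sum_(k < m) (c k) ^+ 2 * ((f y - w k y) * (f y - w k y)).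
  elim: m => [|m IH] fl.
    rewrite big_ord0 addr0 FE exprMn real_normK ?num_real// -expr2.
    rewrite ler_wpM2r ?sqr_ge0// lerXn2r ?nnegrE ?powR_ge0//.
    apply: ge0_ler_powR; rewrite ?nnegrE ?mulr_ge0 ?(ltW p0) ?(ltW Lam0)//.
    by move: fl; rewrite /lam expr0 mul1r.
  rewrite big_ord_recr/= addrA.
  have [fm|fm] := leP `|f y| (lam m).
    apply: (le_trans (IH fm)); rewrite lerDl.
    by apply: mulr_ge0; [exact: sqr_ge0|exact: sq0].
  apply: (@le_trans _ _ (c m ^+ 2 * ((f y - w m y) * (f y - w m y)))).
    have [_ _ /(_ y fm) H] := Hw m.
    rewrite FE -expr2 -exprMn -[leRHS]real_normK ?num_real//.
    rewrite lerXn2r ?nnegrE ?mulr_ge0 ?powR_ge0//.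
    rewrite normrM (@ger0_norm _ (c m)) /c ?mulr_ge0 ?powR_ge0//.
    rewrite [2 * _ `^ _]mulrC -mulrA; apply: ler_pM => //.
    have l20 : 0 <= 2 * lam m by apply: mulr_ge0 => //; exact: ltW.
    apply: ge0_ler_powR; rewrite ?nnegrE ?(mulr_ge0 _ (ltW p0))//.
    by move: fl; rewrite /lam exprS -mulrA.
  by rewrite lerDr; exact: D0.
have mf : measurable_fun setT f by case: sf.
have mnf : measurable_fun setT (fun y => `|f y|) by exact: measurableT_comp.
pose A m : set 'rV[R]_n := [set y | `|f y| <= lam m].
have mA m : measurable (A m).
  rewrite -[A m]setTI; have := mnf measurableT `]-oo, lam m]%classic
      (measurable_itv _).
  by congr measurable; apply/seteqP; split => y /=; rewrite in_itv.
pose F_ m y := F y * \1_(A m) y.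
set Sg := \sum_i \sum_j ip _ _.
set bnd := _ + e * Sg.
have Fm m : ip (F_ m) (F_ m) <= bnd.
  have sw k : sqint mu (fun y => f y - w k y) by case: (Hw k).
  pose D y := (Lam `^ (2 * p)) ^+ 2 * (f y * f y) +
     \sum_(k < m) (c k) ^+ 2 * ((f y - w k y) * (f y - w k y)).
  have i1 := integrable_scaler ((Lam `^ (2 * p)) ^+ 2) (sqint_mul sf sf).
  have i2 : mu.-integrable setT (EFin \o (fun y =>
      \sum_(k < m) (c k) ^+ 2 * ((f y - w k y) * (f y - w k y)))).
    elim: (m) => [|m' IH].
      have [_ +] := @sqint0 _ _ _ mu.
      by apply: eq_integrable => // y _; rewrite /= big_ord0 expr0n.
    have := integrable_addr IH (integrable_scaler (c m' ^+ 2)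
        (sqint_mul (sw m') (sw m'))).
    by apply: eq_integrable => // y _; rewrite /= big_ord_recr.
  have sFm : sqint mu (F_ m).
    apply: (sqint_dom _ sF).
      by apply: measurable_funM; [case: sF|exact: measurable_indic].
    move=> y; rewrite /F_ normrM indicE; case: (_ \in _); rewrite ?normr1 ?mulr1//.
    by rewrite normr0 mulr0.
  apply: (@le_trans _ _ (\int[mu]_y D y)).
    apply: le_Rintegral => //; [exact: sqint_mul|exact: integrable_addr|].
    move=> y _; rewrite /F_ indicE; have [yA|yA] := boolP (y \in A m).
      by rewrite mulr1 -expr2; apply: pt; exact: set_mem.
    by rewrite mulr0 mul0r; exact: D0.
  rewrite RintegralD// RintegralZl//; last exact: sqint_mul.
  rewrite lerD2l.
  have -> : \int[mu]_y (\sum_(k < m) (c k) ^+ 2 * ((f y - w k y) * (f y - w k y))) =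
      \sum_(k < m) c k ^+ 2 * ip (fun y => f y - w k y) (fun y => f y - w k y).
    elim: (m) => [|m' IH].
      rewrite big_ord0 (_ : (fun y => _) = cst 0) ?Rintegral_cst ?mul0r//.
      by apply/funext => y; rewrite big_ord0.
    rewrite big_ord_recr /= -IH -RintegralZl//; last exact: sqint_mul.
    rewrite -RintegralD//.
    - by apply: eq_Rintegral => y _; rewrite big_ord_recr.
    - elim: (m') => [|m'' IH'].
        have [_ +] := @sqint0 _ _ _ mu.
        by apply: eq_integrable => // y _; rewrite /= big_ord0 expr0n.
      have := integrable_addr IH' (integrable_scaler (c m'' ^+ 2)
          (sqint_mul (sw m'') (sw m''))).
      by apply: eq_integrable => // y _; rewrite /= big_ord_recr.
    - by apply: integrable_scaler; exact: sqint_mul.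
  apply: (@le_trans _ _ (\sum_(k < m) (E / T * kap) ^+ 2 * (x ^+ 2) ^+ k)).
    apply: ler_sum => k _.
    have [_ Hk _] := Hw k.
    rewrite -nrm2_sqr -exprMn -exprM mulnC exprM -exprMn.
    have c0 : 0 <= c k by rewrite mulr_ge0 ?powR_ge0.
    have h1 : 0 <= c k * nrm2 (fun y => f y - w k y) by rewrite mulr_ge0// nrm2_ge0.
    have h2 : 0 <= E / T * kap * x ^+ k.
      by rewrite mulr_ge0 ?exprn_ge0 ?(ltW x0)// mulr_ge0// divr_ge0 ?(ltW E0)
          ?(ltW T0).
    apply: lerXn2r; rewrite ?nnegrE//.
    apply: (@le_trans _ _ (c k * (rho (lam k) ^+ 2 * kap))); first exact: ler_wpM2l.
    by rewrite mulrA /c EE// lamE le_eqVlt; apply/orP; left; apply/eqP; ring.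
  rewrite -mulr_sumr.
  have x21 : x ^+ 2 < 1 by rewrite -subr_gt0.
  have := sum_geometric_le m (sqr_ge0 x) x21.
  move=> /(ler_wpM2l (sqr_ge0 (E / T * kap))) /le_trans; apply.
  have kS : kap ^+ 2 <= n%:R ^+ 4 * Sg := sum_nrm2_hess_le S.
  have TT : T ^+ 2 = n%:R ^+ 4 * E ^+ 2 * (1 - x ^+ 2)^-1 / e
      by rewrite sqr_sqrtr// ltW.
  have n40 : 0 < n%:R ^+ 4 :> R by rewrite exprn_gt0.
  have -> : (E / T * kap) ^+ 2 / (1 - x ^+ 2) = e / n%:R ^+ 4 * kap ^+ 2.
    have alg (E' N' X' k' : R) : E' != 0 -> N' != 0 -> X' != 0 ->
        E' ^+ 2 / (N' * E' ^+ 2 * X'^-1 / e) * k' / X' = e / N' * k'.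
      by move=> hE hN hX; field; rewrite hE hN hX gt_eqF.
    have -> : (E / T * kap) ^+ 2 = E ^+ 2 / T ^+ 2 * kap ^+ 2 by rewrite -exprVn
        -!exprMn.
    by rewrite TT alg// gt_eqF.
  have -> : e * Sg = e / n%:R ^+ 4 * (n%:R ^+ 4 * Sg) by field; rewrite gt_eqF.
  by rewrite ler_wpM2l// divr_ge0 ?(ltW e0) ?(ltW n40).
have F0 y : 0 <= F y by exact: powR_ge0.
(* The bound [Fm] does not depend on the number of levels. As [F] is square integrable, the
   truncations converge to it in L^2 and the bound passes to the limit. *)
have [| | | |sF_ _ cvF] := @sqint_dominated _ _ _ mu F_ F F _ _ sF.
- by move=> m; apply: measurable_funM; [case: sF|exact: measurable_indic].
- by case: sF.
- move=> m y; rewrite /F_ normrM indicE (ger0_norm (F0 y)).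
  by case: (_ \in _); rewrite ?normr1 ?mulr1// normr0 mulr0.
- move=> y; apply: cvg_near_cst.
  exists (Num.trunc (`|f y| / Lam)).+1 => // m /= ym.
  rewrite /F_ indicE mem_set ?mulr1// /A /= /lam.
  rewrite -ler_pdivrMr//; apply: le_trans (ltW (truncnS_gt _)) _.
  apply: (@le_trans _ _ m%:R); first by rewrite ler_nat.
  by rewrite -natrX ler_nat ltnW// ltn_expl.
have b0 : 0 <= bnd := le_trans (ip_ge0 _ _) (Fm 0%N).
rewrite -nrm2_sqr -[leRHS]sqr_sqrtr// lerXn2r ?nnegrE ?nrm2_ge0 ?sqrtr_ge0//.
apply/ler_addgt0Pr => d d0.
have d20 : 0 < d ^+ 2 by rewrite exprn_gt0.
have /cvgr0Pnorm_lt/(_ _ d20) [N _ /(_ N (leqnn N))] := cvF.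
rewrite /= ger0_norm ?ip_ge0// -nrm2_sqr ltr_pXn2r ?nnegrE ?nrm2_ge0 ?(ltW d0)//
    => h.
have -> : F = fun y => F_ N y + (F y - F_ N y) by apply/funext => y; ring.
apply: (le_trans (nrm2D (sF_ N) (sqintB sF (sF_ N)))).
apply: lerD; last exact: ltW.
by apply: ler_wsqrtr; exact: Fm.
Qed.

End power_bound.

(** * Complex-valued functions and curves *)

Section complex_sobolev.
Context {R : realType} {n : nat}.
Local Notation mu := (lebesgue_rV R n).
Local Notation vec i := (delta_mx ord0 i : 'rV[R]_n).
Local Notation ip := (ip mu).
Local Notation nrm2 := (nrm2 mu).
Implicit Types (u v g : 'rV[R]_n -> Rcomplex R) (f : 'rV[R]_n -> R).

Definition re u : 'rV[R]_n -> R := fun x => complex.Re (u x).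
Definition im u : 'rV[R]_n -> R := fun x => complex.Im (u x).

Lemma Lfun_sqint f : f \in Lfun mu 2%:E <-> sqint mu f.
Proof.
split=> [fL|[mf fi]].
  split; last exact: Lfun2_integrable_sqr.
  by move: fL; rewrite inE => /andP[+ _]; rewrite inE.
rewrite inE; apply/andP; split; first by rewrite inE.
rewrite inE/= /finite_norm unlock /=.
rewrite poweR_lty//; move/integrableP : fi => [_].
congr (_ < _)%E; apply: eq_integral => x _ /=.
by rewrite powR_mulrn ?normr_ge0// normrX.
Qed.

Lemma in_L2P u : in_L2 u <-> sqint mu (re u) /\ sqint mu (im u).
Proof. by rewrite -!Lfun_sqint. Qed.

Lemma normRcomplex (z : Rcomplex R) :
  `|z| = Num.sqrt (complex.Re z ^+ 2 + complex.Im z ^+ 2).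
Proof. by case: z. Qed.

Lemma L2normE u : in_L2 u ->
  L2norm u = Num.sqrt (ip (re u) (re u) + ip (im u) (im u)).
Proof.
move=> /in_L2P[sr si]; rewrite /L2norm unlock /=.
have -> : (\int[mu]_x (`| `|u x| | `^ 2)%:E =
    (ip (re u) (re u) + ip (im u) (im u))%:E)%E.
  have irr := sqint_mul sr sr; have iii := sqint_mul si si.
  rewrite -[RHS]/(_%:E) /ip -RintegralD// /Rintegral fineK; last first.
    by apply: integrable_fin_num => //; exact: integrable_addr.
  apply: eq_integral => x _; rewrite normr_id powR_mulrn// normRcomplex.
  by rewrite sqr_sqrtr ?addr_ge0 ?sqr_ge0// -!expr2.
by rewrite poweR_EFin /= powR12_sqrt// addr_ge0 ?ip_ge0.
Qed.

Lemma L2norm_sqr u : in_L2 u ->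
  L2norm u ^+ 2 = ip (re u) (re u) + ip (im u) (im u).
Proof. by move=> uL; rewrite L2normE// sqr_sqrtr// addr_ge0 ?ip_ge0. Qed.

Lemma is_weak_partialP i u g : is_weak_partial i u g <->
  forall phi, test_function phi ->
    ip ('D_(vec i) phi) (re u) = - ip phi (re g) /\
    ip ('D_(vec i) phi) (im u) = - ip phi (im g).
Proof.
have cE phi v : cintegral (fun x => phi x *: v x) =
    (ip phi (re v) +i* ip phi (im v))%C.
  congr (_ +i* _)%C; apply: eq_Rintegral => x _; by rewrite ?/re ?/im; case: (v x).
split=> H phi /H; rewrite !cE.
  by case=> -> ->.
by case=> -> ->.
Qed.

Lemma weak_partial_diff i u g : in_L2 u -> in_L2 g -> is_weak_partial i u g ->
  weak_diff i (re u) (re g) /\ weak_diff i (im u) (im g).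
Proof.
move=> /in_L2P[su1 su2] /in_L2P[sg1 sg2] /is_weak_partialP H.
by split; split=> // phi /bump_test /H[].
Qed.

Lemma test_supp (phi : 'rV[R]_n -> R) : test_function phi ->
  exists2 M : R, 0 <= M & forall x, phi x != 0 -> cube (- M) M x.
Proof.
move=> [_ cK]; have [M [_ HM]] := compact_bounded cK.
exists (`|M| + 1); first by rewrite addr_ge0.
move=> x px i; rewrite /= in_itv/= -ler_norml.
have : `|x| <= `|M| + 1.
  apply: HM; last exact: subset_closure.
  by rewrite (le_lt_trans (ler_norm M))// ltrDl.
apply: le_trans; rewrite /Num.Def.normr /= mx_normrE.
by apply/bigmax_geP; right => /=; exists (ord0, i).
Qed.

Lemma continuous_supp_bnd (phi : 'rV[R]_n -> R) (M : R) : continuous phi ->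
  (forall x, phi x != 0 -> cube (- M) M x) -> exists k : R, forall x, `|phi x| <= k.
Proof.
move=> cphi pM.
have cK : compact (phi @` cube (- M) M).
  by apply: continuous_compact; [exact: continuous_subspaceT|exact: compact_cube].
have [N [_ HN]] := compact_bounded cK.
exists (`|N| + 1) => x; have [->|/pM xM] := eqVneq (phi x) 0.
  by rewrite normr0 addr_ge0.
apply: HN; last by exists x.
by rewrite (le_lt_trans (ler_norm N))// ltrDl.
Qed.

Lemma sqint_test (phi : 'rV[R]_n -> R) i : test_function phi ->
  sqint mu phi /\ sqint mu ('D_(vec i) phi).
Proof.
move=> tphi; have [M M0 pM] := test_supp tphi; have [sphi _] := tphi.
have cp : continuous phi by case: (sphi [::]).
have cdp : continuous ('D_(vec i) phi) by case: (sphi [:: i]).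
have dpM x : 'D_(vec i) phi x != 0 -> cube (- M) M x.
  apply: contraNP => xM.
  have oM : nbhs x (~` cube (- M) M).
    by apply: open_nbhs_nbhs; split => //; exact/closed_openC/closed_cube.
  rewrite (@near_eq_derive _ _ _ phi (cst 0)) ?derive_cst//.
  apply: filterS oM => y yM.
  by apply/eqP; apply: contra_notT yM; exact: pM.
have [k pk] := continuous_supp_bnd cp pM;
    have [l dpl] := continuous_supp_bnd cdp dpM.
split.
  exact: (sqint_cube (continuous_measurable_rV cp) pk pM).
exact: (sqint_cube (continuous_measurable_rV cdp) dpl dpM).
Qed.

Lemma in_L2D u v : in_L2 u -> in_L2 v -> in_L2 (u + v).
Proof.
move=> /in_L2P[su1 su2] /in_L2P[sv1 sv2]; apply/in_L2P; split.
  have := sqintD su1 sv1; congr sqint; apply/funext => x; rewrite /re.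
  by rewrite -[(u + v) x]/(u x + v x) raddfD.
have := sqintD su2 sv2; congr sqint; apply/funext => x; rewrite /im.
by rewrite -[(u + v) x]/(u x + v x) raddfD.
Qed.

Lemma reD u v : re (u + v) = fun x => re u x + re v x.
Proof. by apply/funext => x; rewrite /re -[(u + v) x]/(u x + v x) raddfD. Qed.

Lemma imD u v : im (u + v) = fun x => im u x + im v x.
Proof. by apply/funext => x; rewrite /im -[(u + v) x]/(u x + v x) raddfD. Qed.

Lemma reZ (k : R) u : re (k *: u) = fun x => k * re u x.
Proof. by apply/funext => x; rewrite /re -[(k *: u) x]/(k *: u x) linearZ. Qed.

Lemma imZ (k : R) u : im (k *: u) = fun x => k * im u x.
Proof. by apply/funext => x; rewrite /im -[(k *: u) x]/(k *: u x) linearZ. Qed.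

Lemma in_L2Z (k : R) u : in_L2 u -> in_L2 (k *: u).
Proof.
move=> /in_L2P[su1 su2]; apply/in_L2P; rewrite reZ imZ.
by split; exact: sqintZ.
Qed.

Lemma is_weak_partialD i u v g g' : in_L2 u -> in_L2 v -> in_L2 g -> in_L2 g' ->
  is_weak_partial i u g -> is_weak_partial i v g' ->
      is_weak_partial i (u + v) (g + g').
Proof.
move=> /in_L2P[su1 su2] /in_L2P[sv1 sv2] /in_L2P[sg1 sg2] /in_L2P[sh1 sh2].
move=> /is_weak_partialP ug /is_weak_partialP vg'; apply/is_weak_partialP =>
    phi tphi.
have [sp sdp] := sqint_test i tphi.
have [E1 E2] := ug phi tphi; have [E3 E4] := vg' phi tphi.
by rewrite !reD !imD !ipDr// E1 E2 E3 E4 !opprD.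
Qed.

Lemma is_weak_partialZ i (k : R) u g : in_L2 u -> in_L2 g ->
  is_weak_partial i u g -> is_weak_partial i (k *: u) (k *: g).
Proof.
move=> /in_L2P[su1 su2] /in_L2P[sg1 sg2].
move=> /is_weak_partialP ug; apply/is_weak_partialP => phi tphi.
have [sp sdp] := sqint_test i tphi.
have [E1 E2] := ug phi tphi.
by rewrite !reZ !imZ !ipZr// E1 E2 !mulrN.
Qed.

(** Since [weak_partial] picks an arbitrary representative, its algebraic rules hold only up to this
    relation. *)
Definition ae_eqc u v := {ae mu, forall x, re u x = re v x} /\
  {ae mu, forall x, im u x = im v x}.

Lemma is_weak_partial_ae i u v g : in_L2 u -> in_L2 v -> ae_eqc u v ->
  is_weak_partial i u g -> is_weak_partial i v g.
Proof.
move=> /in_L2P[su1 su2] /in_L2P[sv1 sv2] [uv1 uv2] /is_weak_partialP ug.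
apply/is_weak_partialP => phi tphi; have [E1 E2] := ug phi tphi.
have [sp sdp] := sqint_test i tphi.
rewrite -E1 -E2; split; (apply: eq_ip => //; [exact: nearW|]).
  by apply: filterS uv1 => x ->.
by apply: filterS uv2 => x ->.
Qed.

Lemma weak_partialP i u : in_H1 u ->
  in_L2 (weak_partial i u) /\ is_weak_partial i u (weak_partial i u).
Proof.
move=> [_ /(_ i)[g gL ug]].
rewrite /weak_partial; case: xgetP => [h -> []//|] /(_ g) [].
by split.
Qed.

Lemma in_H1D u v : in_H1 u -> in_H1 v -> in_H1 (u + v).
Proof.
move=> [uL ug] [vL vg]; split; first exact: in_L2D.
move=> i; have [g gL Hg] := ug i; have [h hL Hh] := vg i.
by exists (g + h); [exact: in_L2D|exact: is_weak_partialD].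
Qed.

Lemma in_H1Z (k : R) u : in_H1 u -> in_H1 (k *: u).
Proof.
move=> [uL ug]; split; first exact: in_L2Z.
move=> i; have [g gL Hg] := ug i.
by exists (k *: g); [exact: in_L2Z|exact: is_weak_partialZ].
Qed.

Lemma in_H1_ae u v : in_L2 v -> ae_eqc u v -> in_H1 u -> in_H1 v.
Proof.
move=> vL uv [uL ug]; split=> // i; have [g gL Hg] := ug i.
by exists g => //; exact: is_weak_partial_ae uv Hg.
Qed.

Lemma weak_partial_unique i u v g h : in_L2 u -> in_L2 v -> in_L2 g -> in_L2 h ->
  ae_eqc u v -> is_weak_partial i u g -> is_weak_partial i v h -> ae_eqc g h.
Proof.
move=> uL vL gL hL [uv1 uv2] ug vh.
have [d1 d2] := weak_partial_diff uL gL ug.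
have [d3 d4] := weak_partial_diff vL hL vh.
by split; [exact: weak_diff_unique d1 d3 uv1|exact: weak_diff_unique d2 d4 uv2].
Qed.

Lemma ae_eqc_refl u : ae_eqc u u.
Proof. by split; exact: nearW. Qed.

Lemma weak_partial_lin i (k : R) u v : in_H1 u -> in_H1 v ->
  ae_eqc (k *: weak_partial i u + weak_partial i v) (weak_partial i (k *: u + v)).
Proof.
move=> uH vH; have wH := in_H1D (in_H1Z k uH) vH.
have [guL gu] := weak_partialP i uH; have [gvL gv] := weak_partialP i vH.
have [gwL gw] := weak_partialP i wH.
have kguL := in_L2Z k guL; have uL := uH.1; have vL := vH.1.
have kuL := in_L2Z k uL.
apply: (weak_partial_unique (in_L2D kuL vL) (in_L2D kuL vL) _ gwL
    (ae_eqc_refl _) _ gw).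
  exact: in_L2D.
by apply: is_weak_partialD => //; exact: is_weak_partialZ.
Qed.

(** The first derivatives chosen for the combination agree only a.e. with the combination of those
    chosen for [u] and [v]; [in_H1_ae] transports membership across this. *)
Lemma in_H2_lin (k : R) u v : in_H2 u -> in_H2 v -> in_H2 (k *: u + v).
Proof.
move=> [uH uG] [vH vG]; have wH := in_H1D (in_H1Z k uH) vH; split; first exact: wH.
move=> i.
have [gwL gw] := weak_partialP i wH.
apply: (in_H1_ae gwL (weak_partial_lin i k uH vH)).
apply: in_H1D; [apply: in_H1Z; exact: uG|exact: vG].
Qed.

Lemma weak_partial2_lin i j (k : R) u v : in_H2 u -> in_H2 v ->
  ae_eqc (k *: weak_partial j (weak_partial i u) +
      weak_partial j (weak_partial i v))
   (weak_partial j (weak_partial i (k *: u + v))).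
Proof.
move=> uH2 vH2; have [uH uG] := uH2; have [vH vG] := vH2.
have [_ wG] := in_H2_lin k uH2 vH2.
have [guL gu] := weak_partialP j (uG i); have [gvL gv] := weak_partialP j (vG i).
have [gwL gw] := weak_partialP j (wG i).
have u1L := (uG i).1; have v1L := (vG i).1; have kgL := in_L2Z k guL;
    have kuL := in_L2Z k u1L.
apply: (weak_partial_unique (in_L2D kuL v1L) (wG i).1 _ gwL
    (weak_partial_lin i k uH vH) _ gw).
  exact: in_L2D.
by apply: is_weak_partialD => //; exact: is_weak_partialZ.
Qed.

Lemma in_H2_sobolev2 u : in_H2 u ->
  sobolev2 (re u) (fun i => re (weak_partial i u))
    (fun i j => re (weak_partial j (weak_partial i u))) /\
  sobolev2 (im u) (fun i => im (weak_partial i u))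
    (fun i j => im (weak_partial j (weak_partial i u))).
Proof.
move=> [uH uG].
have H1 i : weak_diff i (re u) (re (weak_partial i u)) /\
            weak_diff i (im u) (im (weak_partial i u)).
  have [gL g] := weak_partialP i uH; exact: (weak_partial_diff uH.1 gL g).
have H2 i j : weak_diff j (re (weak_partial i u))
    (re (weak_partial j (weak_partial i u))) /\
    weak_diff j (im (weak_partial i u)) (im (weak_partial j (weak_partial i u))).
  have [gL g] := weak_partialP j (uG i); exact: (weak_partial_diff (uG i).1 gL g).
split; split; [exact: (fun i => (H1 i).1)|exact: (fun i j => (H2 i j).1)
              |exact: (fun i => (H1 i).2)|exact: (fun i j => (H2 i j).2)].
Qed.

End complex_sobolev.

(** * The curve and the equation in real components *)

Section curve.
Context {R : realType} {n : nat}.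
Local Notation mu := (lebesgue_rV R n).
Local Notation ip := (ip mu).
Local Notation nrm2 := (nrm2 mu).
Implicit Types (u v g : 'rV[R]_n -> Rcomplex R) (f : 'rV[R]_n -> R).

(** Indexing real and imaginary parts by a boolean lets each real-valued argument serve for both,
    real pairings becoming sums over [c]. *)
Definition cmp (c : bool) : ('rV[R]_n -> Rcomplex R) -> 'rV[R]_n -> R :=
  if c then re else im.

Definition lap c u : 'rV[R]_n -> R :=
  trace_hess (fun i j => cmp c (weak_partial j (weak_partial i u))).

Lemma cmp_sobolev2 c u : in_H2 u ->
  sobolev2 (cmp c u) (fun i => cmp c (weak_partial i u))
    (fun i j => cmp c (weak_partial j (weak_partial i u))).
Proof. by move=> /in_H2_sobolev2[h1 h2]; case: c; [exact: h1|exact: h2]. Qed.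

Lemma sqint_cmp c u : in_L2 u -> sqint mu (cmp c u).
Proof. by move=> /in_L2P[h1 h2]; case: c; [exact: h1|exact: h2]. Qed.

Lemma sqint_lap c u : in_H2 u -> sqint mu (lap c u).
Proof. by move=> uH; exact: sqint_trace_hess (cmp_sobolev2 c uH). Qed.

Lemma nrm2_ae f f' : sqint mu f -> sqint mu f' -> {ae mu, forall x, f x = f' x} ->
  nrm2 f = nrm2 f'.
Proof. by move=> sf sg fg; congr Num.sqrt; exact: eq_ip. Qed.

Lemma nrm2_cmp_le c u : in_L2 u -> nrm2 (cmp c u) <= L2norm u.
Proof.
move=> uL; rewrite L2normE//; apply: ler_wsqrtr.
by case: c; rewrite /cmp ?lerDl ?lerDr ip_ge0.
Qed.

Lemma L2norm_le_H2norm u : L2norm u <= H2norm u.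
Proof.
rewrite -(ger0_norm (_ : 0 <= L2norm u)) -?sqrtr_sqr; last first.
  by apply: fine_ge0; exact: Lnorm_ge0.
apply: ler_wsqrtr; rewrite -addrA lerDl addr_ge0//.
  by apply: sumr_ge0 => i _; exact: sqr_ge0.
by apply: sumr_ge0 => i _; apply: sumr_ge0 => j _; exact: sqr_ge0.
Qed.

Lemma L2norm_wp2_le_H2norm i u :
  L2norm (weak_partial i (weak_partial i u)) <= H2norm u.
Proof.
have H (x : R) (a : 'I_n -> R) (b : 'I_n -> 'I_n -> R) :
    b i i ^+ 2 <= x ^+ 2 + \sum_k a k ^+ 2 + \sum_k \sum_l b k l ^+ 2.
  apply: (@le_trans _ _ (\sum_k \sum_l b k l ^+ 2)).
    rewrite (bigD1 i)//= (bigD1 (P := xpredT) i)//= -addrA lerDl addr_ge0//.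
      by apply: sumr_ge0 => l _; exact: sqr_ge0.
    by apply: sumr_ge0 => k _; apply: sumr_ge0 => l _; exact: sqr_ge0.
  rewrite lerDr addr_ge0 ?sqr_ge0//; apply: sumr_ge0 => k _; exact: sqr_ge0.
have w0 : 0 <= L2norm (weak_partial i (weak_partial i u)).
  by apply: fine_ge0; exact: Lnorm_ge0.
rewrite -(ger0_norm w0) -sqrtr_sqr /H2norm; apply: ler_wsqrtr.
exact: (H _ (fun k => L2norm (weak_partial k u))
  (fun k l => L2norm (weak_partial l (weak_partial k u)))).
Qed.

Lemma lap_lin c (k : R) u v : in_H2 u -> in_H2 v ->
  {ae mu, forall x, lap c (k *: u + v) x = k * lap c u x + lap c v x}.
Proof.
move=> uH vH.
have H i : {ae mu, forall x,
   cmp c (weak_partial i (weak_partial i (k *: u + v))) x =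
   k * cmp c (weak_partial i (weak_partial i u)) x +
   cmp c (weak_partial i (weak_partial i v)) x}.
  have [h1 h2] := weak_partial2_lin i i k uH vH.
  move: h1 h2; rewrite reD imD reZ imZ => h1 h2.
  case: c; rewrite /cmp.
    by apply: filterS h1 => x h; exact: (esym h).
  by apply: filterS h2 => x h; exact: (esym h).
have : {ae mu, forall x, forall i,
   cmp c (weak_partial i (weak_partial i (k *: u + v))) x =
   k * cmp c (weak_partial i (weak_partial i u)) x +
   cmp c (weak_partial i (weak_partial i v)) x}.
  by apply: filter_forall; exact: H.
apply: filterS => x Hx; rewrite /lap /trace_hess.
have sumE (a b : 'I_n -> R) : \sum_i (k * a i + b i) = k * \sum_i a i + \sum_i b i.
  by rewrite big_split /= mulr_sumr.
rewrite -sumE; apply: eq_bigr => i _; exact: Hx.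
Qed.

Lemma nrm2_lap_le c u : in_H2 u -> nrm2 (lap c u) <= n%:R * H2norm u.
Proof.
move=> uH; have S := cmp_sobolev2 c uH.
apply: (@le_trans _ _ (\sum_i nrm2 (cmp c (weak_partial i (weak_partial i u))))).
  by apply: nrm2_sum => i; case: (S.2 i i).
apply: (@le_trans _ _ (\sum_(i < n) H2norm u)); last first.
  by rewrite sumr_const card_ord mulr_natl.
apply: ler_sum => i _.
have [gL _] := weak_partialP i (uH.2 i).
by apply: (le_trans (nrm2_cmp_le c gL)); exact: L2norm_wp2_le_H2norm.
Qed.

Lemma cmp_lin c (k : R) u v : cmp c (k *: u + v) =
    fun x => k * cmp c u x + cmp c v x.
Proof. by case: c; rewrite /cmp ?reD ?imD ?reZ ?imZ. Qed.

(** Differentiability at [E] puts the difference quotient within H^2 distance 1 of [dpsi E] for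
    small [h], which bounds it. The constant [n] comes from [nrm2_lap_le]. *)
Lemma C1_H2_curve_lipschitz (a b : R) (psi : R -> 'rV[R]_n -> Rcomplex R) E :
  C1_H2_curve a b psi -> a < E < b ->
  exists (L eta : R), [/\ 0 <= L, 0 < eta & forall h : R, `|h| < eta ->
      a < h + E < b ->
    forall c, nrm2 (fun x => cmp c (psi (h + E)) x - cmp c (psi E) x) <= L * `|h| /\
     nrm2 (fun x => lap c (psi (h + E)) x - lap c (psi E) x) <= L * `|h|].
Proof.
move=> [dpsi Hd] aEb; have [uH dH cvg _] := Hd E aEb.
pose N c := nrm2 (cmp c (dpsi E)) + nrm2 (lap c (dpsi E)).
have N0 c : 0 <= N c by rewrite addr_ge0 ?nrm2_ge0.
have /cvgr0Pnorm_lt/(_ 1 ltr01) :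
    H2norm (h^-1 *: (psi (E + h) - psi E) - dpsi E) @[h --> 0^'] --> 0
    by exact: cvg.
move=> [eta /= eta0 Heta].
exists (1 + n%:R + N true + N false), eta; split => //.
  by apply: addr_ge0 => //; apply: addr_ge0 => //; apply: addr_ge0.
move=> h heta ahb c.
have [->|h0] := eqVneq h 0.
  rewrite normr0 mulr0 add0r.
  by split; under eq_fun do rewrite subrr; rewrite nrm2_0.
have [u'H _ _ _] := Hd (h + E) ahb.
have := Heta h; rewrite /ball /= sub0r normrN => /(_ heta h0).
set w := h^-1 *: _ - _ => w1.
(* The closure and linearity lemmas concern [k *: u + v], so the error [w] is assembled from such
   combinations, [- dpsi E] being written as [-2 *: dpsi E + dpsi E]. *)
have vH := in_H2_lin (-1) uH u'H; have dH' := in_H2_lin (-2) dH dH.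
have wH := in_H2_lin h^-1 vH dH'.
have wE : w = h^-1 *: (-1 *: psi E + psi (h + E)) + (-2 *: dpsi E + dpsi E).
  rewrite /w addrC [E + h]addrC [psi (h + E) - _]addrC scaleN1r [RHS]addrC;
      congr (_ + _).
  by rewrite -[X in _ = _ + X]scale1r -scalerDl -scaleN1r; congr (_ *: _); ring.
rewrite -wE in wH.
have wle : H2norm w <= 1 by apply: le_trans (ler_norm _) _; exact: ltW.
have LE : N c + 1 + n%:R <= 1 + n%:R + N true + N false.
  by have := N0 true; have := N0 false; case: c => ? ?; lra.
have sw := sqint_cmp c wH.1.1; have sd := sqint_cmp c dH.1.1.
have slw := sqint_lap c wH; have sld := sqint_lap c dH.
have slu := sqint_lap c uH; have slu' := sqint_lap c u'H.
have K0 f f' : sqint mu f -> sqint mu f' -> nrm2 f <= 1 + n%:R -> nrm2 f' <= N c ->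
    nrm2 (fun x => h * (f x + f' x)) <= (1 + n%:R + N true + N false) * `|h|.
  move=> s1 s2 l1 l2; rewrite nrm2Z; last exact: sqintD.
  rewrite mulrC ler_wpM2r//; apply: (le_trans (nrm2D s1 s2)).
  apply: le_trans LE; lra.
split.
  have -> : (fun x => cmp c (psi (h + E)) x - cmp c (psi E) x) =
     fun x => h * (cmp c w x + cmp c (dpsi E) x).
    apply/funext => x; rewrite wE !cmp_lin mulrDr mulrDr mulrA mulfV// mul1r; ring.
  apply: K0 => //; last by rewrite /N lerDl nrm2_ge0.
  apply: (le_trans (nrm2_cmp_le c wH.1.1)); apply: (le_trans (L2norm_le_H2norm w)).
  by apply: (le_trans wle); rewrite lerDl.
have -> : nrm2 (fun x => lap c (psi (h + E)) x - lap c (psi E) x) =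
     nrm2 (fun x => h * (lap c w x + lap c (dpsi E) x)).
  apply: nrm2_ae; [exact: sqintB|by apply: sqintZ; exact: sqintD|].
  have l1 := lap_lin c (-1) uH u'H; have l2 := lap_lin c (-2) dH dH.
  have l3 := lap_lin c h^-1 vH dH'; rewrite -wE in l3.
  have alg (lw ld m1 m2 lu lu' : R) : m1 = -1 * lu + lu' -> m2 = -2 * ld + ld ->
      lw = h^-1 * m1 + m2 -> lu' - lu = h * (lw + ld).
    by move=> -> -> ->; rewrite mulrDr mulrDr mulrA mulfV// mul1r; ring.
  apply: filterS3 l1 l2 l3 => x e1 e2 e3; exact: alg e1 e2 e3.
apply: K0 => //; last by rewrite /N lerDr nrm2_ge0.
apply: (le_trans (nrm2_lap_le c wH)).
rewrite -[leLHS]add0r lerD// ler_piMr//.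
Qed.

Lemma normRcomplex_powR (z : Rcomplex R) (p : R) :
  `|z| `^ (2 * p) = (complex.Re z ^+ 2 + complex.Im z ^+ 2) `^ p.
Proof.
rewrite powRrM powR_mulrn// normRcomplex sqr_sqrtr// addr_ge0 ?sqr_ge0//.
Qed.

Lemma is_solution_cmp (V : 'rV[R]_n -> R) (p sigma : R) u E :
  is_solution V p sigma u E -> {ae mu, forall x, forall c,
    lap c u x = V x * cmp c u x +
      sigma * ((cmp true u x ^+ 2 + cmp false u x ^+ 2) `^ p * cmp c u x) +
      E * cmp c u x}.
Proof.
apply: filterS => x H c.
have lapE : cmp c (laplacian u) x = lap c u x.
  have E1 : laplacian u x = \sum_i weak_partial i (weak_partial i u) x.
    by rewrite /laplacian fct_sumE.
  by case: c; rewrite /cmp /re /im E1 raddf_sum.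
have : cmp c (fun y => - laplacian u y + V y *: u y
    + (sigma * `|u y| `^ (2 * p)) *: u y + E *: u y) x = 0.
  by case: c {lapE}; rewrite /cmp /re /im H.
have -> : cmp c (fun y => - laplacian u y + V y *: u y
    + (sigma * `|u y| `^ (2 * p)) *: u y + E *: u y) x =
   - cmp c (laplacian u) x + V x * cmp c u x +
       (sigma * `|u x| `^ (2 * p)) * cmp c u x
     + E * cmp c u x.
  by case: c {lapE}; rewrite /cmp /re /im !raddfD /= !linearZ raddfN.
rewrite lapE normRcomplex_powR => h.
by rewrite /cmp /re /im in h *; lra.
Qed.

End curve.

(** * The a priori bound *)

Section real_lemmas.
Context {R : realType}.

(** Young's inequality for the conjugate exponents [p + 1] and [(p + 1) / p], applied to [a] and
    [b^p]. *)
Lemma young_powR (p a b : R) : 0 < p -> 0 <= a -> 0 <= b ->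
  (p + 1) * (b `^ p * a) <= a `^ (p + 1) + p * b `^ (p + 1).
Proof.
move=> p0 a0 b0; have p10 : 0 < p + 1 by rewrite addr_gt0.
have := @conjugate_powR _ a (b `^ p) (p + 1) ((p + 1) / p) a0 (powR_ge0 _ _) p10.
rewrite divr_gt0// => /(_ isT).
have -> : (p + 1)^-1 + ((p + 1) / p)^-1 = 1.
  by field; rewrite !gt_eqF.
move=> /(_ erefl); rewrite -powRrM (_ : p * ((p + 1) / p) = p + 1); last first.
  by field; rewrite gt_eqF.
move=> H; rewrite [b `^ p * a]mulrC.
have := ler_wpM2l (ltW p10) H; rewrite mulrDr.
rewrite (_ : (p + 1) * (a `^ (p + 1) / (p + 1)) = a `^ (p + 1)); last first.
  by field; rewrite gt_eqF.
rewrite (_ : (p + 1) * (b `^ (p + 1) / ((p + 1) / p)) = p * b `^ (p + 1))//.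
by field; rewrite !gt_eqF.
Qed.

Lemma powR_mul_succ (p s : R) : 0 < p -> 0 <= s -> s `^ p * s = s `^ (p + 1).
Proof.
move=> p0 s0; have p10 : 0 < p + 1 by rewrite addr_gt0.
by rewrite mulrC -(mulr_powRB1 s0 p10) addrK.
Qed.

(** The product of [Q + d] with [expR (k * E)] is nonincreasing for [k = - c] and nondecreasing for
    [k = c]. Both are used, because the interval is open and the comparison point has to be inside
    it, here the midpoint. *)
Lemma gronwall_bound (Q dQ : R -> R) (a b c d : R) : a < b -> 0 < c ->
  (forall E, a < E < b -> is_derive E (1 : R) Q (dQ E)) ->
  (forall E, a < E < b -> `|dQ E| <= c * (Q E + d)) ->
  exists M, forall E, a < E < b -> Q E <= M.
Proof.
move=> ab c0 QdQ dQle.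
pose E0 := (a + b) / 2.
have E0ab : a < E0 < b by rewrite /E0; apply/andP; split; lra.
(* The sign is a consequence of the bound on [|dQ E|], which forces its right-hand side to be
   nonnegative. *)
have Qd E : a < E < b -> 0 <= Q E + d.
  by move=> Eab; rewrite -(pmulr_rge0 _ c0); apply: le_trans (dQle E Eab).
have mean (k E1 E2 : R) : a < E1 < b -> a < E2 < b -> E1 < E2 ->
    exists2 e, a < e < b & (Q E2 + d) * expR (k * E2) - (Q E1 + d) * expR (k * E1) =
      expR (k * e) * (dQ e + k * (Q e + d)) * (E2 - E1).
  move=> E1ab E2ab E12.
  pose F E := (Q E + d) * expR (k * E).
  pose dF E := expR (k * E) * (dQ E + k * (Q E + d)).
  have FdF E : a < E < b -> is_derive E (1 : R) F (dF E).
    move=> Eab.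
    have d1 := is_deriveD (QdQ E Eab) (@is_derive_cst R R R d E 1).
    have d2 := @is_derive1_comp _ expR (fun x => k * x) E _ _ (is_derive_expR _)
       (is_deriveZ k (@is_derive_id _ _ E 1)).
    have := is_deriveM d1 d2; move/eq_is_derive; apply => //.
    rewrite /dF /= addr0 -![_ *: _]/(_ * _) mulr1.
    by rewrite -[(Q + _) E]/(Q E + d); ring.
  have sub E : E1 <= E <= E2 -> a < E < b.
    move=> /andP[h1 h2]; move: E1ab E2ab => /andP[? _] /andP[_ ?].
    by rewrite (lt_le_trans _ h1)// (le_lt_trans h2).
  have [||e] := @MVT _ F dF E1 E2 E12.
  - by move=> E; rewrite in_itv/= => /andP[h1 h2]; apply/FdF/sub; rewrite !ltW.
  - apply: derivable_within_continuous => E; rewrite in_itv/= => h.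
    by case: (FdF E (sub E h)).
  by rewrite in_itv/= => /andP[h1 h2] FE; exists e => //; apply: sub; rewrite !ltW.
exists ((Q E0 + d) * expR (c * (b - a)) - d) => E Eab.
rewrite lerBrDr.
have [h|h|->] := ltgtP E0 E.
- have [e eab H] := mean (- c) E0 E E0ab Eab h.
  have {H} : (Q E + d) * expR (- c * E) <= (Q E0 + d) * expR (- c * E0).
    rewrite -subr_le0 H; apply: mulr_le0_ge0; last by rewrite subr_ge0 ltW.
    apply: mulr_ge0_le0; first exact: expR_ge0.
    by have := dQle e eab; have := ler_norm (dQ e); lra.
  rewrite -(ler_pM2r (expR_gt0 (c * E))) -!mulrA -!expRD mulNr addNr expR0 mulr1.
  move=> /le_trans; apply; apply: ler_wpM2l; first exact: Qd.
  rewrite ler_expR mulNr addrC -mulrBr ler_pM2l//.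
  by move: Eab E0ab => /andP[? ?] /andP[? ?]; lra.
- have [e eab H] := mean c E E0 Eab E0ab h.
  have {H} : (Q E + d) * expR (c * E) <= (Q E0 + d) * expR (c * E0).
    rewrite -subr_ge0 H; apply: mulr_ge0; last by rewrite subr_ge0 ltW.
    apply: mulr_ge0; first exact: expR_ge0.
    by have := dQle e eab; have := ler_norm (- dQ e); rewrite normrN; lra.
  rewrite -(ler_pM2r (expR_gt0 (- c * E))) -!mulrA -!expRD.
  rewrite mulNr subrr expR0 mulr1 => /le_trans; apply.
  apply: ler_wpM2l; first exact: Qd.
  rewrite ler_expR -mulrBr ler_pM2l//.
  by move: Eab E0ab => /andP[? ?] /andP[? ?]; lra.
- rewrite ler_peMr ?Qd// -expR0 ler_expR mulr_ge0 ?subr_ge0 ?(ltW ab)//.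
  exact: ltW.
Qed.

End real_lemmas.

(** The coefficient [(2 * k)^-1] is such that substituting the bounds on [f1], [f2] into those on
    [l1], [l2] reproduces only half of [l1 + l2], which moves to the left. *)
Lemma absorb (R : realFieldType) (k C d m l1 l2 a1 a2 f1 f2 : R) :
  0 < k -> 0 <= C -> 0 <= d ->
  l1 <= d * a1 + k / 2 * (f1 + f2) -> l2 <= d * a2 + k / 2 * (f1 + f2) ->
  f1 <= C * a1 + (2 * k)^-1 * l1 -> f2 <= C * a2 + (2 * k)^-1 * l2 ->
  a1 + a2 <= m -> l1 + l2 <= 2 * (d * m + k * (C * m)).
Proof.
move=> k0 C0 d0 L1 L2 F1 F2 am.
have F := ler_wpM2l (ltW k0) (lerD F1 F2).
have E1 : k * (C * a1 + (2 * k)^-1 * l1 + (C * a2 + (2 * k)^-1 * l2)) =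
    k * (C * (a1 + a2)) + (l1 + l2) / 2 by field; rewrite gt_eqF.
have A1 := ler_wpM2l (ltW k0) (ler_wpM2l C0 am).
have A2 := ler_wpM2l d0 am.
rewrite E1 in F; lra.
Qed.

(** * Identities and estimates for a curve of pairs of real functions *)

Section a_priori.
Context {R : realType} {n : nat}.
Local Notation mu := (lebesgue_rV R n).
Local Notation ip := (ip mu).
Local Notation nrm2 := (nrm2 mu).
Variables (p sigma Em Ep CW L0 : R) (W : 'rV[R]_n -> R).
Variables (f : bool -> R -> 'rV[R]_n -> R)
  (G : bool -> R -> 'I_n -> 'rV[R]_n -> R)
  (K : bool -> R -> 'I_n -> 'I_n -> 'rV[R]_n -> R).
Hypotheses (n0 : (0 < n)%N) (p0 : 0 < p) (pn : p * n%:R < 2 * p + 2).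
Hypotheses (Em0 : 0 < Em) (EmEp : Em < Ep).
Hypotheses (mW : measurable_fun setT W) (CW0 : 0 < CW)
  (WCW : forall x, `|W x| <= CW)
  (W_small : forall x, ~ cube (- L0) L0 x -> `|W x| <= Em / 2).
Local Notation inI E := (Em < E < Ep).
Local Notation Lp c E := (trace_hess (K c E)).
Hypotheses (sf : forall c E, inI E -> sqint mu (f c E))
  (S : forall c E, inI E -> sobolev2 (f c E) (G c E) (K c E)).

Let s E x := f true E x ^+ 2 + f false E x ^+ 2.
Let nl c E x := s E x `^ p * f c E x.
(** The nonlinear term as the equation sees it, equal a.e. to [sigma * nl]. Being linear in [f], it
    is square integrable and inherits the Lipschitz bound of the curve. *)
Let t c E x := Lp c E x - W x * f c E x - E * f c E x.

Hypothesis eqn : forall E c, inI E ->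
  {ae mu, forall x, Lp c E x = W x * f c E x + sigma * nl c E x + E * f c E x}.
Hypothesis lip : forall E, inI E -> exists (L eta : R),
  [/\ 0 <= L, 0 < eta & forall h : R, `|h| < eta -> inI (h + E) -> forall c,
    nrm2 (fun x => f c (h + E) x - f c E x) <= L * `|h| /\
    nrm2 (fun x => Lp c (h + E) x - Lp c E x) <= L * `|h|].

Let N E := \sum_c ip (f c E) (f c E).
Let Q E := \sum_c ip (nl c E) (f c E).

Let s0 E x : 0 <= s E x.
Proof. by rewrite addr_ge0 ?sqr_ge0. Qed.

Let sLp c E : inI E -> sqint mu (Lp c E).
Proof. by move=> EI; exact: sqint_trace_hess (S c EI). Qed.

Let sW c E : inI E -> sqint mu (fun x => W x * f c E x).
Proof. by move=> EI; exact: sqint_bndM (sf c EI). Qed.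

Let st c E : inI E -> sqint mu (t c E).
Proof.
move=> EI; apply: sqintB; last by apply: sqintZ; exact: sf.
by apply: sqintB; [exact: sLp|exact: sW].
Qed.

Let t_nl c E : inI E -> {ae mu, forall x, t c E x = sigma * nl c E x}.
Proof.
move=> EI; apply: filterS (eqn c EI) => x; rewrite /t => ->; ring.
Qed.

Let ip_Lp c E v : inI E -> sqint mu v ->
  ip (Lp c E) v = ip (fun x => W x * f c E x) v + ip (t c E) v + E * ip (f c E) v.
Proof.
move=> EI sv; have h1 := sW c EI; have h2 := st c EI; have h3 := sqintZ E (sf c EI).
rewrite -ipZl//; last exact: sf.
rewrite -ipDl// -ipDl//; last exact: sqintD.
by congr ip; apply/funext => x; rewrite /t; ring.
Qed.

(** The Laplacian and the multiplication by [W] are symmetric and cancel in the difference, leaving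
    only the two values of the spectral parameter. *)
Let cross_identity E F : inI E -> inI F ->
  \sum_c ip (t c E) (f c F) - \sum_c ip (t c F) (f c E) =
  (F - E) * \sum_c ip (f c E) (f c F).
Proof.
move=> EI FI; rewrite -sumrB mulr_sumr; apply: eq_bigr => c _.
have H1 := ip_Lp c EI (sf c FI); have H2 := ip_Lp c FI (sf c EI).
have H3 := trace_hess_sym (S c EI) (S c FI) (sf c EI) (sf c FI).
rewrite [RHS]mulrBl; rewrite (ipC _ (f c E) (Lp c F)) in H3.
have H4 : ip (fun x => W x * f c E x) (f c F) = ip (fun x => W x * f c F x) (f c E).
  by apply: eq_Rintegral => x _; ring.
have H5 : ip (f c F) (f c E) = ip (f c E) (f c F) by rewrite ipC.
rewrite H4 in H1; rewrite H5 in H2; lra.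
Qed.

Let energy_identity E : inI E ->
  \sum_c \sum_i ip (G c E i) (G c E i) +
  \sum_c ip (fun x => W x * f c E x) (f c E) +
  \sum_c ip (t c E) (f c E) + E * N E = 0.
Proof.
move=> EI; rewrite /N mulr_sumr -!big_split /=; apply: big1 => c _.
have H1 := ip_Lp c EI (sf c EI).
have H2 := ip_trace_hess (S c EI) (S c EI).1 (sf c EI).
lra.
Qed.

Let pairing_close E F (h L : R) : inI E -> inI F -> 0 <= L ->
  (forall c, nrm2 (fun x => f c F x - f c E x) <= L * `|h|) ->
  `|\sum_c ip (f c E) (f c F) - N E| <= (\sum_c nrm2 (f c E) * L) * `|h|.
Proof.
move=> EI FI L0' H; rewrite /N -sumrB mulr_suml.
apply: le_trans (ler_norm_sum _ _ _) _; apply: ler_sum => c _.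
have hE := sf c EI; have hF := sf c FI; have hd := sqintB hF hE.
rewrite -ipBr//; apply: (le_trans (ip_CS_norm hE hd)).
by rewrite -mulrA ler_wpM2l ?sqrtr_ge0//; exact: H.
Qed.

Let near_inI E : inI E -> exists2 eta : R, 0 < eta & forall h : R, `|h| < eta ->
    inI (h + E).
Proof.
move=> /andP[h1 h2]; exists (Num.min (E - Em) (Ep - E)).
  by rewrite lt_min !subr_gt0 h1.
move=> h; rewrite lt_min !ltr_norml => /andP[/andP[? ?] /andP[? ?]].
by apply/andP; split; lra.
Qed.

(** Solutions at distinct parameters are then orthogonal by [cross_identity]; letting [F = h + E]
    tend to [E], [pairing_close] makes [N E] arbitrarily small. *)
Let mass_eq0 E : sigma = 0 -> inI E -> N E = 0.
Proof.
move=> sig0 EI; have [L [eta [L0' eta0 Hh]]] := lip EI.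
have [eta' eta'0 HI] := near_inI EI.
apply/eqP; rewrite eq_le; apply/andP; split; last first.
  by apply: sumr_ge0 => c _; exact: ip_ge0.
apply/ler_addgt0Pl => e e0; rewrite addr0.
set C := \sum_c nrm2 (f c E) * L.
have C0 : 0 <= C by apply: sumr_ge0 => c _; rewrite mulr_ge0 ?nrm2_ge0.
pose h := Num.min (Num.min eta eta') (e / (C + 1)) / 2.
have C10 : 0 < C + 1 by rewrite ltr_wpDl.
have hp : 0 < h by rewrite /h divr_gt0// !lt_min eta0 eta'0 divr_gt0.
have hlt : h < Num.min (Num.min eta eta') (e / (C + 1)).
  by rewrite /h ltr_pdivrMr// ltr_pMr ?ltr1n// !lt_min eta0 eta'0 divr_gt0.
move: hlt; rewrite !lt_min => /andP[/andP[h1 h2] h3].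
have FI : inI (h + E) by apply: HI; rewrite gtr0_norm.
have t0 c F v : inI F -> sqint mu v -> ip (t c F) v = 0.
  move=> FI' sv; transitivity (ip (fun=> 0) v); last exact: ip0l.
  apply: eq_ip => //; [exact: st|exact: sqint0| |exact: nearW].
  by apply: filterS (t_nl c FI') => x ->; rewrite sig0 mul0r.
have := cross_identity EI FI.
have T1 : \sum_c ip (t c E) (f c (h + E)) = 0.
  by apply: big1 => c _; apply: t0 => //; exact: sf.
have T2 : \sum_c ip (t c (h + E)) (f c E) = 0.
  by apply: big1 => c _; apply: t0 => //; exact: sf.
rewrite T1 T2.
rewrite subrr addrK => /esym /eqP; rewrite mulf_eq0 gt_eqF//= => /eqP P0.
have := @pairing_close E (h + E) h L EI FI L0' _.
rewrite P0 sub0r normrN => H.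
have {H} : `|N E| <= C * `|h|.
  by apply: H => c; have [] := Hh h _ FI c; rewrite ?gtr0_norm.
move=> /(le_trans (ler_norm _)) /le_trans; apply.
rewrite gtr0_norm//; apply: (@le_trans _ _ ((C + 1) * (e / (C + 1)))); last first.
  by rewrite mulrC mulfVK// gt_eqF.
by apply: ler_pM => //; [exact: ltW|rewrite lerDl|exact: ltW].
Qed.

Let nrm2_Lp c E : inI E ->
  nrm2 (Lp c E) <= (CW + Ep) * nrm2 (f c E) + nrm2 (t c E).
Proof.
move=> EI; have hf := sf c EI; have ht := st c EI; have hE := sqintZ E hf.
have hW := sW c EI.
have -> : Lp c E = fun x => (W x * f c E x + E * f c E x) + t c E x.
  by apply/funext => x; rewrite /t; ring.
apply: (le_trans (nrm2D _ ht)); first exact: sqintD.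
rewrite lerD2r; apply: (le_trans (nrm2D hW hE)); rewrite mulrDl; apply: lerD.
  apply: (@le_trans _ _ (nrm2 (fun x => CW * f c E x))).
    apply: ler_wsqrtr; apply: le_ip => //; first exact: sqintZ.
    by move=> x; rewrite !normrM ler_wpM2r// (le_trans (WCW x))// ler_norm.
  by rewrite nrm2Z// gtr0_norm.
move: EI => /andP[h1 h2]; rewrite nrm2Z// ler_wpM2r ?nrm2_ge0//.
by rewrite gtr0_norm ?ltW// (lt_trans Em0).
Qed.

Let gradS E := \sum_c \sum_i ip (G c E i) (G c E i).
Let hessS E := \sum_c \sum_i \sum_j ip (K c E i j) (K c E i j).

Let hessE E : inI E -> hessS E = \sum_c nrm2 (Lp c E) ^+ 2.
Proof.
move=> EI; apply: eq_bigr => c _.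
by rewrite (hess_trace (S c EI)) nrm2_sqr.
Qed.

Let gradS_ge0 E : 0 <= gradS E.
Proof. by apply: sumr_ge0 => c _; apply: sumr_ge0 => i _; exact: ip_ge0. Qed.

Let le_mass c E : ip (f c E) (f c E) <= N E.
Proof. by rewrite /N big_bool /=; case: c; rewrite ?lerDl ?lerDr ip_ge0. Qed.

Let bounds E M := [/\ N E <= M, gradS E <= M & hessS E <= M].

Let bounds_eq0 E : sigma = 0 -> inI E -> bounds E 0.
Proof.
move=> sig0 EI; have NE := mass_eq0 sig0 EI.
have f0 c : ip (f c E) (f c E) = 0.
  by apply/eqP; rewrite eq_le ip_ge0 -NE le_mass.
have t0 c v : sqint mu v -> ip (t c E) v = 0.
  move=> sv; transitivity (ip (fun=> 0) v); last exact: ip0l.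
  apply: eq_ip => //; [exact: st|exact: sqint0| |exact: nearW].
  by apply: filterS (t_nl c EI) => x ->; rewrite sig0 mul0r.
split; first by rewrite NE.
  have W0 c : ip (fun x => W x * f c E x) (f c E) = 0.
    apply/eqP; rewrite -normr_le0.
    apply: (le_trans (ip_CS_norm (sW c EI) (sf c EI))).
    by rewrite f0 sqrtr0 mulr0.
  have := energy_identity EI; rewrite NE mulr0 addr0.
  rewrite [X in _ + X + _ = _]big1//= [X in _ + X = _]big1 ?addr0; last first.
    by move=> c _; apply: t0; exact: sf.
  by rewrite -/(gradS E) => ->.
rewrite hessE// big1// => c _.
apply/eqP; rewrite expf_eq0/= eq_le nrm2_ge0 andbT.
apply: (le_trans (nrm2_Lp c EI)).
have -> : nrm2 (f c E) = 0 by rewrite -(sqrtr0 R); congr Num.sqrt; exact: f0.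
have -> : nrm2 (t c E) = 0.
  by rewrite -(sqrtr0 R); congr Num.sqrt; apply: t0; exact: st.
by rewrite mulr0 addr0.
Qed.

(** * The case of nonzero [sigma] *)

Section nonlinear.
Hypothesis sig0 : sigma != 0.

Let ms E : inI E -> measurable_fun setT (s E).
Proof.
move=> EI; apply: measurable_funD; apply: measurable_funX.
  by case: (sf true EI).
by case: (sf false EI).
Qed.

Let mnl c E : inI E -> measurable_fun setT (nl c E).
Proof.
move=> EI; apply: measurable_funM; last by case: (sf c EI).
exact: (measurableT_comp (measurable_powR p) (ms EI)).
Qed.

(** Square integrability comes from the equation: [nl] is a.e. [sigma^-1] times [t]. *)
Let snl c E : inI E -> sqint mu (nl c E).
Proof.
move=> EI; have [mt it] := sqintZ sigma^-1 (st c EI); have mn := mnl c EI.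
split=> //; apply/integrableP; split.
  by apply/measurable_EFinP; exact: measurable_funX.
move/integrableP : it => [_]; congr (_ < _)%E; apply: ae_eq_integral => //.
- by apply: measurableT_comp => //; apply/measurable_EFinP; exact: measurable_funX.
- by apply: measurableT_comp => //; apply/measurable_EFinP; exact: measurable_funX.
apply: filterS (t_nl c EI) => x tE _.
by rewrite /= tE mulKf.
Qed.

Let ip_t c E v : inI E -> sqint mu v -> ip (t c E) v = sigma * ip (nl c E) v.
Proof.
move=> EI sv; rewrite -ipZl//; last exact: snl.
apply: eq_ip => //; [exact: st|exact/sqintZ/snl|exact: t_nl|exact: nearW].
Qed.

Let X E F := \sum_c ip (nl c E) (f c F).

Let nl_pow E x : nl true E x * f true E x + nl false E x * f false E x =
    s E x `^ (p + 1).
Proof. by rewrite -(powR_mul_succ p0 (s0 E x)) /nl /s; ring. Qed.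

Let integrable_pow E : inI E ->
    mu.-integrable setT (EFin \o (fun x => s E x `^ (p + 1))).
Proof.
move=> EI.
have := integrable_addr (sqint_mul (snl true EI) (sf true EI))
    (sqint_mul (snl false EI) (sf false EI)).
by apply: eq_integrable => // x _; rewrite /= nl_pow.
Qed.

Let QE E : inI E -> Q E = \int[mu]_x (s E x `^ (p + 1)).
Proof.
move=> EI; rewrite /Q big_bool /= /ip -RintegralD//; last 2 first.
- by apply: sqint_mul; [exact: snl|exact: sf].
- by apply: sqint_mul; [exact: snl|exact: sf].
by apply: eq_Rintegral => x _; rewrite -nl_pow.
Qed.

Let Q_ge0 E : inI E -> 0 <= Q E.
Proof. by move=> EI; rewrite QE//; apply: Rintegral_ge0 => x _;
    exact: powR_ge0. Qed.

(** Pointwise, twice the product of the two solutions is at most [s E + s F]; multiplied by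
    [s E ^ p], the first summand is already a power [p + 1] and [young_powR] treats the second. *)
Let convexity E F : inI E -> inI F ->
  (2 * p + 2) * X E F <= Q F + (2 * p + 1) * Q E.
Proof.
move=> EI FI; rewrite !QE// /X big_bool /=.
have i1 := sqint_mul (snl true EI) (sf true FI).
have i2 := sqint_mul (snl false EI) (sf false FI).
have j1 := integrable_pow EI; have j2 := integrable_pow FI.
rewrite /ip -RintegralD// -!RintegralZl//; last exact: integrable_addr.
rewrite -RintegralD//; last exact: integrable_scaler.
apply: le_Rintegral => //.
- by apply: integrable_scaler; exact: integrable_addr.
- by apply: integrable_addr => //; exact: integrable_scaler.
move=> x _.
have Y := young_powR p0 (s0 F x) (s0 E x).
have PE := powR_mul_succ p0 (s0 E x).
have P0 := powR_ge0 (s E x) p.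
have AM : 2 * (f true E x * f true F x + f false E x * f false F x) <=
    s E x + s F x.
  have := sqr_ge0 (f true E x - f true F x);
      have := sqr_ge0 (f false E x - f false F x).
  rewrite /s; nra.
have {AM} := ler_wpM2l P0 AM; rewrite [X in _ <= X]mulrDr PE => AM.
rewrite /nl; move: Y AM.
set a := s F x `^ (p + 1); set b := s E x `^ (p + 1).
set u := s E x `^ p * s F x; set k := s E x `^ p.
set q1 := f true E x; set q2 := f true F x; set q3 := f false E x;
    set q4 := f false F x.
move=> Y AM.
have := ler_wpM2l (ltW (_ : 0 < p + 1)) AM; rewrite addr_gt0// => /(_ isT) AM'.
have -> : (2 * p + 2) * (k * q1 * q2 + k * q3 * q4) =
  (p + 1) * (k * (2 * (q1 * q2 + q3 * q4))) by ring.
apply: (le_trans AM'); rewrite mulrDr; lra.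
Qed.

Let cross_X E F : inI E -> inI F -> sigma * (X E F - X F E) =
    (F - E) * \sum_c ip (f c E) (f c F).
Proof.
move=> EI FI; rewrite -cross_identity// mulrBr !mulr_sumr; congr (_ - _).
  by apply: eq_bigr => c _; rewrite ip_t//; exact: sf.
by apply: eq_bigr => c _; rewrite ip_t//; exact: sf.
Qed.

(* The defects of the two [convexity] inequalities add up to [(2p + 2) gap],
   and [gap] is quadratic in [F - E] by [gap_close]; hence [Q] is differentiable
   although nothing is known about the derivative of the nonlinear term. *)
Let gap E F := Q E + Q F - X E F - X F E.

Let gapE E F : inI E -> inI F ->
  sigma * gap E F = \sum_c ip (fun x => t c F x - t c E x)
      (fun x => f c F x - f c E x).
Proof.
move=> EI FI; rewrite /gap /Q /X -big_split -!sumrB /= mulr_sumr;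
    apply: eq_bigr => c _.
have h1 := st c EI; have h2 := st c FI; have h3 := sf c EI; have h4 := sf c FI.
have h5 := sqintB h4 h3.
rewrite ipBl// !ipBr//; rewrite !ip_t//; ring.
Qed.

Let gap_ge0 E F : inI E -> inI F -> 0 <= gap E F.
Proof.
move=> EI FI; have := convexity EI FI; have := convexity FI EI;
    rewrite /gap => h1 h2.
have p10 : 0 < 2 * p + 2 by rewrite addr_gt0// mulr_gt0.
rewrite -(pmulr_rge0 _ p10).
have -> : (2 * p + 2) * (Q E + Q F - X E F - X F E) =
    (Q F + (2 * p + 1) * Q E - (2 * p + 2) * X E F) +
    (Q E + (2 * p + 1) * Q F - (2 * p + 2) * X F E) by ring.
by rewrite addr_ge0// subr_ge0.
Qed.

Let gap_close E F (h L : R) : inI E -> inI F -> F = h + E -> 0 <= L -> `|h| <= 1 ->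
  (forall c, nrm2 (fun x => f c F x - f c E x) <= L * `|h|) ->
  (forall c, nrm2 (fun x => Lp c F x - Lp c E x) <= L * `|h|) ->
  `|sigma| * gap E F <= (\sum_c (L + CW * L + `|E| * L +
      nrm2 (f c E) + L) * L) * h ^+ 2.
Proof.
move=> EI FI FE L0' h1 Hf HL.
rewrite -[gap E F]ger0_norm ?gap_ge0// -normrM gapE//.
apply: (le_trans (ler_norm_sum _ _ _)); rewrite mulr_suml; apply: ler_sum => c _.
have hE := sf c EI; have hF := sf c FI; have hd := sqintB hF hE.
have hLE := sLp c EI; have hLF := sLp c FI; have hLd := sqintB hLF hLE.
have htd := sqintB (st c FI) (st c EI).
apply: (le_trans (ip_CS_norm htd hd)).
(* The summands of the constant come, in order, from the increments of the Laplacian, of [W f] and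
   of [E f]; the last two bound the norm of [f c F], which appears because the parameter itself
   moves by [h]. *)
have nt : nrm2 (fun x => t c F x - t c E x) <=
    (L + CW * L + `|E| * L + nrm2 (f c E) + L) * `|h|.
  have hWd := sqint_bndM mW WCW hd.
  have hEd := sqintZ E hd; have hhF := sqintZ h hF.
  have -> : (fun x => t c F x - t c E x) =
    (fun x => (Lp c F x - Lp c E x) - W x * (f c F x - f c E x) -
      E * (f c F x - f c E x) - h * f c F x).
    by apply/funext => x; rewrite /t FE; ring.
  apply: (le_trans (nrm2B _ hhF)); first by apply: sqintB => //; exact: sqintB.
  have fF : nrm2 (f c F) <= nrm2 (f c E) + L.
    have -> : f c F = fun x => f c E x + (f c F x - f c E x).
      by apply/funext => x; rewrite addrC subrK.
    apply: (le_trans (nrm2D hE hd)); rewrite lerD2l; apply: (le_trans (Hf c)).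
    by rewrite ler_piMr.
  rewrite nrm2Z//; have H4 : `|h| * nrm2 (f c F) <= (nrm2 (f c E) + L) * `|h|.
    by rewrite mulrC ler_wpM2r.
  rewrite -[X in X * `|h|]addrA [X in _ <= X]mulrDl; apply: lerD => //.
  apply: (le_trans (nrm2B _ hEd)); first exact: sqintB.
  rewrite mulrDl; apply: lerD; last first.
    by rewrite nrm2Z// -mulrA ler_wpM2l.
  apply: (le_trans (nrm2B hLd hWd)); rewrite mulrDl; apply: lerD => //.
  apply: (@le_trans _ _ (nrm2 (fun x => CW * (f c F x - f c E x)))).
    apply: ler_wsqrtr; apply: le_ip => //; first exact: sqintZ.
    by move=> x; rewrite !normrM ler_wpM2r// (le_trans (WCW x))// ler_norm.
  by rewrite nrm2Z// gtr0_norm// -mulrA ler_wpM2l// ltW.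
rewrite -[h ^+ 2]real_normK ?num_real// expr2.
move: nt; set A := _ + L => nt.
rewrite (_ : A * L * (`|h| * `|h|) = (A * `|h|) * (L * `|h|)); last by ring.
by apply: ler_pM; rewrite ?sqrtr_ge0//; exact: Hf.
Qed.

Let Q_derive E : inI E ->
  is_derive E (1 : R) Q (- ((p + 1) / (p * sigma)) * N E).
Proof.
move=> EI; have [L [eta [L0' eta0 Hh]]] := lip EI.
have [eta' eta'0 HI] := near_inI EI.
set B := \sum_c (L + CW * L + `|E| * L + nrm2 (f c E) + L) * L.
set D := \sum_c nrm2 (f c E) * L.
have D0 : 0 <= D by apply: sumr_ge0 => c _; rewrite mulr_ge0 ?nrm2_ge0.
have B0 : 0 <= B.
  apply: sumr_ge0 => c _; apply: mulr_ge0 => //.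
  apply: addr_ge0 => //; apply: addr_ge0; last exact: nrm2_ge0.
  by apply: addr_ge0; [apply: addr_ge0 => //; apply: mulr_ge0 => //;
      exact: ltW|exact: mulr_ge0].
have k0 : 0 < (p + 1) / (p * `|sigma|) by rewrite divr_gt0 ?addr_gt0//
    mulr_gt0// normr_gt0.
apply: (@is_derive_quadratic _ Q E _ ((p + 1) / (p * `|sigma|) * (D + B))
    (Num.min 1 (Num.min eta eta'))).
- by rewrite mulr_ge0 ?addr_ge0// ltW.
- by rewrite !lt_min ltr01 eta0.
move=> h; rewrite !lt_min => /andP[h1 /andP[h2 h3]].
have FI := HI h h3; have HF := Hh h h2 FI.
have P1 := pairing_close EI FI L0' (fun c => (HF c).1).
have P2 := gap_close EI FI erefl L0' (ltW h1) (fun c => (HF c).1)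
    (fun c => (HF c).2).
rewrite -/B in P2; rewrite -/D in P1.
have P3 := cross_X EI FI; rewrite addrK in P3.
have C1 := convexity EI FI; have C2 := convexity FI EI.
have P4 := gap_ge0 EI FI.
set PP := \sum_c _ in P1 P3.
set F := h + E in FI HF P2 P3 C1 C2 P4 *.
have sg0 : 0 < `|sigma| by rewrite normr_gt0.
have p10 : 0 < p + 1 by rewrite addr_gt0.
(* The two convexity defects enter with opposite signs. By [cross_X] the antisymmetric part is
   [h / sigma] times a pairing close to [N E]; the difference of the defects is at most their sum,
   [(2p + 2) * gap], hence of order [h ^ 2]. *)
have eq1 : 2 * p * (Q F - Q E) = - (2 * p + 2) * (X E F - X F E)
   - ((Q F + (2 * p + 1) * Q E - (2 * p + 2) * X E F)
     - (Q E + (2 * p + 1) * Q F - (2 * p + 2) * X F E)) by ring.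
set g1 := Q F + _ - _ in eq1; set g2 := Q E + _ - _ in eq1.
have g10 : 0 <= g1 by rewrite subr_ge0.
have g20 : 0 <= g2 by rewrite subr_ge0.
have g12 : g1 + g2 = (2 * p + 2) * gap E F by rewrite /g1 /g2 /gap; ring.
have gg : `|g1 - g2| <= (2 * p + 2) * gap E F.
  by rewrite -g12 ler_norml; lra.
have XX : X E F - X F E = h / sigma * PP.
  by apply: (mulfI sig0); rewrite P3; field.
have key : 2 * p * (Q F - Q E - h * (- ((p + 1) / (p * sigma)) * N E)) =
    - (2 * p + 2) * (h / sigma) * (PP - N E) - (g1 - g2).
  rewrite mulrBr eq1 XX; field; rewrite sig0 gt_eqF//.
have p20 : 0 < 2 * p by rewrite mulr_gt0.
rewrite -(ler_pM2l p20) -[X in X * `|_|]gtr0_norm// -normrM key.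
apply: (le_trans (ler_normB _ _)).
have p220 : 0 < 2 * p + 2 by rewrite addr_gt0.
have T1 : `|- (2 * p + 2) * (h / sigma) * (PP - N E)| <=
    (2 * p + 2) / `|sigma| * D * h ^+ 2.
  rewrite !normrM normrN normfV (gtr0_norm p220) -[h ^+ 2]real_normK ?num_real//
      expr2.
  rewrite (_ : (2 * p + 2) / `|sigma| * D * (`|h| * `|h|) =
     (2 * p + 2) * (`|h| / `|sigma|) * (D * `|h|)); last by ring.
  by apply: ler_wpM2l => //; rewrite mulr_ge0 ?divr_ge0// ltW.
have T2 : (2 * p + 2) * gap E F <= (2 * p + 2) / `|sigma| * B * h ^+ 2.
  rewrite -!mulrA ler_pM2l// ler_pdivlMl//.
apply: (le_trans (lerD T1 (le_trans gg T2))).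
rewrite le_eqVlt; apply/orP; left; apply/eqP; field.
by rewrite !gt_eqF.
Qed.

(** Where [s^p < CW] one has [s <= CW^(1/p)], so [|W| s] is at most [CW * CW^(1/p)]; this is the
    integral of that bound over the cube outside which [W] is small. *)
Let C0 := CW * CW `^ p^-1 *
  ip (\1_(cube (- L0) L0) : 'rV[R]_n -> R) (\1_(cube (- L0) L0)).

(** Three cases bound [|W| s]: off the cube by half of the spectral term, on the cube by [s^(p + 1)]
    where [s^p >= CW], and by a constant elsewhere. Inserted in [energy_identity], half of
    [Em * N E] is left over. *)
Let mass_dom E : inI E ->
  Em / 2 * N E + gradS E <= (`|sigma| + 1) * Q E + C0.
Proof.
move=> EI; pose ic : 'rV[R]_n -> R := \1_(cube (- L0) L0).
have sic : sqint mu ic.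
  by apply: sqint_indic; [exact: measurable_cube|exact: mu_cube_lty].
pose CC := CW * CW `^ p^-1.
have CC0 : 0 <= CC by rewrite mulr_ge0 ?powR_ge0// ltW.
have pt x : - (W x * s E x) <= Em / 2 * s E x + s E x `^ (p + 1) +
    CC * (ic x * ic x).
  have sx := s0 E x.
  apply: (@le_trans _ _ (`|W x| * s E x)).
    by rewrite -mulNr ler_wpM2r// ler_normr lexx orbT.
  have P0 := powR_ge0 (s E x) (p + 1).
  have [xc|xc] := pselect (cube (- L0) L0 x); last first.
    have := W_small xc => h; have := ler_wpM2r sx h.
    have : 0 <= CC * (ic x * ic x) by rewrite mulr_ge0// -expr2 sqr_ge0.
    lra.
  rewrite /ic indicE mem_set//= mulr1 mulr1.
  have E2 : 0 <= Em / 2 * s E x by rewrite mulr_ge0// divr_ge0// ltW.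
  have Wx := ler_wpM2r sx (WCW x).
  have [h|h] := leP CW (s E x `^ p).
    have := ler_wpM2r sx h; rewrite powR_mul_succ//; lra.
  have h2 : s E x <= CW `^ p^-1.
    have -> : s E x = (s E x `^ p) `^ p^-1.
      by rewrite -powRrM mulfV ?gt_eqF// powRr1.
    by apply: ge0_ler_powR; rewrite ?nnegrE ?powR_ge0 ?invr_ge0 ?ltW.
  have := ler_wpM2l (ltW CW0) h2; rewrite -/CC; lra.
have i1 := sqint_mul (sf true EI) (sf true EI).
have i2 := sqint_mul (sf false EI) (sf false EI).
have iS : mu.-integrable setT (EFin \o s E).
  by have := integrable_addr i1 i2; exact: eq_integrable.
have j1 := sqint_mul (sW true EI) (sf true EI).
have j2 := sqint_mul (sW false EI) (sf false EI).
have iWs : mu.-integrable setT (EFin \o (fun x => -1 * (W x * s E x))).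
  apply: integrable_scaler.
  have := integrable_addr j1 j2; apply: eq_integrable => // x _ /=.
  by congr EFin; rewrite /s; ring.
have NS : N E = \int[mu]_x s E x.
  by rewrite /N big_bool /= /ip -RintegralD.
have WS : \sum_c ip (fun x => W x * f c E x) (f c E) =
    - \int[mu]_x (-1 * (W x * s E x)).
  rewrite RintegralZl; last 2 first.
  - by [].
  - have := integrable_addr j1 j2; apply: eq_integrable => // x _ /=.
    by congr EFin; rewrite /s; ring.
  rewrite mulN1r opprK big_bool /= /ip -RintegralD//.
  by apply: eq_Rintegral => x _; rewrite /s; ring.
have iP := integrable_pow EI.
have iic := sqint_mul sic sic.
have I1 := integrable_scaler (Em / 2) iS; have I2 := integrable_addr I1 iP.
have I3 := integrable_scaler CC iic.
have : \int[mu]_x (-1 * (W x * s E x)) <= Em / 2 * N E + Q E + C0.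
  apply: (@le_trans _ _ (\int[mu]_x (Em / 2 * s E x + s E x `^ (p + 1) +
      CC * (ic x * ic x)))).
    apply: le_Rintegral => //; first exact: integrable_addr.
    by move=> x _; rewrite mulN1r.
  by rewrite RintegralD// RintegralD// RintegralZl// RintegralZl// -NS -QE.
have en := energy_identity EI; rewrite WS -/(gradS E) in en.
have tQ : \sum_c ip (t c E) (f c E) = sigma * Q E.
  by rewrite mulr_sumr; apply: eq_bigr => c _; rewrite ip_t//; exact: sf.
rewrite tQ in en.
have sQ : - (sigma * Q E) <= `|sigma| * Q E.
  by rewrite -mulNr ler_wpM2r ?Q_ge0// ler_normr lexx orbT.
have NE0 : 0 <= N E by apply: sumr_ge0 => c _; exact: ip_ge0.
have EN : Em * N E <= E * N E by rewrite ler_wpM2r//; move: EI => /andP[/ltW].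
lra.
Qed.

Let Q_bounded : exists M, forall E, inI E -> Q E <= M.
Proof.
have sg0 : 0 < `|sigma| by rewrite normr_gt0.
have sg1 : 0 < `|sigma| + 1 by rewrite addr_gt0.
pose kap := (p + 1) / (p * `|sigma|).
have kap0 : 0 < kap by rewrite divr_gt0 ?addr_gt0// mulr_gt0.
(* The constants come from solving [mass_dom] for [N E] and factoring the result as
   [c * (Q E + d)]. *)
apply: (@gronwall_bound _ Q (fun E => - ((p + 1) / (p * sigma)) * N E) Em Ep
  (kap * (2 / Em) * (`|sigma| + 1)) (C0 / (`|sigma| + 1))) => //.
- by rewrite mulr_gt0// mulr_gt0// divr_gt0.
move=> E EI.
have NE0 : 0 <= N E by apply: sumr_ge0 => c _; exact: ip_ge0.
have D := mass_dom EI; have G0 := gradS_ge0 E.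
have NE : N E <= 2 / Em * ((`|sigma| + 1) * Q E + C0).
  rewrite -ler_pdivrMl ?divr_gt0// invf_div; apply: le_trans D.
  by rewrite lerDl.
rewrite normrM (ger0_norm NE0) normrN normrM normfV normrM (gtr0_norm p0).
rewrite (@gtr0_norm _ (p + 1)) ?addr_gt0// -/kap.
rewrite (_ : _ * (Q E + _) = kap * (2 / Em * ((`|sigma| + 1) * Q E + C0))).
  by rewrite ler_pM2l.
by field; rewrite !gt_eqF.
Qed.

(** The nonlinearity couples the two components, whereas [power_bound] concerns a single real
    function; comparing with the larger component decouples them. *)
Let nl_le c E x : `|nl c E x| <= 2 `^ p *
  (`|f true E x| `^ (2 * p + 1) + `|f false E x| `^ (2 * p + 1)).
Proof.
pose M := Num.max `|f true E x| `|f false E x|.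
have M0 : 0 <= M by rewrite le_max normr_ge0.
have p1 : 2 * p + 1 == 0 = false by apply/negbTE;
    rewrite gt_eqF// addr_gt0// mulr_gt0.
have fM c' : `|f c' E x| <= M by rewrite /M le_max; case: c'; rewrite lexx ?orbT.
have sM : s E x <= 2 * M ^+ 2.
  have sq c' : f c' E x ^+ 2 <= M ^+ 2.
    by rewrite -real_normK ?num_real// lerXn2r// nnegrE.
  by have := sq true; have := sq false; rewrite /s; lra.
rewrite normrM ger0_norm ?powR_ge0//.
apply: (@le_trans _ _ (2 `^ p * M `^ (2 * p + 1))).
  have -> : M `^ (2 * p + 1) = (M ^+ 2) `^ p * M.
    by rewrite powRD ?p1// powRr1// powRrM powR_mulrn.
  rewrite mulrA -powRM// ?sqr_ge0//; apply: ler_pM => //; first exact: powR_ge0.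
  by apply: ge0_ler_powR; rewrite ?nnegrE ?mulr_ge0 ?sqr_ge0 ?(ltW p0).
rewrite ler_wpM2l ?powR_ge0// /M.
by case: (leP `|f true E x| `|f false E x|) => _; rewrite ?lerDl ?lerDr powR_ge0.
Qed.

Lemma bounds_neq0 : exists M, forall E, inI E -> bounds E M.
Proof.
have [Qm HQ] := Q_bounded; pose Q1 := `|Qm| + 1.
have Q10 : 0 < Q1 by rewrite ltr_wpDl.
have QQ1 E : inI E -> Q E <= Q1.
  by move=> /HQ /le_trans; apply; rewrite (le_trans (ler_norm _))// lerDl.
pose B := (`|sigma| + 1) * Q1 + C0.
pose Nm := 2 / Em * B.
have sg0 : 0 < `|sigma| by rewrite normr_gt0.
have dom E : inI E -> Em / 2 * N E + gradS E <= B.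
  move=> EI; apply: (le_trans (mass_dom EI)); rewrite lerD2r ler_wpM2l ?QQ1//.
have NE0 E : 0 <= N E by apply: sumr_ge0 => c _; exact: ip_ge0.
have NNm E : inI E -> N E <= Nm.
  move=> EI; rewrite /Nm -ler_pdivrMl ?divr_gt0// invf_div.
  by apply: le_trans (dom E EI); rewrite lerDl gradS_ge0.
have gB E : inI E -> gradS E <= B.
  move=> EI; apply: le_trans (dom E EI); rewrite lerDr mulr_ge0// divr_ge0// ltW//.
(* From (a + r (b + d))^2 <= 2 a^2 + 4 r^2 (b^2 + d^2) with [r = |sigma| 2^p], so that
   [k / 2 = 4 r^2]. The parameter [(2 * k)^-1] given to [power_bound] is the one [absorb] needs. *)
pose k := 8 * (`|sigma| * 2 `^ p) ^+ 2.
have k0 : 0 < k.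
  by apply: mulr_gt0 => //; rewrite exprn_gt0// mulr_gt0// powR_gt0.
have k20 : 0 < (2 * k)^-1 by rewrite invr_gt0 mulr_gt0.
have [C C_0 HC] := @power_bound R n p Q1 (2 * k)^-1 n0 p0 pn Q10 k20.
pose A := 2 * (CW + Ep) ^+ 2 * Nm + k * (C * Nm).
exists (Num.max (Num.max Nm B) (2 * A)) => E EI.
split.
- by apply: (le_trans (NNm E EI)); rewrite !le_max lexx.
- by apply: (le_trans (gB E EI)); rewrite !le_max lexx !orbT.
rewrite le_max; apply/orP; right.
pose Fc c x := `|f c E x| `^ (2 * p + 1).
have mFc c : measurable_fun setT (Fc c).
  apply: (measurableT_comp (measurable_powR (2 * p + 1))).
  by apply: measurableT_comp => //; case: (sf c EI).
have p1 : 2 * p + 1 == 0 = false by apply/negbTE;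
    rewrite gt_eqF// addr_gt0// mulr_gt0.
have p2 : 2 * p + 2 == 0 = false by apply/negbTE;
    rewrite gt_eqF// addr_gt0// mulr_gt0.
have fs c x : `|f c E x| ^+ 2 <= s E x.
  by rewrite real_normK ?num_real// /s; case: c; rewrite ?lerDl ?lerDr sqr_ge0.
(* Inherited from the nonlinear term, because [|f c|^(2p)] is at most [s^p]. *)
have sFc c : sqint mu (Fc c).
  apply: (sqint_dom (mFc c) (snl c EI)) => x.
  rewrite ger0_norm ?powR_ge0// /Fc powRD ?p1// powRr1// normrM.
  rewrite ler_wpM2r// ger0_norm ?powR_ge0// powRrM powR_mulrn//.
  by apply: ge0_ler_powR; rewrite ?nnegrE ?sqr_ge0 ?(ltW p0).
have iq c : mu.-integrable setT (EFin \o (fun x => `|f c E x| `^ (2 * p + 2))) /\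
    \int[mu]_x (`|f c E x| `^ (2 * p + 2)) <= Q1.
  have le x : `|f c E x| `^ (2 * p + 2) <= s E x `^ (p + 1).
    rewrite (_ : 2 * p + 2 = 2 * (p + 1)); last by ring.
    rewrite powRrM powR_mulrn//.
    by apply: ge0_ler_powR; rewrite ?nnegrE ?sqr_ge0// addr_ge0// ltW.
  have i1 : mu.-integrable setT (EFin \o (fun x => `|f c E x| `^ (2 * p + 2))).
    apply: (dom_integrable _ (integrable_pow EI)).
      apply: (measurableT_comp (measurable_powR (2 * p + 2))).
      by apply: measurableT_comp => //; case: (sf c EI).
    by move=> x; rewrite ger0_norm ?powR_ge0.
  split=> //; apply: le_trans (QQ1 E EI); rewrite QE//.
  by apply: le_Rintegral => //; exact: integrable_pow.
have FS c : nrm2 (Fc c) ^+ 2 <= C * ip (f c E) (f c E) +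
    (2 * k)^-1 * nrm2 (Lp c E) ^+ 2.
  rewrite !nrm2_sqr -(hess_trace (S c EI)).
  by apply: HC => //; [exact: sf|exact: S|exact: (iq c).1|exact: (iq c).2|
      exact: sFc].
have tF c : nrm2 (t c E) <= `|sigma| * 2 `^ p * (nrm2 (Fc true) + nrm2 (Fc false)).
  have -> : nrm2 (t c E) = nrm2 (fun x => sigma * nl c E x).
    congr Num.sqrt; apply: eq_ip; try exact: st; try (exact/sqintZ/snl);
        exact: t_nl.
  rewrite nrm2Z; last exact: snl.
  rewrite -mulrA ler_wpM2l//.
  have sFF := sqintD (sFc true) (sFc false).
  apply: (@le_trans _ _ (nrm2 (fun x => 2 `^ p * (Fc true x + Fc false x)))).
    apply: ler_wsqrtr; apply: le_ip; [exact: snl|exact: sqintZ|].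
    move=> x; apply: (le_trans (nl_le c E x)); exact: ler_norm.
  rewrite nrm2Z// ger0_norm ?powR_ge0// ler_wpM2l ?powR_ge0//.
  exact: nrm2D.
have LS c : nrm2 (Lp c E) ^+ 2 <= 2 * (CW + Ep) ^+ 2 * ip (f c E) (f c E) +
    k / 2 * (nrm2 (Fc true) ^+ 2 + nrm2 (Fc false) ^+ 2).
  have h := le_trans (nrm2_Lp c EI) (lerD (lexx _) (tF c)).
  have L0' := nrm2_ge0 mu (Lp c E).
  rewrite -nrm2_sqr /k -[2 * _ * _]mulrA -exprMn.
  move: (nrm2 (Lp c E)) (nrm2 (f c E)) (nrm2 (Fc true)) (nrm2 (Fc false))
    (`|sigma| * 2 `^ p) (CW + Ep) L0' h => l u b d r v l0.
  move: (v * u) => a h; apply: (@le_trans _ _ ((a + r * (b + d)) ^+ 2)).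
    by rewrite lerXn2r ?nnegrE//; exact: le_trans l0 h.
  rewrite -subr_ge0 (_ : _ - _ = (a - r * (b + d)) ^+ 2 +
      2 * (r * (b - d)) ^+ 2); last by field.
  apply: addr_ge0; first exact: sqr_ge0.
  by apply: mulr_ge0 => //; exact: sqr_ge0.
rewrite hessE// big_bool /=.
apply: (absorb k0 C_0 _ (LS true) (LS false) (FS true) (FS false)).
  by apply: mulr_ge0 => //; exact: sqr_ge0.
by apply: le_trans (NNm E EI); rewrite /N big_bool.
Qed.

End nonlinear.

Lemma a_priori_bound : exists M, forall E, inI E ->
  [/\ \sum_c ip (f c E) (f c E) <= M,
      \sum_c \sum_i ip (G c E i) (G c E i) <= M &
      \sum_c \sum_i \sum_j ip (K c E i j) (K c E i j) <= M].
Proof.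
have [sig0|sig0] := eqVneq sigma 0; last exact: bounds_neq0.
by exists 0 => E EI; exact: bounds_eq0.
Qed.

End a_priori.

Lemma Lfun_infty_bounded d (T : measurableType d) (R : realType)
    (mu : {measure set T -> \bar R}) (W : T -> R) : W \in Lfun mu +oo%E ->
  exists C : R, {ae mu, forall x, `|W x| <= C}.
Proof.
move=> /andP[_]; rewrite inE /= /finite_norm unlock /=; case: ifPn => [_ Wy|].
  by apply: (@ess_supr_bounded _ _ _ mu (fun x => `|W x|)).
(* On a space of measure zero the norm is a default value, and any bound holds almost everywhere. *)
rewrite lt0e measure_ge0 andbT negbK => /eqP mu0 _.
by exists 0, setT; split.
Qed.

(** * The potential made bounded everywhere, and the passage to Sobolev norms *)

Section potential.
Context {R : realType} {n : nat}.
Local Notation mu := (lebesgue_rV R n).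

Lemma cubeC_norm (r : R) (x : 'rV[R]_n) : ~ cube (- r) r x -> r <= euclidean_norm x.
Proof.
move=> xr; have [i +] : exists i, ~ (x ord0 i \in `[- r, r]) by apply/existsNP.
rewrite in_itv /= -ler_norml => /negP; rewrite -ltNge => rx.
apply: (le_trans (ltW rx)); rewrite -sqrtr_sqr; apply: ler_wsqrtr.
by rewrite (bigD1 i)//= lerDl; apply: sumr_ge0 => j _; exact: sqr_ge0.
Qed.

(** The decay is known for [V], measurability for its representative [U], and the bound on [U] only
    a.e. Setting [U] to 0 where it exceeds the barrier [b] gives all three for one function and
    changes it only on a null set. *)
Lemma clipped_potential (V : 'rV[R]_n -> R) (e : R) :
  in_Linfty V -> vanishes_at_infinity V -> 0 < e ->
  exists (W : 'rV[R]_n -> R) (C L : R), [/\ measurable_fun setT W, 0 < C,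
      forall x, `|W x| <= C,
    forall x, ~ cube (- L) L x -> `|W x| <= e & {ae mu, forall x, V x = W x}].
Proof.
move=> [U UL VU] V0 e0; have [C UC] := Lfun_infty_bounded UL.
have [r [_ Hr]] := V0 e e0.
(* A neighbourhood of infinity is an open ray, so the decay is available strictly beyond [r]. *)
pose L := r + 1; pose b := fun x : 'rV[R]_n => e + `|C| * \1_(cube (- L) L) x : R.
have mU : measurable_fun setT U by move: UL => /andP[]; rewrite inE.
have mb : measurable_fun setT b.
  apply: measurable_funD => //; apply: measurable_funM => //.
  by apply: measurable_indic; exact: measurable_cube.
have b0 x : 0 <= b x by rewrite addr_ge0 ?(ltW e0)// mulr_ge0.
exists (fun x => if `|U x| <= b x then U x else 0), (e + `|C|), L; split.
- apply: measurable_fun_ifT => //; apply: measurable_fun_ler => //.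
  exact: measurableT_comp.
- by rewrite ltr_pwDl.
- move=> x; have bC : b x <= e + `|C|.
    by rewrite /b lerD2l indicE ler_piMr// lern1 leq_b1.
  case: ifPn => [h|_]; first exact: le_trans h bC.
  by rewrite normr0; exact: le_trans (b0 x) bC.
- move=> x xL; have -> : b x = e by rewrite /b indicE memNset//= mulr0 addr0.
  by case: ifPn => [//|_]; rewrite normr0; exact: ltW.
apply: filterS2 VU UC => x VUx UCx; rewrite VUx; case: ifPn => // /negP[].
have [xL|xL] := pselect (cube (- L) L x).
  rewrite /b indicE mem_set//= mulr1; apply: (le_trans UCx).
  by rewrite (le_trans (ler_norm _))// lerDr ltW.
rewrite /b indicE memNset//= mulr0 addr0 -VUx ltW//.
by apply: (Hr L); [rewrite /L ltrDl|exact: cubeC_norm].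
Qed.

End potential.

(** One inequality for all dimensions: for [n <= 2] it holds because [p * n] is at most [2 * p].
    This is the form in which subcriticality enters [power_bound]. *)
Lemma subcritical_exponent (R : realFieldType) (n : nat) (p : R) : 0 < p ->
  ((3 <= n)%N -> p < 2 / (n%:R - 2)) -> p * n%:R < 2 * p + 2.
Proof.
move=> p0; case: (leqP 3 n) => [n3 /(_ isT)|n3 _].
  have n2 : 0 < n%:R - 2 :> R by rewrite subr_gt0 ltr_nat.
  by rewrite ltr_pdivlMr// mulrBr ltrBlDl [2 * p]mulrC.
have : n%:R <= 2 :> R by rewrite ler_nat.
by move=> /(ler_wpM2l (ltW p0)); lra.
Qed.

Lemma L2norm_sqr_cmp (R : realType) (n : nat) (u : 'rV[R]_n -> Rcomplex R) :
  in_L2 u -> L2norm u ^+ 2 = \sum_c ip (lebesgue_rV R n) (cmp c u) (cmp c u).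
Proof. by move=> uL; rewrite big_bool; exact: L2norm_sqr. Qed.

Unset Implicit Arguments.

Theorem theorem3p1 (R : realType) (n : nat) (p sigma : R) (V : 'rV[R]_n -> R)
    (Em Ep : R) (psi : R -> 'rV[R]_n -> Rcomplex R) :
  (1 <= n)%N ->
  0 < p -> ((3 <= n)%N -> p < 2 / (n%:R - 2)) ->
  in_Linfty V -> vanishes_at_infinity V ->
  0 < Em -> Em < Ep ->
  C1_H2_curve Em Ep psi ->
  (forall E, Em < E < Ep -> is_solution V p sigma (psi E) E) ->
  exists M : R, forall E, Em < E < Ep ->
    [/\ L2norm (psi E) <= M, H1norm (psi E) <= M & H2norm (psi E) <= M].
Proof.
move=> n0 p0 /(subcritical_exponent p0) pn VL V0 Em0 EmEp C1 sol.
have Em20 : 0 < Em / 2 by rewrite divr_gt0.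
have [W [C [L [mW C0 WC WL VW]]]] := clipped_potential VL V0 Em20.
have H2 E : Em < E < Ep -> in_H2 (psi E).
  by case: C1 => dpsi H /H[].
have sf c E : Em < E < Ep -> sqint (lebesgue_rV R n) (cmp c (psi E)).
  by move=> EI; apply: sqint_cmp; exact: (H2 E EI).1.1.
have S c E (EI : Em < E < Ep) := cmp_sobolev2 c (H2 E EI).
have eqn E c : Em < E < Ep -> {ae lebesgue_rV R n, forall x,
    lap c (psi E) x = W x * cmp c (psi E) x +
      sigma * ((cmp true (psi E) x ^+ 2 + cmp false (psi E) x ^+ 2) `^ p *
        cmp c (psi E) x) + E * cmp c (psi E) x}.
  move=> EI; have h := is_solution_cmp (sol E EI).
  by apply: filterS2 VW h => x -> ->.
have lip E (EI : Em < E < Ep) := C1_H2_curve_lipschitz C1 EI.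
have [M HM] := a_priori_bound n0 p0 pn Em0 EmEp mW C0 WC WL sf S eqn lip.
(* One [M] for each order of derivatives in the squared H^2 norm; the two weaker norms are partial
   sums. *)
exists (Num.sqrt (M + M + M)) => E EI; have [M0 M1 M2] := HM E EI.
have [[uL u1] u2] := H2 E EI.
have I0 := L2norm_sqr_cmp uL.
have I1 : \sum_i L2norm (weak_partial i (psi E)) ^+ 2 =
    \sum_c \sum_i ip (lebesgue_rV R n) (cmp c (weak_partial i (psi E))) 
      (cmp c (weak_partial i (psi E))).
  rewrite [RHS]exchange_big; apply: eq_bigr => i _.
  exact: (L2norm_sqr_cmp (u2 i).1).
have I2 : \sum_i \sum_j L2norm (weak_partial j (weak_partial i (psi E))) ^+ 2 =
    \sum_c \sum_i \sum_j
      ip (lebesgue_rV R n) (cmp c (weak_partial j (weak_partial i (psi E))))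
       (cmp c (weak_partial j (weak_partial i (psi E)))).
  rewrite [RHS]exchange_big; apply: eq_bigr => i _.
  rewrite [RHS]exchange_big; apply: eq_bigr => j _.
  exact: (L2norm_sqr_cmp (weak_partialP j (u2 i)).1).
rewrite -I0 in M0; rewrite -I1 in M1; rewrite -I2 in M2.
have J0 := sqr_ge0 (L2norm (psi E)).
have J1 : 0 <= \sum_i L2norm (weak_partial i (psi E)) ^+ 2.
  by apply: sumr_ge0 => i _; exact: sqr_ge0.
have J2 : 0 <= \sum_i \sum_j L2norm (weak_partial j (weak_partial i (psi E))) ^+ 2.
  by apply: sumr_ge0 => i _; apply: sumr_ge0 => j _; exact: sqr_ge0.
have N0 : L2norm (psi E) = Num.sqrt (L2norm (psi E) ^+ 2).
  by rewrite sqrtr_sqr ger0_norm//; apply: fine_ge0; exact: Lnorm_ge0.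
split; [rewrite N0|rewrite /H1norm|rewrite /H2norm]; apply: ler_wsqrtr;
  move: M0 M1 M2 J0 J1 J2; move: (_ ^+ 2) (\sum_i _) (\sum_i _) => a b d; lra.
Qed.
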